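(* Let $n\ge 2$ be an integer, let $p=n$, and let $Q_1,Q_2>1$. Let $1-1/n<\alpha_2<1<\alpha_1$ be the exponents such that $$Q_1=\frac{\alpha_1^n}{n\alpha_1-n+1}\quad\text{and}\quad Q_2=\frac{\alpha_2^n}{n\alpha_2-n+1}.$$ Let $A=\{x\in\mathbf{R}^n:1/e<|x|<1\}$, and for $x\in A$ let $$u_1(x)=(\log|ex|)^{\alpha_1},\qquad u_2(x)=1-(-\log|x|)^{\alpha_2},\qquad u=\min\{u_1,u_2\}.$$ Let $r_0\in(1/e,1)$ be the unique solution in $(1/e,1)$ of $$1=(-\log r_0)^{\alpha_2}+(\log (er_0))^{\alpha_1},$$ and let $$\widehat{Q}=Q_1(\log (er_0))^{n(\alpha_1-1)+1}+Q_2(-\log r_0)^{n(\alpha_2-1)+1}.$$ Then $$\int_A|\nabla u|^n\,dx=c_{n-1}\widehat{Q},$$ where $c_{n-1}$ is the $(n-1)$-dimensional surface area of the unit sphere $\mathbf{S}^{n-1}$, and $u$ is not a $Q$-quasisuperminimizer in $A$ for any $Q<\widehat{Q}$.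
   Context: Let $\Omega\subset\mathbf{R}^n$ be a nonempty open set, $1<p<\infty$ and $Q\ge 1$. A (real-valued) function $u\in W^{1,p}_{\rm loc}(\Omega)$ is a $Q$-quasisuperminimizer in $\Omega$ if $$\int_{\{\varphi\neq 0\}}|\nabla u|^p\,dx\le Q\int_{\{\varphi\neq 0\}}|\nabla(u+\varphi)|^p\,dx$$ for all nonnegative $\varphi\in W^{1,p}_0(\Omega)$. Here the definition is used with $p=n$. For each $Q>1$ there are exactly two exponents $\alpha',\alpha$ with $1-1/n<\alpha'<1<\alpha$ such that $Q=\alpha^n/(n\alpha-n+1)=(\alpha')^n/(n\alpha'-n+1)$. Thus $\alpha_1$ and $\alpha_2$ are uniquely determined by $Q_1$, $Q_2$ and $n$. Here $|ex|=e|x|$, where $e$ is the base of the natural logarithm. *)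

(* Defs.v *)
From HB Require Import structures.
From mathcomp Require Import all_boot all_order all_algebra.
From mathcomp Require Import all_classical all_reals all_analysis.

Set Implicit Arguments.
Unset Strict Implicit.
Unset Printing Implicit Defensive.
Import Order.TTheory GRing.Theory Num.Theory.
Import numFieldNormedType.Exports.

Local Open Scope classical_set_scope.
Local Open Scope ring_scope.

(* The measurable subsets of R^n are those of the product sigma-algebra,
   generated by the coordinate projections, that is, the Borel sets. *)
Definition rV_display : measure_display.
Proof. exact: default_measure_display. Qed.

Section measurable_rV.
Context (R : realType) (n : nat).

Let coor : 'I_n -> 'rV[R]_n -> measurableTypeR R := fun i x => x ord0 i.

Let rV_set0 : g_sigma_preimage coor set0.
Proof. exact: sigma_algebra0. Qed.

Let rV_setC A : g_sigma_preimage coor A -> g_sigma_preimage coor (~` A).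
Proof. exact: sigma_algebraC. Qed.

Let rV_bigcup (F : _^nat) : (forall i, g_sigma_preimage coor (F i)) ->
  g_sigma_preimage coor (\bigcup_i (F i)).
Proof. exact: sigma_algebra_bigcup. Qed.

HB.instance Definition _ := @isMeasurable.Build rV_display
  'rV[R]_n (g_sigma_preimage coor) rV_set0 rV_setC rV_bigcup.

Lemma measurable_coord (i : 'I_n) :
  measurable_fun [set: 'rV[R]_n] (fun x => x ord0 i : R).
Proof.
move=> _ Y mY; rewrite setTI; apply: sub_sigma_algebra => /=.
rewrite -bigcup_seq/=; exists i => /=; first by rewrite mem_index_enum.
by exists Y => //; rewrite setTI.
Qed.

Lemma measurable_fun_coordP d (T : measurableType d) (f : T -> 'rV[R]_n) :
  (forall i, measurable_fun [set: T] (fun x => f x ord0 i : R)) ->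
  measurable_fun [set: T] f.
Proof.
move=> mf.
suff : g_sigma_preimage (fun i => coor i \o f) `<=` measurable.
  rewrite g_sigma_preimage_comp => prefS _ A mA.
  by apply: prefS; exists A.
apply: smallest_sub; first exact: sigma_algebra_measurable.
rewrite -bigcup_seq/=; apply: bigcup_sub => i _ A [B mB <-].
exact: mf.
Qed.

End measurable_rV.

(* The measure of R^n.+1 = R * R^n obtained from Lebesgue measure on R and a
   measure m on R^n. *)
Section lebesgue_step.
Context (R : realType) (n : nat).
Variable m : {sigma_finite_measure set 'rV[R]_n -> \bar R}.

Definition rV_cons (xv : measurableTypeR R * 'rV[R]_n) : 'rV[R]_n.+1 :=
  row_mx (const_mx xv.1 : 'rV_1) xv.2.

Definition rV_uncons (v : 'rV[R]_n.+1) : measurableTypeR R * 'rV[R]_n :=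
  (v ord0 ord0, rsubmx (v : 'rV_(1 + n))).

Lemma rV_cons0 xv : rV_cons xv ord0 ord0 = xv.1.
Proof.
rewrite (_ : (ord0 : 'I_n.+1) = lshift n (ord0 : 'I_1)); last exact/val_inj.
apply: (etrans (row_mxEl (const_mx xv.1 : 'rV_1) xv.2 _ _)).
exact: mxE.
Qed.

Lemma rV_consS xv i : rV_cons xv ord0 (lift ord0 i) = xv.2 ord0 i.
Proof.
rewrite (_ : lift ord0 i = rshift 1 i); last exact/val_inj.
exact: (row_mxEr (const_mx xv.1 : 'rV_1)).
Qed.

Lemma rV_consK : cancel rV_cons rV_uncons.
Proof.
by move=> [x v]; rewrite /rV_uncons rV_cons0 /rV_cons row_mxKr.
Qed.

Lemma measurable_rV_cons : measurable_fun setT rV_cons.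
Proof.
apply: measurable_fun_coordP => i; case: (unliftP ord0 i) => [j|] ->.
  under eq_fun do rewrite rV_consS.
  apply: (measurableT_comp (measurable_coord (R := R) j)).
  exact: measurable_snd.
under eq_fun do rewrite rV_cons0.
exact: measurable_fst.
Qed.

Lemma measurable_rV_uncons : measurable_fun setT rV_uncons.
Proof.
apply: measurable_fun_pair; first exact: measurable_coord.
apply: measurable_fun_coordP => i; under eq_fun do rewrite mxE.
exact: measurable_coord.
Qed.

Definition lebesgue_step : set 'rV[R]_n.+1 -> \bar R :=
  pushforward (lebesgue_measure \x m)%E rV_cons.

Let step0 : lebesgue_step set0 = 0%E.
Proof. by rewrite /lebesgue_step /pushforward preimage_set0 measure0. Qed.

Let step_ge0 A : (0 <= lebesgue_step A)%E.
Proof. by rewrite /lebesgue_step /pushforward measure_ge0. Qed.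

Let step_sigma_additive : semi_sigma_additive lebesgue_step.
Proof.
rewrite /lebesgue_step => F mF tF mU.
rewrite /pushforward preimage_bigcup.
apply: measure_semi_sigma_additive.
- by move=> k; rewrite -[X in measurable X]setTI; exact: measurable_rV_cons.
- apply/trivIsetP => /= i j _ _ ij; rewrite -preimage_setI.
  by move/trivIsetP : tF => /(_ _ _ _ _ ij) ->//; rewrite preimage_set0.
- rewrite -preimage_bigcup -[X in measurable X]setTI.
  exact: measurable_rV_cons.
Qed.

HB.instance Definition _ := isMeasure.Build _ _ _ lebesgue_step
  step0 step_ge0 step_sigma_additive.

Let step_sigma_finite : sigma_finite setT lebesgue_step.
Proof.
have /sigma_finiteP[F [FT ndF Foo]] := sigma_finiteT (@lebesgue_measure R).
have /sigma_finiteP[G [GT ndG Goo]] := sigma_finiteT m.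
exists (fun k => rV_uncons @^-1` (F k `*` G k)).
  rewrite -preimage_bigcup -(preimage_setT rV_uncons) -setXTT FT GT.
  congr (_ @^-1` _); apply/seteqP; split=> [[x v] [/= [i _ Fx] [j _ Gv]]|].
    exists (maxn i j) => //; split.
    - by move: x Fx; exact/subsetPset/ndF/leq_maxl.
    - by move: v Gv; exact/subsetPset/ndG/leq_maxr.
  by move=> [x v] [k _ []/= ? ?]; split; exists k.
move=> k; have [mF Fk] := Foo k; have [mG Gk] := Goo k; split.
  rewrite -[X in measurable X]setTI; apply: measurable_rV_uncons => //.
  exact: measurableX.
rewrite /lebesgue_step /pushforward -comp_preimage.
rewrite (_ : rV_uncons \o rV_cons = id); last exact/funext/rV_consK.
by rewrite preimage_id product_measure1E// lte_mul_pinfty// ge0_fin_numE.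
Qed.

HB.instance Definition _ := Measure_isSigmaFinite.Build _ _ _ lebesgue_step
  step_sigma_finite.

End lebesgue_step.

Fixpoint lebesgue_rV (R : realType) (n : nat) :
    {sigma_finite_measure set 'rV[R]_n -> \bar R} :=
  match n with
  | 0 => @dirac _ 'rV[R]_0 0 R
  | n'.+1 => lebesgue_step (lebesgue_rV R n')
  end.

Lemma lebesgue_rV_box (R : realType) (n : nat) (A : 'I_n -> set R) :
  (forall i, measurable (A i)) ->
  lebesgue_rV R n [set x : 'rV[R]_n | forall i, A i (x ord0 i)] =
  (\prod_(i < n) lebesgue_measure (A i))%E.
Proof.
elim: n A => [|n IH] A mA /=.
  by rewrite big_ord0 diracE mem_set// => -[].
rewrite big_ord_recl -IH; last by move=> i; exact: mA.
rewrite /lebesgue_step /pushforward.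
have mB : measurable [set x : 'rV[R]_n | forall i, A (lift ord0 i) (x ord0 i)].
  rewrite (_ : mkset _ =
    \big[setI/setT]_(i < n) ((fun x : 'rV[R]_n => x ord0 i) @^-1` A (lift ord0 i))).
    apply: bigsetI_measurable => i _; rewrite -[X in measurable X]setTI.
    by apply: measurable_coord => //; exact: mA.
  rewrite -bigcap_seq; apply/seteqP; split=> x /= Ax.
    by move=> i _; exact: Ax.
  by move=> i; apply: (Ax i); rewrite /= mem_index_enum.
rewrite -product_measure1E//; last exact: mA.
congr (product_measure1 _ _ _).
apply/seteqP; split=> -[x v] /=.
- move=> Ax; split; first by have := Ax ord0; rewrite rV_cons0.
  by move=> i; have := Ax (lift ord0 i); rewrite rV_consS.
- move=> [Ax Av] i; case: (unliftP ord0 i) => [j|] ->.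
    by rewrite rV_consS; exact: Av.
  by rewrite rV_cons0.
Qed.

Section euclidean.
Context (R : realType) (n : nat).
Implicit Types (x : 'rV[R]_n) (f : 'rV[R]_n -> R).

(* The Euclidean norm; the norm `|x| of the library is the sup norm, which
   gives the same topology. *)
Definition enorm x : R := Num.sqrt (\sum_(i < n) x ord0 i ^+ 2).

Definition basis_vec (i : 'I_n) : 'rV[R]_n := delta_mx ord0 i.

Definition grad f x : 'rV[R]_n := \row_(i < n) 'D_(basis_vec i) f x.

Fixpoint Ck (k : nat) f : Prop :=
  continuous f /\
  match k with
  | 0 => True
  | k'.+1 => forall i : 'I_n, (forall x, derivable f x (basis_vec i)) /\
                              Ck k' (fun x => 'D_(basis_vec i) f x)
  end.

Definition smooth f : Prop := forall k, Ck k f.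

Definition test_function (Omega : set 'rV[R]_n) f : Prop :=
  let supp := closure [set x : 'rV[R]_n | f x != 0] in
  [/\ smooth f, compact supp & supp `<=` Omega].

End euclidean.

Section sobolev.
Context (R : realType) (n : nat).
Implicit Types (Omega D : set 'rV[R]_n) (u phi : 'rV[R]_n -> R)
  (g : 'rV[R]_n -> 'rV[R]_n) (p Q : R).
Local Notation mu := (lebesgue_rV R n).

(* Only the values of u on D matter: u \_ D is u extended by 0. Membership in
   Lfun includes Borel measurability, so that a class of L^p(D) is represented
   by its Borel representatives. *)
Definition Lp D p u : Prop := u \_ D \in Lfun mu p%:E.

Definition Lp_loc Omega p u : Prop :=
  forall K, compact K -> K `<=` Omega -> Lp K p u.

Definition weak_gradient Omega u g : Prop :=
  [/\ Lp_loc Omega 1 u,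
      forall i, Lp_loc Omega 1 (fun x => g x ord0 i) &
      forall psi, test_function Omega psi -> forall i,
        \int[mu]_(x in Omega) (u x * 'D_(basis_vec R i) psi x) =
        - \int[mu]_(x in Omega) (g x ord0 i * psi x)].

(* The weak gradient is unique up to a null set; wgrad is meaningful only for
   weakly differentiable u. *)
Definition wgrad Omega u : 'rV[R]_n -> 'rV[R]_n :=
  get [set g | weak_gradient Omega u g].

Definition W1p Omega p u : Prop :=
  Lp Omega p u /\
  exists g, weak_gradient Omega u g /\
            forall i, Lp Omega p (fun x => g x ord0 i).

Definition W1p_loc Omega p u : Prop :=
  Lp_loc Omega p u /\
  exists g, weak_gradient Omega u g /\
            forall i, Lp_loc Omega p (fun x => g x ord0 i).

(* The p-th power of the norm of W^{1,p}(Omega). *)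
Definition W1p_norm_pow Omega p u : \bar R :=
  (\int[mu]_(x in Omega) (`|u x| `^ p)%:E +
   \int[mu]_(x in Omega) (enorm (wgrad Omega u x) `^ p)%:E)%E.

(* The closure of the test functions in W^{1,p}(Omega). *)
Definition W1p_0 Omega p u : Prop :=
  W1p Omega p u /\
  forall eps : R, 0 < eps -> exists2 psi, test_function Omega psi &
    (W1p_norm_pow Omega p (u \- psi)%R < eps%:E)%E.

(* Meant for 1 < p < +oo and Q >= 1. *)
Definition quasisuperminimizer Omega p Q u : Prop :=
  W1p_loc Omega p u /\
  forall phi, W1p_0 Omega p phi -> (forall x, Omega x -> 0 <= phi x) ->
    let D := Omega `&` [set x : 'rV[R]_n | phi x != 0] in
    (\int[mu]_(x in D) (enorm (wgrad Omega u x) `^ p)%:E <=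
     Q%:E *
     \int[mu]_(x in D) (enorm (wgrad Omega (u \+ phi)%R x) `^ p)%:E)%E.

End sobolev.

(* The d-dimensional surface area of the unit sphere of R^d.+1, as twice the
   area of the graph of f(y) = sqrt (1 - |y|^2), the open upper hemisphere:
   the area of the graph of f is the integral of sqrt (1 + |grad f|^2), and the
   equator has area zero. *)
Definition sphere_area (R : realType) (d : nat) : \bar R :=
  (2%:E * \int[lebesgue_rV R d]_(y in [set y : 'rV[R]_d | (enorm y < 1)%R])
    (Num.sqrt (1 + enorm (grad (fun z => Num.sqrt (1 - enorm z ^+ 2)) y) ^+ 2))%:E)%E.

(* Main.v *)
(* Put [s = 1 + log |x|], so that [0 < s < 1] on [A], [u1 = s^a1] and
   [u2 = 1 - (1 - s)^a2]. The n-harmonic function [v = s] has the boundary values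
   of [u = min(u1, u2)] and [u < v] in [A], so [phi = v - u] is a positive element
   of [W^{1,n}_0(A)], and testing with it gives [E(u) <= Q E(v)] for the Dirichlet
   integral [E(w) = \int_A |grad w|^n].
   In polar coordinates [E(f(s)) = c_{n-1} \int_0^1 |f'(s)|^n ds]. Hence
   [E(v) = c_{n-1}]; since [u = u1] for [|x| < r0] and [u = u2] for [|x| > r0], also
   [E(u) = c_{n-1} Qhat], which forces [Q >= Qhat].
   That [phi] is in [W^{1,n}_0(A)] follows by smoothing the maximum [v - u] and
   cutting off its small values: the gradients of these test functions are
   dominated by a multiple of [(1 - s)^(a2 - 1) / |x|], which is in [L^n(A)] because
   [n (a2 - 1) + 1 > 0]. *)

Require Import Defs.
From HB Require Import structures.
From mathcomp Require Import all_boot all_order all_algebra.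
From mathcomp Require Import all_classical all_reals all_analysis.
From mathcomp Require Import measurable_realfun.
From mathcomp Require Import ring lra.
Set Implicit Arguments.
Unset Strict Implicit.
Unset Printing Implicit Defensive.
Import Order.TTheory GRing.Theory Num.Theory.
Import numFieldNormedType.Exports.
Local Open Scope classical_set_scope.
Local Open Scope ring_scope.

(** * Functions of class C^k on open sets *)

(** Each term of Qhat is one elementary integral: with s0 = 1 + log r0, \int_0^{s0} (a1 s^(a1 -
    1))^n ds = Q1 s0^(n (a1 - 1) + 1), because Q1 = a1^n / (n (a1 - 1) + 1); the part s > s0 gives
    the term with Q2 in the same way. That u equals u1 before s0 and u2 after it means that g(s) =
    s^a1 + (1 - s)^a2 crosses 1 only once in (0, 1). Its derivative is a difference of two positive
    terms whose logarithms differ by a strictly concave function, so g' cannot be >= 0, <= 0 and >=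
    0 at three increasing points. Since [wgrad] is an arbitrary choice, energies become computable
    only once weak gradients are known to be unique almost everywhere. The function u is a minimum,
    so its weak gradient is obtained by smoothing |u1 - u2| and passing to the limit. Polar
    coordinates are replaced by the map x |-> |x|^n, which carries Lebesgue measure on the unit ball
    to V times Lebesgue measure on [0, 1), with V the volume of the ball. The identity c_{n-1} = n V
    comes from slicing balls along one coordinate. *)

Section Ck_on.
Context (R : realType) (V : normedModType R) (I : Type) (e : I -> V).
Implicit Types (f g : V -> R) (U : set V).

(** Relative to a family [e] of directions, so that functions on R (one direction) and on R^n (the
    basis vectors) share the closure lemmas; local to [U], because logarithms and real powers are
    smooth only away from 0. *)
Fixpoint Ck_on U (k : nat) f : Prop :=
  (forall x, U x -> {for x, continuous f}) /\
  match k with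
  | 0 => True
  | k'.+1 => forall i : I, (forall x, U x -> derivable f x (e i)) /\
                           Ck_on U k' (fun x => 'D_(e i) f x)
  end.

Lemma Ck_on_continuous U k f x : Ck_on U k f -> U x -> {for x, continuous f}.
Proof. by case: k => [|k] [cf _]; exact: cf. Qed.

Lemma Ck_onS U k f : Ck_on U k.+1 f -> Ck_on U k f.
Proof.
elim: k f => [|k IH] f [cf Df]; split => // i; have [di Di] := Df i.
by split => //; exact: IH.
Qed.

Lemma sub_Ck_on U U' k f : U `<=` U' -> Ck_on U' k f -> Ck_on U k f.
Proof.
move=> UU'; elim: k f => [|k IH] f [cf Df]; split => //.
- by move=> x /UU'; exact: cf.
- by move=> x /UU'; exact: cf.
- by move=> i; have [di Di] := Df i; split; [move=> x /UU'; exact: di|exact: IH].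
Qed.

Lemma Ck_onU U U' k f : Ck_on U k f -> Ck_on U' k f -> Ck_on (U `|` U') k f.
Proof.
elim: k f => [|k IH] f [cf Df] [cf' Df']; split => //.
- by move=> x [/cf|/cf'].
- by move=> x [/cf|/cf'].
- move=> i; have [di Di] := Df i; have [di' Di'] := Df' i.
  by split; [move=> x [/di|/di']|exact: IH].
Qed.

Lemma eq_Ck_on U k f g : open U -> {in U, f =1 g} -> Ck_on U k f -> Ck_on U k g.
Proof.
move=> oU; elim: k f g => [|k IH] f g fg [cf Df].
  split => // x Ux; have nfg : {near x, f =1 g}.
    by apply: filterS (open_nbhs_nbhs (conj oU Ux)) => y Uy; apply: fg; rewrite inE.
  rewrite /prop_for/continuous_at -fg ?inE//; apply: cvg_trans (cf x Ux).
  exact: near_eq_cvg.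
have nfg x : U x -> {near x, f =1 g}.
  move=> Ux; apply: filterS (open_nbhs_nbhs (conj oU Ux)) => y Uy.
  by apply: fg; rewrite inE.
split=> [x Ux|i].
  rewrite /prop_for/continuous_at -fg ?inE//; apply: cvg_trans (cf x Ux).
  exact/near_eq_cvg/nfg.
have [di Di] := Df i; split=> [x Ux|].
  exact: near_eq_derivable (nfg x Ux) (di x Ux).
apply: IH Di => x; rewrite inE => Ux; apply: near_eq_derive; exact: nfg.
Qed.

(** Derivatives are local, so on an open [U] any explicit formula for them may replace the operator
    'D. *)
Lemma Ck_on_step U k f (df : I -> V -> R) : open U ->
  (forall x, U x -> {for x, continuous f}) ->
  (forall i x, U x -> is_derive x (e i) f (df i x)) ->
  (forall i, Ck_on U k (df i)) -> Ck_on U k.+1 f.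
Proof.
move=> oU cf Df Cdf; split => // i; split=> [x Ux|].
  by have [] := Df i x Ux.
apply: eq_Ck_on (Cdf i) => // x; rewrite inE => Ux.
by have [_ ->] := Df i x Ux.
Qed.

Lemma Ck_on_is_derive U k f i x : Ck_on U k.+1 f -> U x ->
  is_derive x (e i) f ('D_(e i) f x).
Proof. by move=> [_ /(_ i)[df _]] Ux; exact/derivableP/df. Qed.

Lemma Ck_on_derive U k f i : Ck_on U k.+1 f -> Ck_on U k (fun x => 'D_(e i) f x).
Proof. by move=> [_ /(_ i)[]]. Qed.

Lemma Ck_on_cst U k (c : R) : open U -> Ck_on U k (fun=> c).
Proof.
move=> oU; elim: k c => [|k IH] c; first by split => // x _; exact: cst_continuous.
apply: (@Ck_on_step _ _ _ (fun _ _ => 0)) => //.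
by move=> x _; exact: cst_continuous.
Qed.

Lemma Ck_onD U k f g : open U -> Ck_on U k f -> Ck_on U k g ->
  Ck_on U k (fun x => f x + g x).
Proof.
move=> oU; elim: k f g => [|k IH] f g Cf Cg.
  split => // x Ux.
  by apply: cvgD; [exact: (Ck_on_continuous Cf Ux)|exact: (Ck_on_continuous Cg Ux)].
apply: (@Ck_on_step _ _ _ (fun i x => 'D_(e i) f x + 'D_(e i) g x)) => //.
- move=> x Ux.
  by apply: cvgD; [exact: (Ck_on_continuous Cf Ux)|exact: (Ck_on_continuous Cg Ux)].
- move=> i x Ux; apply: is_deriveD.
    exact: (Ck_on_is_derive i Cf Ux).
  exact: (Ck_on_is_derive i Cg Ux).
- by move=> i; apply: IH; exact: Ck_on_derive.
Qed.

Lemma Ck_onM U k f g : open U -> Ck_on U k f -> Ck_on U k g ->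
  Ck_on U k (fun x => f x * g x).
Proof.
move=> oU; elim: k f g => [|k IH] f g Cf Cg.
  split => // x Ux.
  by apply: cvgM; [exact: (Ck_on_continuous Cf Ux)|exact: (Ck_on_continuous Cg Ux)].
apply: (@Ck_on_step _ _ _ (fun i x => f x * 'D_(e i) g x + g x * 'D_(e i) f x)) => //.
- move=> x Ux.
  by apply: cvgM; [exact: (Ck_on_continuous Cf Ux)|exact: (Ck_on_continuous Cg Ux)].
- move=> i x Ux; apply: is_deriveM.
    exact: (Ck_on_is_derive i Cf Ux).
  exact: (Ck_on_is_derive i Cg Ux).
- move=> i; apply: Ck_onD => //; apply: IH; do ?[exact: Ck_onS];
    exact: Ck_on_derive.
Qed.

Lemma Ck_onZ U k (c : R) f : open U -> Ck_on U k f ->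
  Ck_on U k (fun x => c * f x).
Proof. by move=> oU; apply: Ck_onM => //; exact: Ck_on_cst. Qed.

Lemma Ck_onN U k f : open U -> Ck_on U k f -> Ck_on U k (fun x => - f x).
Proof.
move=> oU /(Ck_onZ (-1) oU); apply: eq_Ck_on => // x _.
by rewrite mulN1r.
Qed.

Lemma Ck_onB U k f g : open U -> Ck_on U k f -> Ck_on U k g ->
  Ck_on U k (fun x => f x - g x).
Proof. by move=> oU Cf Cg; apply: Ck_onD => //; exact: Ck_onN. Qed.

Lemma Ck_on_prod U k (J : Type) (s : seq J) (F : J -> V -> R) : open U ->
  (forall j, Ck_on U k (F j)) -> Ck_on U k (fun x => \prod_(j <- s) F j x).
Proof.
move=> oU CF; elim: s => [|j s IH].
  by under eq_fun do rewrite big_nil; exact: Ck_on_cst.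
by under eq_fun do rewrite big_cons; exact: Ck_onM.
Qed.

Lemma Ck_on_sum U k (J : Type) (s : seq J) (F : J -> V -> R) : open U ->
  (forall j, Ck_on U k (F j)) -> Ck_on U k (fun x => \sum_(j <- s) F j x).
Proof.
move=> oU CF; elim: s => [|j s IH].
  by under eq_fun do rewrite big_nil; exact: Ck_on_cst.
by under eq_fun do rewrite big_cons; exact: Ck_onD.
Qed.

End Ck_on.

Definition Ck_R (R : realType) (U : set R) k (f : R -> R) :=
  @Ck_on R R unit (fun=> 1) U k f.

(** Restricting [f] to the line through [x] in direction [v] reduces this to the one-variable chain
    rule; directional derivability of [f] then suffices. *)
Lemma is_derive_comp_line (R : realType) (V : normedModType R) (f : V -> R)
    (g : R -> R) (x v : V) (df dg : R) :
  is_derive x v f df -> is_derive (f x) 1 g dg ->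
  is_derive x v (fun y => g (f y)) (dg * df).
Proof.
move=> [fx <-] [gx <-].
pose h (t : R) := f (t *: v + x).
have h0 : h 0 = f x by rewrite /h scale0r add0r.
have dh : derivable h 0 1 by move: (fx) => /derivable1P.
have dgh : derivable g (h 0) 1 by rewrite h0.
have E (u : V -> R) : 'D_v u x = derive1 (fun t : R => u (t *: v + x)) 0.
  rewrite derive1E /derive; set g1 := fun h : R => h^-1 *: _.
  set g2 := fun h : R => h^-1 *: _.
  suff -> : g1 = g2 by [].
  by rewrite funeqE /g1 /g2 => t /=; rewrite addr0 scale0r add0r [_%:A]mulr1.
split.
  apply/derivable1P/derivable1_diffP.
  by apply: (@differentiable_comp _ _ _ _ h g); exact/derivable1_diffP.
rewrite E; have /= -> := derive1_comp dh dgh.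
by rewrite -derive1E h0 E.
Qed.

Lemma Ck_on_comp (R : realType) (V : normedModType R) (I : Type) (e : I -> V)
    (U : set V) (W : set R) k (f : V -> R) (g : R -> R) :
  open U -> (forall x, U x -> W (f x)) ->
  Ck_on e U k f -> Ck_R W k g -> Ck_on e U k (fun x => g (f x)).
Proof.
move=> oU UW; elim: k f g UW => [|k IH] f g UW Cf Cg.
  split=> // x Ux; apply: continuous_comp; first exact: (Ck_on_continuous Cf Ux).
  exact: (Ck_on_continuous Cg (UW _ Ux)).
apply: (@Ck_on_step _ _ _ _ _ _ _
  (fun i x => 'D_1 g (f x) * 'D_(e i) f x)) => //.
- move=> x Ux; apply: continuous_comp; first exact: (Ck_on_continuous Cf Ux).
  exact: (Ck_on_continuous Cg (UW _ Ux)).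
- move=> i x Ux; apply: is_derive_comp_line.
    exact: (Ck_on_is_derive i Cf Ux).
  exact: (Ck_on_is_derive tt Cg (UW _ Ux)).
- move=> i; apply: Ck_onM => //; last exact: Ck_on_derive.
  apply: (IH f (fun y => 'D_1 g y)) => //; first exact: Ck_onS.
  exact: (Ck_on_derive tt Cg).
Qed.

(** * Smooth functions of one variable *)

Section smooth_functions.
Context (R : realType).
Implicit Types (k : nat) (x y : R).

Lemma open_gt0 : open [set x : R | 0 < x].
Proof. exact: open_gt. Qed.

Lemma Ck_R_id (U : set R) k : open U -> Ck_R U k id.
Proof.
move=> oU; case: k => [|k]; first by split => // x _; exact: cvg_id.
apply: (@Ck_on_step _ _ _ _ _ _ _ (fun _ _ => 1)) => //.
- by move=> x _; exact: cvg_id.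
- by move=> _; exact: Ck_on_cst.
Qed.

Lemma Ck_R_powR k (a : R) : Ck_R [set x | 0 < x] k (fun x => x `^ a).
Proof.
have c0 (b : R) x : 0 < x -> {for x, continuous (@powR R ^~ b)}.
  move=> x0; apply: differentiable_continuous; apply/derivable1_diffP.
  by apply: derivable_powR; rewrite in_itv/= x0.
elim: k a => [|k IH] a; first by split => // x; exact: c0.
apply: (@Ck_on_step _ _ _ _ _ _ _ (fun _ x => a * x `^ (a - 1))).
- exact: open_gt0.
- by move=> x; exact: c0.
- by move=> _; exact: (Ck_onZ a open_gt0 (IH (a - 1))).
Qed.

Lemma Ck_R_ln k : Ck_R [set x | 0 < x] k (@ln R).
Proof.
case: k => [|k]; first by split => // x; exact: continuous_ln.
apply: (@Ck_on_step _ _ _ _ _ _ _ (fun _ x => x `^ (-1))).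
- exact: open_gt0.
- by move=> x; exact: continuous_ln.
- by move=> _ x /= x0; rewrite powR_inv1 ?ltW//; exact: is_derive1_ln.
- by move=> _; exact: (Ck_R_powR k (-1)).
Qed.

(** For k = 0 this is the classical flat function. The powers y^-k are included because
    differentiation produces them: the linear span of the family is closed under derivatives, which
    is what the induction for smoothness uses. *)
Definition flat_pow k y := if 0 < y then y ^- k * expR (- y^-1) else 0.

(** Reciprocal form of exp x >= x^k / k! at x = 1 / y. *)
Lemma expRNV_le k y : 0 < y -> expR (- y^-1) <= k`!%:R * y ^+ k.
Proof.
move=> y0; have y'0 : 0 < y^-1 by rewrite invr_gt0.
have k0 : 0 < k`!%:R :> R by rewrite ltr0n fact_gt0.
case: k k0 => [_|k k0].
  by rewrite fact0 expr0 mulr1 -expR0 ler_expR oppr_le0 ltW.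
rewrite expRN -[leRHS]invrK lef_pV2 ?posrE ?expR_gt0 ?invr_gt0 ?mulr_gt0 ?exprn_gt0//.
rewrite invfM mulrC -exprVn; apply: le_trans (expR_ge1Dxn k (ltW y'0)).
by rewrite lerDr.
Qed.

Lemma flat_pow_ge0 k y : 0 <= flat_pow k y.
Proof.
rewrite /flat_pow; case: ifPn => // y0.
by rewrite mulr_ge0 ?expR_ge0// invr_ge0 exprn_ge0// ltW.
Qed.

(** A quadratic bound is what gives every member of the family derivative 0 at the origin. *)
Lemma flat_pow_le k y : flat_pow k y <= k.+2`!%:R * y ^+ 2.
Proof.
rewrite /flat_pow; case: ifPn => y0; last by rewrite mulr_ge0// sqr_ge0.
rewrite -ler_pdivlMl ?invr_gt0 ?exprn_gt0// invrK mulrCA -exprD addn2.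
exact: expRNV_le.
Qed.

Lemma is_derive_flat_pow k y :
  is_derive y 1 (flat_pow k) (flat_pow k.+2 y - k%:R * flat_pow k.+1 y).
Proof.
have [y0|y0|->] := ltgtP y 0.
- rewrite /flat_pow ltNge (ltW y0)/= mulr0 subr0.
  apply: (@near_eq_is_derive _ _ _ (fun=> 0)).
  near=> z; rewrite ltNge ltW//=; near: z; exact: lt_nbhsl.
- have yn0 : y != 0 by rewrite gt_eqF.
  apply: (@near_eq_is_derive R R R (fun z : R => z ^- k * expR (- z^-1))).
    by near=> z; rewrite /flat_pow ifT//; near: z; exact: lt_nbhsr.
  have dV : is_derive y 1 (fun z : R => z^-1) (- y ^- 2).
    split; first exact: derivableV.
    by rewrite (@deriveV _ _ id)// derive_id [_ *: _]mulr1.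
  have dVk : is_derive y 1 (fun z : R => z ^- k) (- (k%:R * y ^- k.+1)).
    have -> : (fun z : R => z ^- k) = (fun z => z^-1) ^+ k.
      by apply/funext => z; rewrite exprfctE exprVn.
    apply: is_derive_eq; rewrite /GRing.scale/= mulrN; congr (- _).
    case: k => [|k]; first by rewrite !mul0r.
    by rewrite -mulrA -!exprVn -exprD addn2.
  have dE : is_derive y 1 (fun z : R => expR (- z^-1)) (expR (- y^-1) * - - y ^- 2).
    by apply: is_derive_comp_line.
  suff -> : flat_pow k.+2 y - k%:R * flat_pow k.+1 y =
      y ^- k *: (expR (- y^-1) * - - y ^- 2) + expR (- y^-1) *: (- (k%:R * y ^- k.+1)).
    exact: is_deriveM dVk dE.
  rewrite /flat_pow y0 opprK /GRing.scale/= -!exprVn.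
  have -> : y^-1 ^+ k.+2 = y^-1 ^+ k * y^-1 ^+ 2 by rewrite -exprD addn2.
  move: (expR _) (y^-1 ^+ k) (y^-1 ^+ k.+1) (y^-1 ^+ 2) => E a b c.
  by ring.
rewrite /flat_pow ltxx mulr0 subr0.
(* By [flat_pow_le] the difference quotient at 0 is at most a constant times |h|. *)
have H : (fun h : R => h^-1 *: ((flat_pow k \o shift 0) (h *: 1) - flat_pow k 0))
    @ 0^' --> (0 : R).
  apply/cvgr0Pnorm_le => e e0; near=> h.
  have h0 : h != 0 by near: h; exact: nbhs_dnbhs_neq.
  rewrite /= addr0 [_%:A]mulr1 {2}/flat_pow ltxx subr0 normrZ normfV.
  rewrite ler_pdivrMl ?normr_gt0// ger0_norm ?flat_pow_ge0//.
  rewrite (le_trans (flat_pow_le _ _))// -real_normK ?num_real// expr2.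
  rewrite mulrCA ler_wpM2l// -ler_pdivlMl ?ltr0n ?fact_gt0//.
  near: h; apply: dnbhs0_le.
  by rewrite mulr_gt0// invr_gt0 ltr0n fact_gt0.
by split; [apply/cvg_ex; exists 0|exact: cvg_lim].
Unshelve. all: by end_near. Qed.

Lemma Ck_R_flat_pow k m : Ck_R setT k (flat_pow m).
Proof.
have c m' x : {for x, continuous (flat_pow m')}.
  apply: differentiable_continuous; apply/derivable1_diffP.
  by have [] := is_derive_flat_pow m' x.
elim: k m => [|k IH] m; first by split.
apply: (@Ck_on_step _ _ _ _ _ _ _
  (fun _ y => flat_pow m.+2 y - m%:R * flat_pow m.+1 y)) => //.
- exact: openT.
- by move=> _ x _; exact: is_derive_flat_pow.
- move=> _; apply: Ck_onB; [exact: openT|exact: IH|].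
  by apply: Ck_onZ; [exact: openT|exact: IH].
Qed.

End smooth_functions.

Section coordinates.
Context (R : realType) (n : nat).

Lemma is_derive_coord (x v : 'rV[R]_n) i :
  is_derive x v (fun y : 'rV[R]_n => y ord0 i : R) (v ord0 i).
Proof.
have H : (fun h : R => h^-1 *: ((((fun y : 'rV[R]_n => y ord0 i : R)) \o shift x) (h *: v) - x ord0 i)) @ 0^' --> v ord0 i.
  apply: cvg_near_cst; near=> h.
  rewrite /= !mxE addrK /GRing.scale/= mulrA mulVf ?mul1r//.
  by near: h; exact: nbhs_dnbhs_neq.
by split; [apply/cvg_ex; exists (v ord0 i)|exact: cvg_lim].
Unshelve. all: by end_near. Qed.

Lemma Ck_on_coord (U : set 'rV[R]_n) k i : open U ->
  Ck_on (@basis_vec R n) U k (fun y : 'rV[R]_n => y ord0 i : R).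
Proof.
move=> oU; case: k => [|k].
  by split => // x _; exact: (@coord_continuous R 1 n ord0 i).
apply: (@Ck_on_step _ _ _ _ _ _ _ (fun j _ => basis_vec R j ord0 i)) => //.
- by move=> x _; exact: (@coord_continuous R 1 n ord0 i).
- by move=> j x _; exact: is_derive_coord.
- by move=> j; exact: Ck_on_cst.
Qed.

Lemma Ck_onT (k : nat) (f : 'rV[R]_n -> R) :
  Ck_on (@basis_vec R n) setT k f <-> Ck k f.
Proof.
elim: k f => [|k IH] f; split => -[cf Df]; split => //.
- by move=> x; exact: cf.
- by move=> x _; exact: cf.
- by move=> x; exact: cf.
- by move=> i; have [di Di] := Df i; split; [move=> x; exact: di|exact/IH].
- by move=> x _; exact: cf.
- by move=> i; have [di Di] := Df i; split; [move=> x _; exact: di|exact/IH].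
Qed.

End coordinates.

(** * Lebesgue measure on R^n *)

Section boxes.
Context (R : realType) (n : nat).
Implicit Types (a b : 'I_n -> R) (U : set 'rV[R]_n).
Local Notation mu := (lebesgue_rV R n).

Definition obox a b := [set x : 'rV[R]_n | forall i, `]a i, b i[%classic (x ord0 i)].
Definition cbox a b := [set x : 'rV[R]_n | forall i, `[a i, b i]%classic (x ord0 i)].

Lemma obox_cbox a b : obox a b `<=` cbox a b.
Proof. by move=> x ab i; apply: subset_itv_oo_cc; exact: ab. Qed.

Lemma cbox_compact a b : compact (cbox a b).
Proof.
apply: (@rV_compact R n (fun i => `[a i, b i]%classic)) => i.
exact: segment_compact.
Qed.

Lemma measurable_coord_box (A : 'I_n -> set R) : (forall i, measurable (A i)) ->
  measurable [set x : 'rV[R]_n | forall i, A i (x ord0 i)].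
Proof.
move=> mA; rewrite (_ : mkset _ = \big[setI/setT]_(i < n)
  ((fun x : 'rV[R]_n => x ord0 i) @^-1` A i)).
  apply: bigsetI_measurable => i _; rewrite -[X in measurable X]setTI.
  by apply: measurable_coord => //; exact: mA.
rewrite -bigcap_seq; apply/seteqP; split=> x /= Ax.
  by move=> i _; exact: Ax.
by move=> i; apply: (Ax i); rewrite /= mem_index_enum.
Qed.

Lemma measurable_obox a b : measurable (obox a b).
Proof. by apply: (@measurable_coord_box (fun i => `]a i, b i[%classic)) => i; exact: measurable_itv. Qed.

Lemma measurable_cbox a b : measurable (cbox a b).
Proof. by apply: (@measurable_coord_box (fun i => `[a i, b i]%classic)) => i; exact: measurable_itv. Qed.

Lemma lebesgue_rV_obox a b :
  mu (obox a b) = (\prod_(i < n) (Num.max 0 (b i - a i))%:E)%E.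
Proof.
rewrite /obox (lebesgue_rV_box (A := fun i => `]a i, b i[%classic)); last by move=> i; exact: measurable_itv.
apply: eq_bigr => i _; rewrite lebesgue_measure_itv/= lte_fin -EFinB.
by rewrite /Num.max subr_gt0; case: ifP.
Qed.

Lemma lebesgue_rV_cbox a b :
  mu (cbox a b) = (\prod_(i < n) (Num.max 0 (b i - a i))%:E)%E.
Proof.
rewrite /cbox (lebesgue_rV_box (A := fun i => `[a i, b i]%classic)); last by move=> i; exact: measurable_itv.
apply: eq_bigr => i _; rewrite lebesgue_measure_itv/= lte_fin -EFinB.
by rewrite /Num.max subr_gt0; case: ifP.
Qed.

Lemma lebesgue_rV_cbox_lty a b : (mu (cbox a b) < +oo)%E.
Proof. by rewrite lebesgue_rV_cbox prodEFin ltry. Qed.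

(** Boxes with rational corners, enumerated through [unpickle]. The closed boxes lie in [U], so that
    local integrability applies to each, while the open boxes already cover [U]. *)
Lemma open_bigcup_boxes U : open U -> exists (D : set nat) (a b : nat -> 'I_n -> R),
  (forall k, D k -> cbox (a k) (b k) `<=` U) /\
  U = \bigcup_(k in D) obox (a k) (b k).
Proof.
move=> oU.
pose T := {ffun 'I_n -> rat * rat}.
pose al (f : T) i : R := ratr (f i).1.
pose be (f : T) i : R := ratr (f i).2.
pose g k : T := odflt [ffun=> (0%Q, 0%Q)] (unpickle k).
exists [set k | cbox (al (g k)) (be (g k)) `<=` U], (fun k => al (g k)), (fun k => be (g k)).
split=> //; apply/seteqP; split => [x Ux|x [k /= kU /obox_cbox]]; last exact: kU.
have /nbhs_ballP[e/= e0 xeU] : nbhs x U by exact: open_nbhs_nbhs.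
have H i : exists pq : rat * rat, [/\ x ord0 i - e < ratr pq.1, ratr pq.1 < x ord0 i,
    x ord0 i < ratr pq.2 & ratr pq.2 < x ord0 i + e].
  have [|p /[!in_itv]/= /andP[p1 p2]] := @rat_in_itvoo R (x ord0 i - e) (x ord0 i).
    by rewrite ltrBlDr ltrDl.
  have [|q /[!in_itv]/= /andP[q1 q2]] := @rat_in_itvoo R (x ord0 i) (x ord0 i + e).
    by rewrite ltrDl.
  by exists (p, q).
have [f Hf] := fin_all_exists H.
exists (pickle [ffun i => f i]) => /=.
  rewrite /g pickleK/= => y; rewrite /cbox/= => yab; apply: xeU.
  split => // i j; rewrite ord1.
  have := yab j; rewrite /al /be !ffunE in_itv/= => /andP[y1 y2].
  have [h1 h2 h3 h4] := Hf j.
  rewrite /ball/= ltr_norml; apply/andP; split; lra.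
move=> i; rewrite /g pickleK/= /al /be !ffunE /= in_itv/=.
by have [h1 h2 h3 h4] := Hf i; rewrite h2 h3.
Qed.

Lemma open_measurable_rV U : open U -> measurable U.
Proof.
move=> /open_bigcup_boxes[D [a [b [_ ->]]]].
by apply: bigcup_measurable => k _; exact: measurable_obox.
Qed.

Lemma closed_measurable_rV U : closed U -> measurable U.
Proof.
by move=> cU; rewrite -[U]setCK; apply: measurableC; apply: open_measurable_rV;
  exact: closed_openC.
Qed.

Lemma compact_measurable_rV U : compact U -> measurable U.
Proof.
move=> cU; apply: closed_measurable_rV; exact: compact_closed.
Qed.

Lemma continuous_measurable_rV U (f : 'rV[R]_n -> R) : open U ->
  (forall x, U x -> {for x, continuous f}) -> measurable_fun U f.
Proof.
move=> oU cf; move=> mU; apply: (measurability _ (RGenOInfty.measurableE R)) => //.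
move=> _ [_ [r ->] <-]; apply: open_measurable_rV.
rewrite openE => x [Ux /= fx]; rewrite /interior.
have : nbhs x (f @^-1` `]r, +oo[%classic).
  by apply: cf => //; apply: open_nbhs_nbhs; split => //; exact: rray_open.
by apply: filterS2 (open_nbhs_nbhs (conj oU Ux)) => y Uy fy.
Qed.

Definition oboxes : set (set 'rV[R]_n) :=
  [set A | exists a b, A = obox a b].

Lemma oboxes_setI : setI_closed oboxes.
Proof.
move=> _ _ [a [b ->]] [a' [b' ->]].
exists (fun i => Num.max (a i) (a' i)), (fun i => Num.min (b i) (b' i)).
apply/seteqP; split=> [x [/= xab xab'] i|x /= xab].
  have := xab i; have := xab' i; rewrite /= !in_itv/= gt_max lt_min.
  by move=> /andP[-> ->] /andP[-> ->].
by split => i; have := xab i; rewrite /= !in_itv/= gt_max lt_min =>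
  /andP[/andP[? ?]/andP[? ?]]; apply/andP.
Qed.

Definition ocube (m : nat) := obox (fun=> - m%:R) (fun=> m%:R).

Lemma bigcup_ocube : \bigcup_m ocube m = [set: 'rV[R]_n].
Proof.
apply/seteqP; split => // x _.
pose M := \sum_(i < n) `|x ord0 i|.
have M0 : 0 <= M by exact: sumr_ge0.
exists (Num.truncn M).+1 => // i /=.
rewrite in_itv/= -ltr_norml (le_lt_trans _ (truncnS_gt _))//.
by rewrite /M (bigD1 i)//= lerDl sumr_ge0.
Qed.

(** The product sigma-algebra is generated by the half-spaces x_i > r, and each of these is a
    countable union of open boxes. *)
Lemma measurable_oboxes : measurable = <<s oboxes >>.
Proof.
apply/seteqP; split; last first.
  apply: smallest_sub; first exact: sigma_algebra_measurable.
  by move=> _ [a [b ->]]; exact: measurable_obox.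
apply: smallest_sub; first exact: smallest_sigma_algebra.
rewrite -bigcup_seq/=; apply: bigcup_sub => i _ A [B mB <-].
rewrite setTI; move: B mB.
suff : @measurable _ (measurableTypeR R) `<=`
    image_set_system setT (fun x : 'rV[R]_n => x ord0 i) <<s oboxes >>.
  by move=> + B mB => /(_ B mB); rewrite /image_set_system/= setTI.
rewrite [X in X `<=` _](RGenOInfty.measurableE R); apply: smallest_sub.
  exact/sigma_algebra_image/smallest_sigma_algebra.
move=> _ [r ->]; rewrite /image_set_system/= setTI.
rewrite (_ : _ @^-1` _ =
    \bigcup_m obox (fun j => if j == i then r else - m%:R) (fun=> m%:R)).
  by apply: sigma_algebra_bigcup => m; apply: sub_sigma_algebra; do 2!eexists.
apply/seteqP; split=> [x /= xr|x [m _ /(_ i)]]; last first.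
  by rewrite eqxx/= !in_itv/= => /andP[->].
have [m _ xm] : (\bigcup_m ocube m) x by rewrite bigcup_ocube.
exists m => // j; have := xm j; case: eqP => [->|//].
by move: xr; rewrite /= !in_itv/= andbT => -> /andP[_ ->].
Qed.

(** Open boxes form a generating pi-system, and the cubes [ocube] exhaust the space. *)
Lemma measure_rV_unique (m1 m2 : {measure set 'rV[R]_n -> \bar R}) :
  (forall a b, m1 (obox a b) = m2 (obox a b)) ->
  (forall a b, m1 (obox a b) < +oo)%E ->
  forall A, measurable A -> m1 A = m2 A.
Proof.
move=> m12 m1oo; apply: (measure_unique oboxes ocube).
- exact: measurable_oboxes.
- exact: oboxes_setI.
- by move=> i; do 2!eexists.
- exact: bigcup_ocube.
- by move=> _ [a [b ->]].
- by move=> k; exact: m1oo.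
Qed.

Lemma measurable_scale_shift (t : R) (c : 'rV[R]_n) :
  measurable_fun setT (fun x : 'rV[R]_n => t *: x + c).
Proof.
apply: measurable_fun_coordP => i; under eq_fun do rewrite !mxE.
apply: measurable_funD => //; apply: measurable_funM => //.
exact: measurable_coord.
Qed.

(** Preimages of boxes are boxes with sides divided by [t], so the two measures of [A] agree on
    boxes. *)
Lemma lebesgue_rV_scale_shift (t : R) (c : 'rV[R]_n) A : 0 < t -> measurable A ->
  mu ((fun x => t *: x + c) @^-1` A) = ((t ^- n)%:E * mu A)%E.
Proof.
move=> t0; have tn0 : 0 <= t ^- n by rewrite invr_ge0 exprn_ge0 ?ltW.
pose S (x : 'rV[R]_n) := t *: x + c.
have mS : measurable_fun setT S by exact: measurable_scale_shift.
have E a b : mu (S @^-1` obox a b) = ((t ^- n)%:E * mu (obox a b))%E.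
  have -> : S @^-1` obox a b = obox (fun i => (a i - c ord0 i) / t) (fun i => (b i - c ord0 i) / t).
    apply/seteqP; split=> x /= xab i; have := xab i; rewrite /= !in_itv/= !mxE;
      rewrite ltr_pdivrMr// ltr_pdivlMr// ltrBlDr ltrBrDr [t * _]mulrC//.
  rewrite !lebesgue_rV_obox !prodEFin -EFinM; congr _%:E.
  have -> : t ^- n = \prod_(i < n) t^-1 by rewrite prodr_const card_ord exprVn.
  rewrite -big_split/=; apply: eq_bigr => i _.
  rewrite -mulrBl opprB addrA subrK mulrC maxr_pMr ?invr_ge0 ?ltW//.
  by rewrite mulr0.
move: A; pose k : {nonneg R} := NngNum tn0.
apply: (@measure_rV_unique (pushforward mu S) (mscale k mu)).
  by move=> a b; exact: E.
move=> a b; suff : (mu (S @^-1` obox a b) < +oo)%E by [].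
by rewrite E lebesgue_rV_obox prodEFin -EFinM ltry.
Qed.

Lemma lebesgue_rV_shift (c : 'rV[R]_n) A : measurable A ->
  mu ((fun x => x + c) @^-1` A) = mu A.
Proof.
move=> mA; have := lebesgue_rV_scale_shift c ltr01 mA.
by rewrite expr1n invr1 mul1e => <-; congr (mu _); apply/seteqP; split => x /=;
  rewrite scale1r.
Qed.

Lemma lebesgue_rV_scale (t : R) (A : set 'rV[R]_n) : 0 < t -> measurable A ->
  mu ((fun x => t *: x) @^-1` A) = ((t ^- n)%:E * mu A)%E.
Proof.
move=> t0 mA; rewrite -(lebesgue_rV_scale_shift 0 t0 mA).
by congr (mu _); apply/seteqP; split => x /=; rewrite addr0.
Qed.

End boxes.

(** * Weak gradients *)

Section integration_by_parts.
Context (R : realType) (n : nat).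
Implicit Types (x : 'rV[R]_n) (K Omega : set 'rV[R]_n) (f w psi : 'rV[R]_n -> R).
Local Notation mu := (lebesgue_rV R n).
Local Notation e_ := (@basis_vec R n).

Lemma compact_bounded_fun (T : topologicalType) (A : set T) (f : T -> R) :
  compact A -> (forall t, A t -> {for t, continuous f}) ->
  exists2 M : R, 0 < M & forall t, A t -> `|f t| <= M.
Proof.
move=> cA cf.
have /ex_strict_bound_gt0[M M0 HM] : bounded_set (f @` A).
  apply/compact_bounded/continuous_compact => //.
  by apply: continuous_in_subspaceT => x; rewrite inE; exact: cf.
by exists M => // x Ax; apply/ltW/HM; exists x.
Qed.

Lemma compact_cube K : compact K -> exists2 B : R, 0 < B &
  forall C, B <= C -> K `<=` cbox (fun=> - C) (fun=> C).
Proof.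
move=> /compact_bounded/ex_strict_bound_gt0[M M0 HM]; exists M => // C MC x Kx i.
rewrite /= in_itv/= -ler_norml (le_trans _ MC)//.
apply: le_trans (ltW (HM x Kx)).
rewrite [leRHS]/Num.norm/= mx_normrE.
by apply/bigmax_geP; right => /=; exists (ord0, i).
Qed.

Lemma compact_lebesgue_rV_lty K : compact K -> (mu K < +oo)%E.
Proof.
move=> cK; have [B _ /(_ B (lexx B)) KB] := compact_cube cK.
apply: le_lt_trans (lebesgue_rV_cbox_lty (fun=> - B) (fun=> B)).
by apply: le_measure => //; rewrite inE; [exact: compact_measurable_rV|exact: measurable_cbox].
Qed.

Lemma LpE K u : measurable K -> Lp K 1 u <-> mu.-integrable K (EFin \o u).
Proof.
move=> mK; rewrite /Lp Lfun1_integrable [X in _ <-> X](integrable_mkcond _ mK).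
suff -> : EFin \o (u \_ K) = (EFin \o u) \_ K by split.
by apply/funext => x; rewrite /= !patchE; case: ifP.
Qed.

Lemma continuous_Lp_loc Omega u : 
  (forall x, Omega x -> {for x, continuous u}) -> open Omega -> Lp_loc Omega 1 u.
Proof.
move=> cu oO K cK KO; apply/LpE; first exact: compact_measurable_rV.
have [M M0 HM] := compact_bounded_fun cK (fun x Kx => cu x (KO x Kx)).
apply: measurable_bounded_integrable.
- exact: compact_measurable_rV.
- exact: compact_lebesgue_rV_lty.
- apply: measurable_funS (continuous_measurable_rV oO cu) => //.
  exact: open_measurable_rV.
- exists M; split; first by rewrite num_real.
  by move=> r Mr x Kx; apply: le_trans (ltW Mr); exact: HM.
Qed.

(** The product vanishes off [K] and [b] is bounded on [K]. Every pairing with a test function or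
    its derivatives is integrable for this reason. *)
Lemma integrable_Lp_loc Omega K u (b : 'rV[R]_n -> R) : open Omega -> compact K -> K `<=` Omega ->
  Lp_loc Omega 1 u -> continuous b -> (forall x, ~ K x -> b x = 0) ->
  mu.-integrable Omega (EFin \o (fun x => u x * b x)).
Proof.
move=> oO cK KO Lu cb b0.
have mO := open_measurable_rV oO; have mK := compact_measurable_rV cK.
have [M M0 HM] := compact_bounded_fun cK (fun x _ => cb x).
have /LpE-/(_ mK) iu := Lu K cK KO.
apply/integrable_mkcond => //.
rewrite (_ : _ \_ _ = ((EFin \o u) \_ K) \* (EFin \o b))%E.
  apply: integrableMl => //.
  - by apply/(integrable_mkcond _ mK).
  - by apply: (continuous_measurable_rV openT) => x _; exact: cb.
  - exists M; split; first by rewrite num_real.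
    move=> r Mr x _; apply: le_trans (ltW Mr).
    by have [/HM//|/b0 ->] := pselect (K x); rewrite normr0 ltW.
apply/funext => x; rewrite !patchE.
have [Kx|nKx] := pselect (K x).
  by rewrite !mem_set ?EFinM//; exact: KO.
rewrite /= b0// (memNset nKx) mul0e; case: ifP => // _.
by rewrite mulr0.
Qed.

Lemma integral_shift (c : 'rV[R]_n) w : measurable_fun setT w ->
  mu.-integrable setT (EFin \o w) ->
  mu.-integrable setT (EFin \o (fun x => w (x + c))) /\
  (\int[mu]_x (w (x + c)%R)%:E = \int[mu]_x (w x)%:E)%E.
Proof.
move=> mw iw.
pose S (x : 'rV[R]_n) := x + c.
have mS : measurable_fun setT S.
  have := measurable_scale_shift 1 c.
  by congr measurable_fun; apply/funext => x; rewrite scale1r.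
have mw' : measurable_fun setT (EFin \o w) by exact/measurable_EFinP.
have E (f : 'rV[R]_n -> \bar R) : (\int[pushforward mu S]_x f x =
    \int[mu]_x f x)%E.
  by apply: eq_measure_integral => A mA _; exact: lebesgue_rV_shift.
have iw' : mu.-integrable setT (EFin \o (fun x => w (x + c))).
  apply/integrableP; split.
    by apply/measurable_EFinP; exact: measurableT_comp mw mS.
  move/integrableP : iw => [_]; rewrite -[X in (X < _)%E -> _]E.
  rewrite ge0_integral_pushforward//.
  exact: measurableT_comp.
split=> //.
by rewrite -[RHS]E (@integral_pushforward _ _ _ _ _ _ mS mu setT (EFin \o w) mw').
Qed.

Lemma line_MVT w i x (t M : R) : 0 < t ->
  (forall s, 0 <= s <= t -> is_derive (s *: e_ i + x) (e_ i) w ('D_(e_ i) w (s *: e_ i + x))) ->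
  (forall s, 0 <= s <= t -> `|'D_(e_ i) w (s *: e_ i + x)| <= M) ->
  `|w (t *: e_ i + x) - w x| <= M * t.
Proof.
move=> t0 dw bw.
pose g (s : R) := w (s *: e_ i + x).
have dg s : 0 <= s <= t -> is_derive s 1 g ('D_(e_ i) w (s *: e_ i + x)).
  move=> /dw [d D].
  have gs : g = (fun r : R => (fun h : R => w (h *: e_ i + (s *: e_ i + x))) (r - s)).
    by apply/funext => r; rewrite /g addrA -scalerDl subrK.
  have d0 : is_derive (s - s) 1 (fun h : R => w (h *: e_ i + (s *: e_ i + x))) ('D_(e_ i) w (s *: e_ i + x)).
    rewrite subrr; split; first by move: d => /derivable1P.
    rewrite /derive; set g1 := fun h : R => h^-1 *: _.
    set g2 := fun h : R => h^-1 *: _.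
    suff -> : g1 = g2 by [].
    by rewrite funeqE /g1 /g2 => r /=; rewrite addr0 scale0r add0r [_%:A]mulr1.
  rewrite gs -[X in is_derive _ _ _ X]mulr1.
  have ds : is_derive s 1 (fun r : R => r - s) 1.
    by apply: is_derive_eq; rewrite subr0.
  exact: (is_derive_comp_line ds d0).
have dg' s : s \in `]0, t[%R -> is_derive s 1 g ('D_(e_ i) w (s *: e_ i + x)).
  by rewrite in_itv/= => /andP[s0 st]; apply: dg; rewrite !ltW.
have cg : {within `[0, t], continuous g}.
  apply: derivable_within_continuous => s /[!in_itv]/= st.
  by have [] := dg s st.
have [c /[!in_itv]/= /andP[c0 ct] Hc] := MVT t0 dg' cg.
have -> : w x = g 0 by rewrite /g scale0r add0r.
rewrite Hc subr0 normrM (gtr0_norm t0) ler_wpM2r ?(ltW t0)//.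
by apply: bw; rewrite !ltW.
Qed.

(** Translation invariance makes the integral of each difference quotient vanish; the quotients
    converge boundedly on a fixed cube. *)
Lemma integral_derive_compact0 w K i : compact K ->
  Ck_on e_ setT 1 w -> (forall x, ~ K x -> w x = 0) ->
  (\int[mu]_x ('D_(e_ i) w x)%:E = 0)%E.
Proof.
move=> cK Cw w0.
have dw x : is_derive x (e_ i) w ('D_(e_ i) w x) by exact: (Ck_on_is_derive i Cw).
have cw x : {for x, continuous w} by exact: (Ck_on_continuous Cw).
have cdw x : {for x, continuous (fun x => 'D_(e_ i) w x)}.
  exact: (Ck_on_continuous (Ck_on_derive i Cw)).
have [B B0 KB] := compact_cube cK.
pose Q C := @cbox R n (fun=> - C) (fun=> C).
(* Steps have length at most 1, so the quotients live in the cube of half-side B + 1, and the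
   segments starting there stay in the cube of half-side B + 2. *)
have [M M0 HM] := compact_bounded_fun (f := fun x => 'D_(e_ i) w x)
  (@cbox_compact R n (fun=> - (B + 2)) (fun=> B + 2)) (fun x _ => cdw x).
pose h (m : nat) : R := m.+1%:R^-1.
have h0 m : 0 < h m by rewrite invr_gt0 ltr0n.
have h1 m : h m <= 1 by rewrite invf_le1 ?ltr0n// ler1n.
pose f_ m x := (h m)^-1 * (w (x + h m *: e_ i) - w x).
have mw : measurable_fun setT w by apply: (continuous_measurable_rV openT).
have Bcoord j (s : R) : 0 <= s <= 1 -> `|(s *: e_ i) ord0 j| <= 1.
  move=> /andP[s0 s1]; rewrite !mxE/=; case: (_ == _); rewrite ?mulr1 ?mulr0 ?normr0//.
  by rewrite ger0_norm.
have Qadd C x s : 0 <= s <= 1 -> Q C x -> Q (C + 1) (s *: e_ i + x).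
  move=> s01 Qx j; have := Qx j; have := Bcoord j s s01; rewrite /= !in_itv/=.
  by rewrite [(_ + x) _ _]mxE ler_norml => /andP[? ?] /andP[? ?]; apply/andP; split; lra.
have Qsub C x s : 0 <= s <= 1 -> Q C (s *: e_ i + x) -> Q (C + 1) x.
  move=> s01 Qx j; have := Qx j; have := Bcoord j s s01; rewrite /= !in_itv/=.
  by rewrite [(_ + x) _ _]mxE ler_norml => /andP[? ?] /andP[? ?]; apply/andP; split; lra.
have iw : mu.-integrable setT (EFin \o w).
  have L1 : Lp_loc setT 1 (cst 1 : 'rV[R]_n -> R).
    by apply: continuous_Lp_loc openT => x _; exact: cst_continuous.
  have := integrable_Lp_loc openT cK (@subsetT _ _) L1 cw w0.
  by congr (_.-integrable _ (EFin \o _)); apply/funext => x; rewrite mul1r.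
have If m : mu.-integrable setT (EFin \o f_ m) /\ (\int[mu]_x (f_ m x)%:E = 0)%E.
  have [iS eS] := integral_shift (h m *: e_ i) mw iw.
  pose dm x := w (x + h m *: e_ i) - w x.
  have iB : mu.-integrable setT (EFin \o dm) by exact: (integrableB measurableT iS iw).
  split; first exact: (integrableZl _ (h m)^-1 iB).
  under eq_integral do rewrite /f_ EFinM.
  rewrite (integralZl measurableT iB) integralB_EFin// eS subee ?mule0//.
  exact: integrable_fin_num.
pose g := (EFin \o cst M) \_ (Q (B + 1)).
have [] := @dominated_convergence _ _ _ mu setT measurableT
  (fun m => EFin \o f_ m) (EFin \o (fun x => 'D_(e_ i) w x)) g.
- by move=> m; have [/integrableP[]] := If m.
- apply/measurable_EFinP; exact: (continuous_measurable_rV openT).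
- apply/aeW => x _; apply/cvg_EFin; first by apply: nearW.
  have [dx _] := dw x; have /cvgr_dnbhsP := dx.
  move=> /(_ h (conj (fun m => lt0r_neq0 (h0 m)) (@cvg_harmonic R))) H.
  apply: (cvg_trans _ H); apply: near_eq_cvg; apply: nearW => m /=.
  by rewrite /f_ [x + _]addrC.
- apply/(integrable_mkcond _ (measurable_cbox _ _)).
  apply: measurable_bounded_integrable => //.
  - exact: measurable_cbox.
  - exact: lebesgue_rV_cbox_lty.
  - by exists M; split; [rewrite num_real|move=> r /ltW Mr x _ /=; rewrite gtr0_norm].
- apply/aeW => x m _; rewrite /g patchE /f_.
  have [Qx|nQx] := pselect (Q (B + 1) x).
    rewrite mem_set//= lee_fin normrM gtr0_norm ?invr_gt0// ler_pdivrMl//.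
    rewrite mulrC [x + _]addrC; apply: line_MVT => // s /andP[s0 sm].
    apply: HM; have -> : B + 2 = B + 1 + 1 by rewrite -addrA.
    by apply: Qadd => //; rewrite s0 (le_trans sm).
  rewrite memNset//= lee_fin !w0 ?subrr ?mulr0 ?normr0//.
    by move=> Kx; apply: nQx; apply: KB Kx; rewrite lerDl.
  move=> Kx; apply: nQx; apply: (Qsub _ _ (h m)); first by rewrite ltW//=.
  by rewrite addrC; exact: (KB B).
move=> _ _; rewrite (_ : (fun _ => _) = (fun=> 0%E)); last first.
  by apply/funext => m; have [_] := If m.
by move=> /cvg_lim <- //; rewrite lim_cst.
Qed.

End integration_by_parts.

Section weak_gradients.
Context (R : realType) (n : nat).
Implicit Types (x : 'rV[R]_n) (K Omega : set 'rV[R]_n) (u v psi : 'rV[R]_n -> R).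
Implicit Types (g : 'rV[R]_n -> 'rV[R]_n).
Local Notation mu := (lebesgue_rV R n).
Local Notation e_ := (@basis_vec R n).

Definition tsupp psi := closure [set x : 'rV[R]_n | psi x != 0].

Section test_function_facts.
Variables (Omega : set 'rV[R]_n) (psi : 'rV[R]_n -> R).
Hypothesis tpsi : test_function Omega psi.

Lemma test_Ck k : Ck_on e_ setT k psi.
Proof. by have [sm _ _] := tpsi; exact/Ck_onT. Qed.

Lemma test_continuous : continuous psi.
Proof. by move=> x; exact: (Ck_on_continuous (test_Ck 0)). Qed.

Lemma test_derive_continuous i : continuous (fun x => 'D_(e_ i) psi x).
Proof. by move=> x; exact: (Ck_on_continuous (Ck_on_derive i (test_Ck 1))). Qed.

Lemma test_eq0 x : ~ tsupp psi x -> psi x = 0.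
Proof. by move=> nx; apply: contrapT => /eqP px; apply/nx/subset_closure. Qed.

Lemma open_tsuppC : open (~` tsupp psi).
Proof. by apply: closed_openC; exact: closed_closure. Qed.

Lemma test_near0 x : ~ tsupp psi x -> \near x, psi x = 0.
Proof.
move=> nx; apply: filterS (open_nbhs_nbhs (conj open_tsuppC nx)) => y.
exact: test_eq0.
Qed.

Lemma test_derive0 i x : ~ tsupp psi x -> 'D_(e_ i) psi x = 0.
Proof.
move=> /test_near0 h; rewrite -[RHS](derive_cst (0 : R) x (e_ i)).
exact: near_eq_derive.
Qed.

Lemma test_compact : compact (tsupp psi).
Proof. by have [] := tpsi. Qed.

Lemma test_sub : tsupp psi `<=` Omega.
Proof. by have [] := tpsi. Qed.

End test_function_facts.

Lemma grad_E u x i : grad u x ord0 i = 'D_(e_ i) u x.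
Proof. by rewrite mxE. Qed.

(** The product u psi, extended by 0, is C^1 on the whole space, since [Omega] and the complement of
    the support of psi cover it. Its partial derivatives therefore integrate to 0, and the product
    rule turns this into integration by parts. *)
Lemma weak_gradient_C1 Omega u : open Omega -> Ck_on e_ Omega 1 u ->
  weak_gradient Omega u (grad u).
Proof.
move=> oO Cu; have mO := open_measurable_rV oO.
have cu x : Omega x -> {for x, continuous u} by exact: (Ck_on_continuous Cu).
have cdu i x : Omega x -> {for x, continuous (fun x => 'D_(e_ i) u x)}.
  exact: (Ck_on_continuous (Ck_on_derive i Cu)).
have Lu : Lp_loc Omega 1 u by exact: continuous_Lp_loc.
have Ldu i : Lp_loc Omega 1 (fun x => 'D_(e_ i) u x) by apply: continuous_Lp_loc oO; exact: cdu.
have gE i : (fun x => grad u x ord0 i) = (fun x => 'D_(e_ i) u x).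
  by apply/funext => x; exact: grad_E.
split=> //; first by move=> i; rewrite gE.
move=> psi tpsi i; under [in RHS]eq_Rintegral do rewrite grad_E.
have cK := test_compact tpsi; have KO := test_sub tpsi.
have i1 := integrable_Lp_loc oO cK KO Lu (test_derive_continuous tpsi (i := i))
  (@test_derive0 psi i).
have i2 := integrable_Lp_loc oO cK KO (Ldu i) (test_continuous tpsi) (@test_eq0 psi).
pose w := (fun x => u x * psi x) \_ Omega.
have w0 x : ~ tsupp psi x -> w x = 0.
  by move=> nx; rewrite /w patchE (test_eq0 nx) mulr0; case: ifP.
have wO : {in Omega, (fun x => u x * psi x) =1 w} by move=> x Ox; rewrite /w patchE Ox.
have CwO : Ck_on e_ Omega 1 w.
  apply: eq_Ck_on wO _ => //; apply: Ck_onM => //.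
  by apply: sub_Ck_on (test_Ck tpsi 1).
have CwC : Ck_on e_ (~` tsupp psi) 1 w.
  have oC := @open_tsuppC psi.
  apply: (@eq_Ck_on _ _ _ _ _ _ (fun=> 0)) (Ck_on_cst _ _ _ oC) => //.
  by move=> x; rewrite inE => nx; rewrite w0.
have Cw : Ck_on e_ setT 1 w.
  apply: sub_Ck_on (Ck_onU CwO CwC) => x _.
  by have [/KO|] := pselect (tsupp psi x); [left|right].
have := integral_derive_compact0 i cK Cw w0.
pose F x := u x * 'D_(e_ i) psi x + 'D_(e_ i) u x * psi x.
have -> : (fun x => ('D_(e_ i) w x)%:E) = (EFin \o F) \_ Omega.
  apply/funext => x; rewrite patchE; case: ifPn => [|nOx]; last first.
    have nx : ~ tsupp psi x by move=> /KO Ox; rewrite mem_set in nOx.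
    have -> : 'D_(e_ i) w x = 'D_(e_ i) (cst 0 : 'rV[R]_n -> R) x.
      apply: near_eq_derive; apply: filterS (open_nbhs_nbhs (conj (@open_tsuppC psi) nx)) => y.
      exact: w0.
    by rewrite derive_cst.
  rewrite inE => Ox; congr _%:E.
  have -> : 'D_(e_ i) w x = 'D_(e_ i) (u * psi) x.
    apply: near_eq_derive; apply: filterS (open_nbhs_nbhs (conj oO Ox)) => y Oy.
    by rewrite /w patchE mem_set.
  have [du _] := Ck_on_is_derive i Cu Ox.
  have [dp _] := Ck_on_is_derive i (test_Ck tpsi 1) (I : setT x).
  by rewrite deriveM// /F /GRing.scale/= [psi x * _]mulrC.
rewrite -integral_mkcond => H0.
have := integralD_EFin mO i1 i2.
rewrite [X in X = _ -> _]H0 /Rintegral => H.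
apply/eqP; rewrite -addr_eq0; apply/eqP.
by rewrite -fineD ?integrable_fin_num// -H.
Qed.

Lemma Lp_loc_lin Omega (a : R) u v : Lp_loc Omega 1 u -> Lp_loc Omega 1 v ->
  Lp_loc Omega 1 (fun x => a * u x + v x).
Proof.
move=> Lu Lv K cK KO; have mK := compact_measurable_rV cK; apply/LpE => //.
have /LpE-/(_ mK) iu := Lu K cK KO; have /LpE-/(_ mK) iv := Lv K cK KO.
exact: (integrableD mK (integrableZl mK a iu) iv).
Qed.

Lemma weak_gradient_lin Omega (a : R) u v g h : open Omega ->
  weak_gradient Omega u g -> weak_gradient Omega v h ->
  weak_gradient Omega (fun x => a * u x + v x) (fun x => a *: g x + h x).
Proof.
move=> oO [Lu Lg Ig] [Lv Lh Ih]; have mO := open_measurable_rV oO.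
have E i x : (a *: g x + h x) ord0 i = a * g x ord0 i + h x ord0 i by rewrite !mxE.
split; first exact: Lp_loc_lin.
  by move=> i; under eq_fun do rewrite E; exact: Lp_loc_lin.
move=> psi tpsi i; have cK := test_compact tpsi; have KO := test_sub tpsi.
have J1 w Lw := @integrable_Lp_loc _ _ _ _ w _ oO cK KO Lw
  (test_derive_continuous tpsi (i := i)) (@test_derive0 psi i).
have J2 w Lw := @integrable_Lp_loc _ _ _ _ w _ oO cK KO Lw
  (test_continuous tpsi) (@test_eq0 psi).
under eq_Rintegral do rewrite mulrDl -mulrA.
under [in RHS]eq_Rintegral do rewrite E mulrDl -mulrA.
have Z (f : 'rV[R]_n -> R) : mu.-integrable Omega (EFin \o f) ->
  mu.-integrable Omega (EFin \o (fun x => a * f x)) by exact: (integrableZl mO a).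
rewrite RintegralD ?RintegralZl ?Ig ?Ih//; do ?[exact: J1|exact/Z/J1].
rewrite RintegralD ?RintegralZl//; do ?[exact: J2|exact/Z/J2].
by rewrite opprD mulrN.
Qed.

Lemma Lp_loc_abs Omega u : Lp_loc Omega 1 u -> Lp_loc Omega 1 (fun x => `|u x|).
Proof.
move=> Lu K cK KO; have mK := compact_measurable_rV cK; apply/LpE => //.
by have /LpE-/(_ mK) iu := Lu K cK KO; exact: integrable_norm.
Qed.

Lemma Lp_loc_dominated Omega (h_ : nat -> 'rV[R]_n -> R) u v :
  (forall m, Lp_loc Omega 1 (h_ m)) ->
  (forall x, Omega x -> h_ ^~ x @ \oo --> u x) -> Lp_loc Omega 1 v ->
  (forall m x, Omega x -> `|h_ m x| <= v x) -> Lp_loc Omega 1 u.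
Proof.
move=> Lh hu Lv hv K cK KO; have mK := compact_measurable_rV cK; apply/LpE => //.
have /LpE-/(_ mK) iv := Lv K cK KO.
have mh m : measurable_fun K (h_ m).
  by have /LpE-/(_ mK)/integrableP[/measurable_EFinP] := Lh m K cK KO.
have [] // := @dominated_convergence _ _ _ mu K mK (fun m => EFin \o h_ m) (EFin \o u) (EFin \o v).
- by move=> m; exact/measurable_EFinP.
- by apply/measurable_EFinP; apply: (measurable_fun_cvg mh) => x Kx; exact/hu/KO.
- by apply/aeW => x Kx; apply: cvg_EFin; [exact: nearW|exact/hu/KO].
- by apply/aeW => x m Kx; rewrite lee_fin; exact/hv/KO.
Qed.

Lemma Rintegral_dominated_cvg Omega K (h_ : nat -> 'rV[R]_n -> R) u v (b : 'rV[R]_n -> R) :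
  open Omega -> compact K -> K `<=` Omega -> continuous b ->
  (forall x, ~ K x -> b x = 0) ->
  (forall m, Lp_loc Omega 1 (h_ m)) ->
  (forall x, Omega x -> h_ ^~ x @ \oo --> u x) -> Lp_loc Omega 1 v ->
  (forall m x, Omega x -> `|h_ m x| <= v x) ->
  (\int[mu]_(x in Omega) (h_ m x * b x))%R @[m --> \oo] -->
  (\int[mu]_(x in Omega) (u x * b x))%R.
Proof.
move=> oO cK KO cb b0 Lh hu Lv hv; have mO := open_measurable_rV oO.
have Lu := Lp_loc_dominated Lh hu Lv hv.
have J w Lw := @integrable_Lp_loc _ _ _ _ w _ oO cK KO Lw cb b0.
have cb' : continuous (fun x => `|b x|).
  by move=> x; apply: (continuous_comp (cb x)); exact: norm_continuous.
have b0' x : ~ K x -> `|b x| = 0 by move=> /b0 ->; rewrite normr0.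
have [] := @dominated_convergence _ _ _ mu Omega mO
  (fun m => EFin \o (fun x => h_ m x * b x)) (EFin \o (fun x => u x * b x))
  (EFin \o (fun x => v x * `|b x|)).
- by move=> m; have /integrableP[] := J _ (Lh m).
- by have /integrableP[] := J _ Lu.
- apply/aeW => x Ox; apply: cvg_EFin; first exact: nearW.
  by apply: cvgM; [exact: hu|exact: cvg_cst].
- exact: (@integrable_Lp_loc _ _ _ _ v _ oO cK KO Lv cb' b0').
- by apply/aeW => x m Ox; rewrite lee_fin normrM ler_wpM2r//; exact: hv.
move=> _ _ H; apply: (@fine_cvg _ _ _ _ (fun m => \int[mu]_(x in Omega) (h_ m x * b x)%:E)%E).
by rewrite fineK//; apply: integrable_fin_num => //; exact: J.
Qed.

(** Both sides of the integration by parts for [u_ m] pass to the limit by dominated convergence.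
    This is the source of weak gradients of functions that are not C^1. *)
Lemma weak_gradient_dominated Omega (u_ : nat -> 'rV[R]_n -> R)
    (g_ : nat -> 'rV[R]_n -> 'rV[R]_n) u g U (G : 'I_n -> 'rV[R]_n -> R) : open Omega ->
  (forall m, weak_gradient Omega (u_ m) (g_ m)) ->
  (forall x, Omega x -> u_ ^~ x @ \oo --> u x) ->
  (forall i x, Omega x -> (fun m => g_ m x ord0 i) @ \oo --> g x ord0 i) ->
  Lp_loc Omega 1 U -> (forall m x, Omega x -> `|u_ m x| <= U x) ->
  (forall i, Lp_loc Omega 1 (G i)) ->
  (forall i m x, Omega x -> `|g_ m x ord0 i| <= G i x) ->
  weak_gradient Omega u g.
Proof.
move=> oO wg uu gg LU uU LG gG.
have Lu m : Lp_loc Omega 1 (u_ m) by have [] := wg m.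
have Lg i m : Lp_loc Omega 1 (fun x => g_ m x ord0 i) by have [] := wg m.
split.
- exact: (Lp_loc_dominated Lu uu LU uU).
- by move=> i; exact: (Lp_loc_dominated (Lg i) (gg i) (LG i) (gG i)).
move=> psi tpsi i; have cK := test_compact tpsi; have KO := test_sub tpsi.
have C1 := Rintegral_dominated_cvg oO cK KO
  (test_derive_continuous tpsi (i := i)) (@test_derive0 psi i) Lu uu LU uU.
have C2 := Rintegral_dominated_cvg oO cK KO
  (test_continuous tpsi) (@test_eq0 psi) (Lg i) (gg i) (LG i) (gG i).
apply: (cvg_unique _ C1) => //; apply: (cvg_trans _ (cvgN C2)).
apply: near_eq_cvg; apply: nearW => m /=.
by have [_ _ ->] := wg m.
Qed.

End weak_gradients.

(** * Uniqueness of weak gradients *)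

Section uniqueness.
Context (R : realType) (n : nat).
Implicit Types (x : 'rV[R]_n) (K Omega : set 'rV[R]_n) (u v h psi : 'rV[R]_n -> R).
Implicit Types (a b : 'I_n -> R).
Local Notation mu := (lebesgue_rV R n).
Local Notation e_ := (@basis_vec R n).
Local Notation fl := (@flat_pow R 0).

Lemma flat_gt0 (t : R) : (0 < fl t) = (0 < t).
Proof.
rewrite /flat_pow; case: ifPn => t0; last by rewrite ltxx.
by rewrite expr0 invr1 mul1r expR_gt0.
Qed.

Lemma flat_neq0 (t : R) : (fl t != 0) = (0 < t).
Proof. by rewrite -flat_gt0 lt0r flat_pow_ge0 andbT. Qed.

Lemma flat_le1 (t : R) : fl t <= 1.
Proof.
rewrite /flat_pow; case: ifPn => // t0.
by rewrite expr0 invr1 mul1r -expR0 ler_expR oppr_le0 invr_ge0 ltW.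
Qed.

Lemma cvg_flat (t : R) : (fun m => fl (m.+1%:R * t)) @ \oo --> ((0 < t)%R%:R : R).
Proof.
have [t0|t0] := ltP 0 t; last first.
  apply: cvg_near_cst; apply: nearW => m; rewrite /flat_pow ifF//.
  by apply/negbTE; rewrite -leNgt mulr_ge0_le0.
have -> : (true%:R : R) = expR (- (0 * t^-1)) by rewrite mul0r oppr0 expR0.
have -> : (fun m => fl (m.+1%:R * t)) = (fun m => expR (- (m.+1%:R^-1 * t^-1))).
  apply/funext => m; rewrite /flat_pow mulr_gt0// expr0 invr1 mul1r.
  by rewrite invfM.
apply: (@continuous_cvg _ _ _ _ _ _ (fun y => expR y)); first exact: continuous_expR.
apply: cvgN; apply: cvgM; [exact: cvg_harmonic|exact: cvg_cst].
Qed.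

(** For every [m] it is nonzero exactly on the open box; growing [m] only steepens the sides, so the
    limit is the indicator of that box. *)
Definition bump a b (m : nat) x : R :=
  \prod_(i < n) (fl (m.+1%:R * (x ord0 i - a i)) * fl (m.+1%:R * (b i - x ord0 i))).

Lemma bump_ge0 a b m x : 0 <= bump a b m x.
Proof. by apply: prodr_ge0 => i _; rewrite mulr_ge0// flat_pow_ge0. Qed.

Lemma bump_le1 a b m x : bump a b m x <= 1.
Proof.
by apply: Num.Theory.prodr_ile1 => i _; rewrite mulr_ge0 ?flat_pow_ge0//= mulr_ile1 ?flat_pow_ge0 ?flat_le1.
Qed.

Lemma bump_neq0 a b m : [set x | bump a b m x != 0] = obox a b.
Proof.
have m0 : 0 < m.+1%:R :> R by rewrite ltr0n.
apply/seteqP; split=> x /=.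
  move=> /prodf_neq0 bx i; have := bx i isT.
  rewrite mulf_eq0 negb_or !flat_neq0 !pmulr_rgt0// !subr_gt0 /= in_itv/=.
  by [].
move=> xab; apply/prodf_neq0 => i _; have := xab i; rewrite /= in_itv/= => /andP[? ?].
by rewrite mulf_eq0 negb_or !flat_neq0 !pmulr_rgt0// !subr_gt0; apply/andP.
Qed.

Lemma cvg_bump a b x : bump a b ^~ x @ \oo --> (\1_(obox a b) x : R).
Proof.
have -> : \1_(obox a b) x =
    \prod_(i < n) (((0 < x ord0 i - a i)%R%:R * (0 < b i - x ord0 i)%R%:R) : R).
  rewrite indicE; have [xab|nxab] := pselect (obox a b x).
    rewrite mem_set// big1// => i _; have := xab i; rewrite /= in_itv/= => /andP[? ?].
    by rewrite !subr_gt0 -natrM mulnb; apply/eqP; rewrite pnatr_eq1 eqb1; apply/andP.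
  rewrite memNset//; apply/esym/eqP; rewrite prodf_seq_eq0.
  apply: contra_notT nxab => /hasPn h i; have := h i (mem_index_enum _).
  rewrite -natrM mulnb pnatr_eq0 eqb0 negbK !subr_gt0 => ?.
  by rewrite /= in_itv/=.
rewrite /bump; elim: (index_enum _) => [|i s IH].
  by rewrite big_nil; under eq_fun do rewrite big_nil; exact: cvg_cst.
rewrite big_cons; under eq_fun do rewrite big_cons.
by apply: cvgM => //; apply: cvgM; exact: cvg_flat.
Qed.

Lemma cbox_closed a b : closed (cbox a b).
Proof. by apply: compact_closed => //; exact: cbox_compact. Qed.

(** A separate outer closed box is used because the inner box will be an intersection of boxes; when
    it is empty, its own closed box need not lie in [Omega]. *)
Lemma bump_test Omega a b a' b' m : obox a' b' `<=` cbox a b ->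
  cbox a b `<=` Omega -> test_function Omega (bump a' b' m).
Proof.
move=> ab' abO.
have clo : closure (obox a' b') `<=` cbox a b.
  have := closureS ab'.
  by rewrite -((closure_id (cbox a b)).1 (@cbox_closed a b)).
split.
- move=> k; apply/Ck_onT; apply: Ck_on_prod; first exact: openT.
  have oT : open [set: 'rV[R]_n] := openT.
  have C0 (c : R) : Ck_on e_ setT k (fun=> c) by exact: Ck_on_cst.
  have Cfl (f : 'rV[R]_n -> R) : Ck_on e_ setT k f -> Ck_on e_ setT k (fun x => fl (f x)).
    by move=> Cf; exact: (Ck_on_comp oT (fun _ _ => I) Cf (Ck_R_flat_pow R k 0)).
  have Cx i := Ck_on_coord k i oT.
  move=> i; apply: (Ck_onM oT); apply/Cfl/(Ck_onZ _ oT).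
    exact: (Ck_onB oT (Cx i) (C0 _)).
  exact: (Ck_onB oT (C0 _) (Cx i)).
- rewrite bump_neq0; apply: (subclosed_compact _ (@cbox_compact _ _ a b)) => //.
  exact: closed_closure.
- by rewrite bump_neq0; apply: subset_trans abO.
Qed.

(** Test with bumps and let them converge to the indicator of the box; |h| on the compact box is the
    majorant. *)
Lemma integral_obox0 Omega h a b a' b' : open Omega -> Lp_loc Omega 1 h ->
  (forall psi, test_function Omega psi -> \int[mu]_(x in Omega) (h x * psi x) = 0) ->
  cbox a b `<=` Omega -> obox a' b' `<=` cbox a b ->
  (\int[mu]_(x in obox a' b') (h x)%:E = 0)%E.
Proof.
move=> oO Lh h0 abO ab'.
pose K := cbox a b; have cK : compact K by exact: cbox_compact.
have mK : measurable K by exact: measurable_cbox.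
have mO := open_measurable_rV oO.
have mB : measurable (obox a' b') by exact: measurable_obox.
have /LpE-/(_ mK) ih := Lh K cK abO.
have mh : measurable_fun K h by have /integrableP[/measurable_EFinP] := ih.
have tb m := @bump_test Omega a b a' b' m ab' abO.
have mbump m : measurable_fun setT (bump a' b' m).
  by apply: (continuous_measurable_rV openT) => x _; exact: (test_continuous (tb m)).
have b0 m x : ~ K x -> bump a' b' m x = 0.
  move=> nK; apply/eqP; apply: contra_notT nK => bx.
  by apply/ab'; rewrite -(bump_neq0 a' b' m).
have If m : (\int[mu]_(x in K) (h x * bump a' b' m x)%:E = 0)%E.
  have im : mu.-integrable Omega (EFin \o (fun x => h x * bump a' b' m x)).
    exact: (integrable_Lp_loc oO cK abO Lh (test_continuous (tb m)) (b0 m)).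
  have := h0 _ (tb m); rewrite /Rintegral => /(congr1 (@EFin R)).
  rewrite fineK ?integrable_fin_num// => H; rewrite -[RHS]H.
  rewrite [LHS]integral_mkcond [RHS]integral_mkcond; congr (integral _ _ _).
  apply/funext => x; rewrite !patchE.
  have [Kx|nK] := pselect (K x); first by rewrite !mem_set//; exact: abO.
  by rewrite (memNset nK) b0// mulr0; case: ifP.
have [] := @dominated_convergence _ _ _ mu K mK
  (fun m => EFin \o (fun x => h x * bump a' b' m x))
  (EFin \o (fun x => h x * \1_(obox a' b') x)) (EFin \o (fun x => `|h x|)).
- move=> m; apply/measurable_EFinP; apply: measurable_funM => //.
  exact: measurable_funS (mbump m).
- by apply/measurable_EFinP; apply: measurable_funM.
- apply/aeW => x Kx; apply: cvg_EFin; first exact: nearW.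
  by apply: cvgM; [exact: cvg_cst|exact: cvg_bump].
- exact: integrable_norm.
- apply/aeW => x m Kx; rewrite lee_fin normrM ler_piMr//.
  by rewrite ger0_norm ?bump_ge0// bump_le1.
move=> _ _; rewrite (_ : (fun _ => _) = (fun=> 0%E)); last first.
  by apply/funext => m; exact: If.
move=> /cvg_lim; rewrite lim_cst// => /(_ (@ereal_hausdorff _)) H.
rewrite [RHS]H// [LHS]integral_mkcond [RHS]integral_mkcond; congr (integral _ _ _).
apply/funext => x; rewrite !patchE /= indicE.
have [Bx|nB] := pselect (obox a' b' x).
  by rewrite !mem_set// ?mulr1//; exact: ab'.
by rewrite (memNset nB) /= mulr0; case: ifP.
Qed.

(** Dynkin's lemma extends the vanishing of the integral of [h] from boxes to all measurable subsets
    of the box. *)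
Lemma ae_eq0_box Omega h a b : open Omega -> Lp_loc Omega 1 h ->
  (forall psi, test_function Omega psi -> \int[mu]_(x in Omega) (h x * psi x) = 0) ->
  cbox a b `<=` Omega ->
  ae_eq mu (obox a b) (EFin \o h) (cst 0%E).
Proof.
move=> oO Lh h0 abO; pose B := obox a b.
have mB : measurable B by exact: measurable_obox.
have ih : mu.-integrable B (EFin \o h).
  have mK : measurable (cbox a b) by exact: measurable_cbox.
  have /LpE-/(_ mK) ih := Lh (cbox a b) (@cbox_compact _ _ a b) abO.
  by apply: integrableS ih => //; exact: obox_cbox.
have mh : measurable_fun B (EFin \o h) by have /integrableP[] := ih.
pose P (E : set 'rV[R]_n) := (\int[mu]_(x in E `&` B) (h x)%:E = 0)%E.
have PB : (\int[mu]_(x in B) (h x)%:E = 0)%E.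
  by apply: (integral_obox0 oO Lh h0 abO); exact: obox_cbox.
have PE E : measurable E -> P E.
  rewrite measurable_oboxes; apply: (@dynkin_induction _ _ (@oboxes R n)).
  - exact: measurable_oboxes.
  - exact: oboxes_setI.
  - by rewrite /P setTI.
  - move=> C GC; rewrite /P.
    have [a' [b' CB]] : oboxes (C `&` B) by apply: oboxes_setI => //; exists a, b.
    rewrite CB; apply: (integral_obox0 oO Lh h0 abO).
    by rewrite -CB => x [_]; exact: obox_cbox.
  - move=> S mS PS; rewrite /P.
    have : (\int[mu]_(x in (S `&` B) `|` (~` S `&` B)) (h x)%:E = 0)%E.
      by rewrite -setIUl setUv setTI.
    rewrite integral_setU.
    + by rewrite PS add0e.
    + exact: measurableI.
    + by apply: measurableI => //; exact: measurableC.
    + by rewrite -setIUl setUv setTI.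
    + by apply/disj_setPS => x [[Sx _] [nSx _]]; exact: nSx.
  - move=> F mF tF PF; rewrite /P setI_bigcupl integral_bigcup.
    + by rewrite eseries0// => k _ _; exact: PF.
    + exact: trivIset_setIr.
    + by move=> k; exact: measurableI.
    + rewrite -setI_bigcupl; apply: integrableS ih => //.
      by apply: measurableI => //; exact: bigcupT_measurable.
apply: integral_ae_eq => // E EB mE.
by rewrite integral0 -(setIidl EB); exact: PE.
Qed.

(** The fundamental lemma of the calculus of variations; countably many boxes cover [Omega], so
    their null sets add up to a null set. *)
Lemma ae_eq0_test Omega h : open Omega -> Lp_loc Omega 1 h ->
  (forall psi, test_function Omega psi -> \int[mu]_(x in Omega) (h x * psi x) = 0) ->
  {ae mu, forall x, Omega x -> h x = 0}.
Proof.
move=> oO Lh h0; have [D [a [b [abO OE]]]] := open_bigcup_boxes oO.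
have H k : mu.-negligible [set x | D k /\ obox (a k) (b k) x /\ h x <> 0].
  have [Dk|nD] := pselect (D k); last first.
    by apply: negligibleS (negligible_set0 mu) => x [].
  have := ae_eq0_box oO Lh h0 (abO k Dk).
  apply: negligibleS => x /= [_ [xk hx]] /(_ xk) [] //.
apply: negligibleS (negligible_bigcup H) => x /= /not_implyP[].
by rewrite [in X in X -> _]OE => -[k Dk xk] hx; exists k.
Qed.

(** The components of g' - g are orthogonal to all test functions. *)
Lemma weak_gradient_unique Omega u (g g' : 'rV[R]_n -> 'rV[R]_n) : open Omega ->
  weak_gradient Omega u g -> weak_gradient Omega u g' ->
  {ae mu, forall x, Omega x -> g x = g' x}.
Proof.
move=> oO [_ Lg Ig] [_ Lg' Ig'].
have H i : {ae mu, forall x, Omega x -> (-1) * g x ord0 i + g' x ord0 i = 0}.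
  apply: ae_eq0_test => //; first exact: Lp_loc_lin.
  move=> psi tpsi; have cK := test_compact tpsi; have KO := test_sub tpsi.
  have J w Lw := @integrable_Lp_loc _ _ _ _ w _ oO cK KO Lw
    (test_continuous tpsi) (@test_eq0 _ _ psi).
  have mO := open_measurable_rV oO.
  under eq_Rintegral do rewrite mulN1r addrC mulrBl.
  rewrite RintegralB//; [|exact: J|exact: J].
  by have := Ig psi tpsi i; rewrite Ig'// => /oppr_inj ->; rewrite subrr.
have /filter_forall := H; apply: filterS => x Hx Ox; apply/rowP => i.
by have := Hx i Ox; rewrite mulN1r addrC => /eqP; rewrite subr_eq0 => /eqP.
Qed.

End uniqueness.

(** * Weak gradient of an absolute value *)

Section smooth_abs.
Context (R : realType).
Implicit Types e z : R.

(** For e > 0 this is smooth, lies between |z| and |z| + e, and has slope at most 1 in absolute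
    value; these bounds provide the majorants for e -> 0. *)
Definition sabs e z := Num.sqrt (z ^+ 2 + e ^+ 2).

Lemma sabs_arg_gt0 e z : 0 < e -> 0 < z ^+ 2 + e ^+ 2.
Proof. by move=> e0; rewrite ltr_wpDl ?sqr_ge0// exprn_gt0. Qed.

Lemma sabs_gt0 e z : 0 < e -> 0 < sabs e z.
Proof. by move=> e0; rewrite sqrtr_gt0 sabs_arg_gt0. Qed.

Lemma sabs_ge e z : `|z| <= sabs e z.
Proof. by rewrite -sqrtr_sqr ler_sqrt ?lerDl ?addr_ge0 ?sqr_ge0. Qed.

Lemma sabs_le e z : 0 <= e -> sabs e z <= `|z| + e.
Proof.
move=> e0; rewrite -[leRHS]ger0_norm ?addr_ge0// -sqrtr_sqr ler_sqrt ?sqr_ge0//.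
by rewrite sqrrD real_normK ?num_real// lerD2r lerDl mulrn_wge0// mulr_ge0.
Qed.

Lemma sabs_powR e : 0 < e -> sabs e = (fun z => (z ^+ 2 + e ^+ 2) `^ 2^-1).
Proof. by move=> e0; apply/funext => z; rewrite powR12_sqrt// ltW// sabs_arg_gt0. Qed.

Lemma Ck_R_sabs e k : 0 < e -> Ck_R setT k (sabs e).
Proof.
move=> e0; rewrite sabs_powR//.
have Cid : Ck_R [set: R] k id by apply: Ck_R_id; exact: openT.
have Ca : Ck_R [set: R] k (fun z : R => z ^+ 2 + e ^+ 2).
  apply: Ck_onD; [exact: openT| |exact: (Ck_on_cst _ _ _ openT)].
  exact: (Ck_onM openT Cid Cid).
apply: (Ck_on_comp openT _ Ca (Ck_R_powR k 2^-1)) => z _.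
exact: sabs_arg_gt0.
Qed.

Lemma is_derive_sabs e z : 0 < e -> is_derive z 1 (sabs e) (z / sabs e z).
Proof.
move=> e0; have a0 := sabs_arg_gt0 z e0.
rewrite {1}sabs_powR//.
have da : is_derive z 1 (fun z : R => z ^+ 2 + e ^+ 2) (2 * z).
  apply: is_derive_eq; rewrite addr0 /GRing.scale/= mulr1.
  by rewrite mulr_natl.
have dp := is_derive1_powR (2^-1) a0.
have := is_derive_comp_line da dp; congr is_derive.
have -> : 2^-1 - 1 = - 2^-1 :> R by lra.
rewrite powRN powR12_sqrt ?ltW// -/(sabs e z).
by rewrite mulrACA mulVf// mul1r mulrC.
Qed.

Lemma sabs_ratio_le1 e z : 0 < e -> `|z / sabs e z| <= 1.
Proof.
move=> e0; have s0 := sabs_gt0 z e0.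
by rewrite normrM normfV (gtr0_norm s0) ler_pdivrMr// mul1r sabs_ge.
Qed.

Lemma cvg_sabs z : (fun m => sabs m.+1%:R^-1 z) @ \oo --> `|z|.
Proof.
apply: (@squeeze_cvgr _ _ _ _ (fun=> `|z|) (fun m => `|z| + m.+1%:R^-1)).
- by apply: nearW => m; rewrite sabs_ge sabs_le// invr_ge0.
- exact: cvg_cst.
- by rewrite -[X in _ --> X]addr0; apply: cvgD; [exact: cvg_cst|exact: cvg_harmonic].
Qed.

Lemma cvg_sabs_ratio z : (fun m => z / sabs m.+1%:R^-1 z) @ \oo --> Num.sg z.
Proof.
have [->|z0] := eqVneq z 0.
  by rewrite sgr0; under eq_fun do rewrite mul0r; exact: cvg_cst.
have -> : Num.sg z = z / `|z|.
  by rewrite {2}(numEsg z) mulfK// normr_eq0.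
apply: cvgM; first exact: cvg_cst.
by apply: cvgV; [rewrite normr_eq0|exact: cvg_sabs].
Qed.

End smooth_abs.

(** Limit of the functions [sabs e (f x)]. Where [f] vanishes their gradients are 0 for every e, in
    agreement with [Num.sg 0 = 0], so the convergence is pointwise everywhere in [Omega], including
    the zero set of [f]. *)
Lemma weak_gradient_abs (R : realType) (n : nat) (Omega : set 'rV[R]_n)
    (f : 'rV[R]_n -> R) : open Omega -> Ck_on (@basis_vec R n) Omega 1 f ->
  weak_gradient Omega (fun x => `|f x|) (fun x => Num.sg (f x) *: grad f x).
Proof.
move=> oO Cf; pose h (m : nat) : R := m.+1%:R^-1.
have h0 m : 0 < h m by rewrite invr_gt0 ltr0n.
have h1 m : h m <= 1 by rewrite invf_le1 ?ltr0n// ler1n.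
pose f_ m x := sabs (h m) (f x).
have Cf_ m : Ck_on (@basis_vec R n) Omega 1 (f_ m).
  exact: (Ck_on_comp oO (fun _ _ => I) Cf (Ck_R_sabs 1 (h0 m))).
have gE m x i : Omega x -> grad (f_ m) x ord0 i = f x / sabs (h m) (f x) * grad f x ord0 i.
  move=> Ox; rewrite !grad_E; have df := Ck_on_is_derive i Cf Ox.
  by have [_ ->] := is_derive_comp_line df (is_derive_sabs (f x) (h0 m)).
apply: (@weak_gradient_dominated _ _ Omega f_ (fun m => grad (f_ m)) _ _
  (fun x => 1 * `|f x| + 1) (fun i x => `|grad f x ord0 i|)) => //.
- by move=> m; exact: weak_gradient_C1.
- by move=> x Ox; exact: cvg_sabs.
- move=> i x Ox; under eq_fun do rewrite gE//.
  by rewrite mxE; apply: cvgM; [exact: cvg_sabs_ratio|exact: cvg_cst].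
- have [Lf _ _] := weak_gradient_C1 oO Cf.
  apply: Lp_loc_lin; first exact: Lp_loc_abs.
  by apply: continuous_Lp_loc => // x _; exact: cst_continuous.
- move=> m x Ox; rewrite mul1r ger0_norm; last exact/ltW/sabs_gt0.
  apply: (le_trans (sabs_le _ (ltW (h0 m)))); rewrite lerD2l.
  exact: h1.
- by move=> i; have [_ Lg _] := weak_gradient_C1 oO Cf; exact: Lp_loc_abs.
- by move=> i m x Ox; rewrite gE// normrM ler_piMl// sabs_ratio_le1.
Qed.

(** * Volume of balls and area of the sphere *)

Section euclidean_balls.
Context (R : realType).
Implicit Types r t : R.
Local Notation mu n := (lebesgue_rV R n).

Definition sqnorm n (x : 'rV[R]_n) : R := \sum_(i < n) x ord0 i ^+ 2.

Lemma sqnorm_ge0 n (x : 'rV[R]_n) : 0 <= sqnorm x.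
Proof. by apply: sumr_ge0 => i _; exact: sqr_ge0. Qed.

Lemma sqr_enorm n (x : 'rV[R]_n) : enorm x ^+ 2 = sqnorm x.
Proof. by rewrite sqr_sqrtr// sqnorm_ge0. Qed.

Lemma enorm_ge0 n (x : 'rV[R]_n) : 0 <= enorm x.
Proof. exact: sqrtr_ge0. Qed.

Lemma sqnormZ n (a : R) (x : 'rV[R]_n) : sqnorm (a *: x) = a ^+ 2 * sqnorm x.
Proof. by rewrite /sqnorm mulr_sumr; apply: eq_bigr => i _; rewrite mxE exprMn. Qed.

Lemma enormZ n (a : R) (x : 'rV[R]_n) : enorm (a *: x) = `|a| * enorm x.
Proof.
by rewrite /enorm -/(sqnorm _) sqnormZ sqrtrM ?sqr_ge0// sqrtr_sqr.
Qed.

Lemma coord_le_enorm n (x : 'rV[R]_n) i : `|x ord0 i| <= enorm x.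
Proof.
rewrite -sqrtr_sqr ler_sqrt ?sqnorm_ge0//.
by rewrite (bigD1 i)//= lerDl sumr_ge0// => j _; exact: sqr_ge0.
Qed.

Lemma Ck_on_sqnorm n (U : set 'rV[R]_n) k : open U ->
  Ck_on (@basis_vec R n) U k (@sqnorm n).
Proof.
move=> oU; apply: Ck_on_sum => // i.
by apply: Ck_onM => //; exact: Ck_on_coord.
Qed.

Lemma continuous_sqnorm n : continuous (@sqnorm n).
Proof. by move=> x; exact: (Ck_on_continuous (Ck_on_sqnorm 0 openT) (I : setT x)). Qed.

Lemma continuous_enorm n : continuous (@enorm R n).
Proof.
move=> x; apply: continuous_comp; first exact: continuous_sqnorm.
exact: sqrt_continuous.
Qed.

Lemma measurable_enorm n : measurable_fun setT (@enorm R n).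
Proof. by apply: (continuous_measurable_rV openT) => x _; exact: continuous_enorm. Qed.

Lemma is_derive_sqnorm n (x : 'rV[R]_n) i :
  is_derive x (@basis_vec R n i) (@sqnorm n) (2 * x ord0 i).
Proof.
have H j : is_derive x (@basis_vec R n i) (fun y : 'rV[R]_n => y ord0 j ^+ 2 : R)
    (2 * x ord0 j * (@basis_vec R n i) ord0 j).
  have dc := is_derive_coord x (@basis_vec R n i) j.
  have := @is_deriveX _ _ (fun y : 'rV[R]_n => y ord0 j : R) 2 x _ _ dc.
  by congr is_derive; rewrite /GRing.scale/= expr1.
have := @is_derive_sum _ _ _ n (fun j (y : 'rV[R]_n) => y ord0 j ^+ 2 : R) x _ _ H.
congr is_derive.
  by apply/funext => y; rewrite fct_sumE.
rewrite (bigD1 i)//= big1 => [|j ji]; rewrite !mxE/=; last first.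
  by rewrite (negbTE ji) mulr0.
by rewrite eqxx mulr1 addr0.
Qed.

Definition eball n r := [set x : 'rV[R]_n | enorm x < r].

Lemma measurable_eball n r : measurable (@eball n r).
Proof.
rewrite -[X in measurable X]setTI; apply: (measurable_enorm measurableT (Y := `]-oo, r[%classic)) .
exact: measurable_itv.
Qed.

Lemma lebesgue_eball_lty n r : (mu n (@eball n r) < +oo)%E.
Proof.
apply: le_lt_trans (lebesgue_rV_cbox_lty (fun=> - r) (fun=> r)).
apply: le_measure; rewrite ?inE; [exact: measurable_eball|exact: measurable_cbox|].
move=> x xr i; rewrite /= in_itv/= -ler_norml (le_trans (coord_le_enorm x i))//.
exact: ltW.
Qed.

Definition ball_vol n : R := fine (mu n (@eball n 1)).

Lemma lebesgue_eball n r : 0 < r -> mu n (@eball n r) = (r ^+ n * ball_vol n)%:E.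
Proof.
move=> r0; rewrite EFinM /ball_vol fineK; last first.
  by rewrite ge0_fin_numE//; exact: lebesgue_eball_lty.
have r'0 : 0 < r^-1 by rewrite invr_gt0.
have := lebesgue_rV_scale r'0 (@measurable_eball n 1).
rewrite exprVn invrK => <-; congr (mu n _); apply/seteqP; split => x /=;
  by rewrite /eball/= enormZ gtr0_norm// ltr_pdivrMl// mulr1.
Qed.

Lemma ball_vol_gt0 n : 0 < ball_vol n.
Proof.
rewrite /ball_vol fine_gt0// lebesgue_eball_lty andbT.
pose c : R := n.+1%:R^-1.
have c0 : 0 < c by rewrite invr_gt0.
have sub : obox (fun=> - c) (fun=> c) `<=` @eball n 1.
  move=> x xc; rewrite /eball/= -[ltRHS]sqrtr1 ltr_sqrt//.
  apply: (@le_lt_trans _ _ (\sum_(i < n) c ^+ 2)).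
    apply: ler_sum => i _; have := xc i; rewrite /= in_itv/= -ltr_norml => xi.
    by rewrite -real_normK ?num_real// lerXn2r ?nnegrE// ltW.
  rewrite sumr_const card_ord -mulr_natr /c exprVn ltr_pdivrMl ?exprn_gt0//.
  by rewrite mulr1 -natrX ltr_nat -mulnn leq_pmulr.
have le : (mu n (obox (fun=> - c)%R (fun=> c)) <= mu n (@eball n 1))%E.
  by apply: le_measure; rewrite ?inE; [exact: measurable_obox|exact: measurable_eball|].
apply: lt_le_trans le.
rewrite lebesgue_rV_obox prodEFin lte_fin; apply: prodr_gt0 => i _.
by rewrite lt_max opprK addr_gt0 ?orbT.
Qed.

Lemma sqnorm_cons n (t : R) (y : 'rV[R]_n) :
  sqnorm (rV_cons ((t : measurableTypeR R), y)) = t ^+ 2 + sqnorm y.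
Proof.
rewrite /sqnorm big_ord_recl rV_cons0/=; congr (_ + _).
by apply: eq_bigr => i _; rewrite rV_consS.
Qed.

(** Empty slices are covered by [Num.sqrt] being 0 at negative reals: both sides are then false. *)
Lemma sqrt_lt_slice r t q : 0 <= r -> 0 <= q ->
  (Num.sqrt (t ^+ 2 + q) < r) = (`|t| < Num.sqrt (r ^+ 2 - q)).
Proof.
move=> r0 q0; have [r1|r1] := ltP 0 r; last first.
  have -> : r = 0 by apply/eqP; rewrite eq_le r0 r1.
  rewrite expr0n/= sub0r [in RHS]ler0_sqrtr ?oppr_le0//.
  by rewrite !ltNge sqrtr_ge0 normr_ge0.
rewrite -{1}[r]ger0_norm// -sqrtr_sqr ltr_sqrt ?exprn_gt0//.
have [h|h] := ltP 0 (r ^+ 2 - q).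
  by rewrite -[`|t|]sqrtr_sqr ltr_sqrt// ltrBrDr.
rewrite [in RHS]ler0_sqrtr//.
rewrite !ltNge normr_ge0/=; apply/negbTE; rewrite negbK.
by rewrite (le_trans (_ : _ <= q)) ?lerDr ?sqr_ge0// -subr_le0.
Qed.

Lemma lebesgue_eball_slices n r : 0 <= r ->
  mu n.+1 (@eball n.+1 r) =
  (\int[mu n]_y (2 * Num.sqrt (r ^+ 2 - sqnorm y))%:E)%E.
Proof.
move=> r0; rewrite [LHS]/= /lebesgue_step /pushforward.
set B := _ @^-1` _.
have mB : measurable B.
  rewrite -[X in measurable X]setTI; apply: measurable_rV_cons => //.
  exact: measurable_eball.
(* The product measure is an iterated integral over sections in the other variable; uniqueness on
   rectangles permits exchanging the order, which yields slices along the first coordinate. *)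
have -> : ((@lebesgue_measure R) \x (mu n))%E B = ((@lebesgue_measure R) \x^ (mu n))%E B.
  by apply: product_measure_unique => //= C D mC mD; rewrite product_measure2E.
apply: eq_integral => y _ /=.
set s := Num.sqrt (r ^+ 2 - sqnorm y).
have -> : ysection B y = `]-s, s[%classic.
  apply/seteqP; split=> t; rewrite /ysection/= in_setE /B/= /eball/= in_itv/=
    -ltr_norml /enorm -/(sqnorm _) sqnorm_cons sqrt_lt_slice// ?sqnorm_ge0//.
rewrite lebesgue_measure_itv/= lte_fin -EFinB opprK.
have s0 : 0 <= s := sqrtr_ge0 _.
case: ifPn => ss; first by congr _%:E; lra.
by congr _%:E; lra.
Qed.

End euclidean_balls.

(** * Area of the unit sphere *)

Section sphere_area.
Context (R : realType) (d : nat).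
Local Notation mu := (lebesgue_rV R d).
Implicit Types y : 'rV[R]_d.

(* Difference quotients of [r |-> sqrt (r^2 - q)] at [r = 1]: concavity makes
   their limit at 0 monotone. *)
Lemma sqrt_slope_le (q h1 h2 : R) : 0 <= q -> q <= 1 -> 0 < h1 -> h1 <= h2 ->
  (Num.sqrt ((1 + h2) ^+ 2 - q) - Num.sqrt (1 ^+ 2 - q)) / h2 <=
  (Num.sqrt ((1 + h1) ^+ 2 - q) - Num.sqrt (1 ^+ 2 - q)) / h1.
Proof.
move=> q0 q1 h10 h12; have h20 : 0 < h2 := lt_le_trans h10 h12.
have sq (h : R) : 0 <= h -> Num.sqrt ((1 + h) ^+ 2 - q) ^+ 2 = (1 + h) ^+ 2 - q.
  by move=> h0; rewrite sqr_sqrtr//; nra.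
have := sq h2 (ltW h20); have := sq h1 (ltW h10).
have : Num.sqrt (1 ^+ 2 - q) ^+ 2 = 1 - q by rewrite sqr_sqrtr expr1n ?subr_ge0.
have := sqrtr_ge0 (1 ^+ 2 - q); have := sqrtr_ge0 ((1 + h1) ^+ 2 - q).
have := sqrtr_ge0 ((1 + h2) ^+ 2 - q).
move: (Num.sqrt _) (Num.sqrt _) (Num.sqrt _) => c f1 f2 f20 f10 c0 Ec E1 E2.
have [L [L0 L1' hL]] : exists L, [/\ 0 <= L, 0 <= 1 - L & h1 = L * h2].
  exists (h1 / h2); rewrite subr_ge0 ler_pdivrMr// mul1r; split => //.
    by rewrite divr_ge0// ltW.
  by rewrite divfK// gt_eqF.
(* After squaring, the right side exceeds the left by q * h2 ^ 2. *)
have cf : c * f2 <= 1 + h2 - q.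
  rewrite -ler_sqr ?nnegrE ?mulr_ge0//; last by lra.
  by rewrite exprMn Ec E2; nra.
have k0 : 0 <= (1 - L) * c + L * f2 by apply: addr_ge0; exact: mulr_ge0.
(* Concavity at 1 + h1, which divides the segment from 1 to 1 + h2 in the proportion L. *)
have key : (1 - L) * c + L * f2 <= f1.
  rewrite -ler_sqr ?nnegrE//.
  rewrite E1 hL.
  have -> : ((1 - L) * c + L * f2) ^+ 2 =
    (1 - L) ^+ 2 * c ^+ 2 + L ^+ 2 * f2 ^+ 2 + 2 * (L * (1 - L)) * (c * f2) by ring.
  rewrite Ec E2.
  have : 0 <= 2 * (L * (1 - L)) * (1 + h2 - q - c * f2).
    apply: mulr_ge0; last by rewrite subr_ge0.
    by apply: mulr_ge0 => //; exact: mulr_ge0.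
  move=> H; rewrite -subr_ge0.
  apply: le_trans H _; rewrite le_eqVlt; apply/orP; left; apply/eqP; ring.
rewrite ler_pdivrMr// mulrAC ler_pdivlMr// hL.
have -> : (f2 - c) * (L * h2) = (L * (f2 - c)) * h2 by ring.
by rewrite ler_pM2r//; lra.
Qed.

(** The gradient is - y / sqrt (1 - |y|^2), and 1 + |y|^2 / (1 - |y|^2) = 1 / (1 - |y|^2). *)
Lemma sphere_integrand y : enorm y < 1 ->
  Num.sqrt (1 + enorm (grad (fun z : 'rV[R]_d => Num.sqrt (1 - enorm z ^+ 2)) y) ^+ 2) =
  (Num.sqrt (1 - sqnorm y))^-1.
Proof.
move=> y1; have N1 : 0 < 1 - sqnorm y.
  by rewrite subr_gt0 -sqr_enorm expr_lt1// enorm_ge0.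
set s := Num.sqrt (1 - sqnorm y).
have s0 : 0 < s by rewrite sqrtr_gt0.
have gE : grad (fun z : 'rV[R]_d => Num.sqrt (1 - enorm z ^+ 2)) y = (- s^-1) *: y.
  apply/rowP => i; rewrite mxE [RHS]mxE.
  have -> : (fun z : 'rV[R]_d => Num.sqrt (1 - enorm z ^+ 2)) =
            (fun z => Num.sqrt (1 - sqnorm z)).
    by apply/funext => z; rewrite sqr_enorm.
  have dN := is_derive_sqnorm y i.
  have d1 : is_derive y (@basis_vec R d i) (fun z : 'rV[R]_d => 1 - sqnorm z) (0 - 2 * y ord0 i).
    exact: is_deriveB.
  have [_ ->] := is_derive_comp_line d1 (is_derive1_sqrt N1).
  rewrite -/s invfM; move: (y ord0 i) => yi.
  by field; exact: lt0r_neq0.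
rewrite gE sqr_enorm sqnormZ sqrrN.
have -> : 1 + s^-1 ^+ 2 * sqnorm y = s^-1 ^+ 2.
  have s2 : s ^+ 2 = 1 - sqnorm y by rewrite sqr_sqrtr// ltW.
  have -> : sqnorm y = 1 - s ^+ 2 by rewrite s2; ring.
  by field; exact: lt0r_neq0.
by rewrite sqrtr_sqr gtr0_norm// invr_gt0.
Qed.

Let h (m : nat) : R := m.+1%:R^-1.
Let S (r : R) y := Num.sqrt (r ^+ 2 - sqnorm y).
(** The quotient ((1 + x)^k - 1) / x, written without division so that its limit k at x = 0 is
    visible. *)
Let E (k : nat) (x : R) := \sum_(i < k) (1 + x) ^+ i.

Let h0 m : 0 < h m. Proof. by rewrite invr_gt0 ltr0n. Qed.
Let h1 m : h m <= 1. Proof. by rewrite invf_le1 ?ltr0n// ler1n. Qed.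

Let geom k (x : R) : (1 + x) ^+ k - 1 = x * E k x.
Proof. by rewrite subrX1 addrAC subrr add0r. Qed.

Let cvgE k : (fun m => E k (h m)) @ \oo --> (k%:R : R).
Proof.
have -> : k%:R = E k 0.
  by rewrite /E; under eq_bigr do rewrite addr0 expr1n; rewrite sumr_const card_ord.
rewrite /E; elim: (index_enum _) => [|i s IH].
  by rewrite big_nil; under eq_fun do rewrite big_nil; exact: cvg_cst.
rewrite big_cons; under eq_fun do rewrite big_cons.
apply: cvgD => //.
apply: (@continuous_cvg _ _ _ _ _ _ (fun y : R => y ^+ i)); first exact: exprn_continuous.
by apply: cvgD; [exact: cvg_cst|exact: cvg_harmonic].
Qed.

Let mS r : measurable_fun setT (S r).
Proof.
apply: (continuous_measurable_rV openT) => x _.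
apply: (@continuous_comp _ _ _ (fun y => r ^+ 2 - sqnorm y) (@Num.sqrt R)).
  apply: (@continuousB _ _ _ (fun=> r ^+ 2) (@sqnorm R d)).
    exact: cst_continuous.
  exact: continuous_sqnorm.
exact: sqrt_continuous.
Qed.

Let S0 r y : 0 <= S r y. Proof. exact: sqrtr_ge0. Qed.

Let intS r : 0 < r ->
  (\int[mu]_y (S r y)%:E = (2^-1 * (r ^+ d.+1 * ball_vol R d.+1))%:E)%E.
Proof.
move=> r0; have := lebesgue_eball_slices d (ltW r0).
rewrite lebesgue_eball//; under eq_integral do rewrite EFinM.
rewrite ge0_integralZl//.
- move=> H; rewrite EFinM H muleA -EFinM mulVf// ?mul1e//.
- by apply/measurable_EFinP; exact: mS.
Qed.

Let le_S r r' y : 0 <= r -> r <= r' -> S r y <= S r' y.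
Proof.
move=> r0 rr'; rewrite ler_wsqrtr// lerD2r lerXn2r// nnegrE//.
exact: le_trans rr'.
Qed.

Let intdiff m : (\int[mu]_y ((S (1 + h m) y - S 1 y) / h m)%:E =
  (2^-1 * ball_vol R d.+1 * E d.+1 (h m))%:E)%E.
Proof.
have r0 : 0 < 1 + h m by rewrite addr_gt0.
have iS r : 0 < r -> mu.-integrable setT (EFin \o S r).
  move=> r0'; apply/integrableP; split; first by apply/measurable_EFinP; exact: mS.
  under eq_integral do rewrite gee0_abs ?lee_fin//.
  by rewrite intS// ltry.
have iB : mu.-integrable setT (EFin \o (fun y => S (1 + h m) y - S 1 y)).
  exact: (integrableB measurableT (iS _ r0) (iS _ ltr01)).
under eq_integral do rewrite EFinM.
rewrite (integralZr measurableT iB).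
rewrite integralB_EFin//; [|exact: iS|exact: iS].
rewrite !intS// -EFinB -EFinM; congr _%:E.
have -> : 2^-1 * ((1 + h m) ^+ d.+1 * ball_vol R d.+1) - 2^-1 * (1 ^+ d.+1 * ball_vol R d.+1) =
  2^-1 * ball_vol R d.+1 * ((1 + h m) ^+ d.+1 - 1) by rewrite expr1n; ring.
rewrite geom; have x0 : h m != 0 by rewrite gt_eqF.
by field.
Qed.

Let q m y := (S (1 + h m) y - S 1 y) / h m.

Let q_ge0 m y : 0 <= q m y.
Proof.
by rewrite divr_ge0 ?(ltW (h0 m))// subr_ge0 le_S// lerDl ltW.
Qed.

Let mq m : measurable_fun setT (q m).
Proof. by apply: measurable_funM => //; apply: measurable_funB; exact: mS. Qed.

(** Outside the unit ball the quotient lives on the shell 1 <= |y| < 1 + h, whose volume is O(h).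
    There it is at most sqrt (3 h) / h, as (1 + h)^2 - 1 <= 3 h for h <= 1. The integral is thus
    O(sqrt h). *)
Let tail m : (\int[mu]_(y in ~` @eball R d 1) (q m y)%:E <=
  (Num.sqrt (3 * h m) * (ball_vol R d * E d (h m)))%:E)%E.
Proof.
have r0 : 0 < 1 + h m by rewrite addr_gt0.
have mB1 : measurable (~` @eball R d 1) by apply: measurableC; exact: measurable_eball.
have mBr : measurable (@eball R d (1 + h m)) by exact: measurable_eball.
pose c := Num.sqrt (3 * h m) / h m.
have c0 : 0 <= c by rewrite divr_ge0 ?sqrtr_ge0// ltW.
apply: (@le_trans _ _ (\int[mu]_(y in ~` @eball R d 1) (c%:E * (\1_(@eball R d (1 + h m)) y)%:E))%E).
  apply: ge0_le_integral => //.
  - by move=> y _; rewrite lee_fin.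
  - by apply/measurable_EFinP; exact: measurable_funS (mq m).
  - apply: emeasurable_funM => //; apply/measurable_EFinP.
    exact: measurable_indic.
  move=> y /= y1'; have y1 : 1 <= enorm y by rewrite leNgt; apply/negP.
  have N1 : 1 <= sqnorm y by rewrite -sqr_enorm exprn_ege1.
  rewrite -EFinM lee_fin /q /c mulrAC ler_pM2r ?invr_gt0//.
  rewrite {2}/S ler0_sqrtr ?subr0; last by rewrite expr1n subr_le0.
  rewrite indicE; have [yr|yr] := ltP (enorm y) (1 + h m).
    rewrite mem_set//= mulr1 ler_wsqrtr//.
    by have := h0 m; have := h1 m; move: (h m) => hm ? ?; nra.
  rewrite memNset//=; last by move=> /=; apply/negP; rewrite -leNgt.
  rewrite mulr0 /S ler0_sqrtr// subr_le0 -sqr_enorm lerXn2r ?nnegrE ?enorm_ge0//.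
  exact: ltW.
rewrite ge0_integralZl//; last by apply/measurable_EFinP; exact: measurable_indic.
rewrite integral_indic// -setDE.
have D0 : mu (@eball R d (1 + h m) `\` @eball R d 1) =
    (ball_vol R d * ((1 + h m) ^+ d - 1))%:E.
  have I1 : @eball R d (1 + h m) `&` @eball R d 1 = eball 1.
    apply/setIidr => y /=; rewrite /eball/= => /lt_trans; apply.
    by rewrite ltrDl.
  have D1 : (mu (@eball R d (1 + h m) `\` @eball R d 1) =
      mu (@eball R d (1 + h m)) - mu (@eball R d (1 + h m) `&` @eball R d 1))%E.
    by apply: measureD => //; [exact: measurable_eball|exact: lebesgue_eball_lty].
  rewrite D1 I1 !lebesgue_eball// expr1n mul1r -EFinB; congr _%:E.
  by ring.
rewrite [X in (_ * X)%E]D0 -EFinM lee_fin.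
rewrite geom /c le_eqVlt; apply/orP; left; apply/eqP.
have x0 : h m != 0 by rewrite gt_eqF.
by field.
Qed.

Let q_cvg y : enorm y < 1 -> q ^~ y @ \oo --> (Num.sqrt (1 - sqnorm y))^-1.
Proof.
move=> y1; have N1 : 0 < 1 - sqnorm y.
  by rewrite subr_gt0 -sqr_enorm expr_lt1// enorm_ge0.
set s := Num.sqrt (1 - sqnorm y).
have s0 : 0 < s by rewrite sqrtr_gt0.
have S1 : S 1 y = s by rewrite /S expr1n.
(* Rationalising the difference of square roots leaves (1 + h)^2 - 1 = h (2 + h) in the
   numerator. *)
have -> : q ^~ y = (fun m => (2 + h m) / (S (1 + h m) y + s)).
  apply/funext => m; rewrite /q S1.
  have D0 : 0 < S (1 + h m) y + s by rewrite ltr_wpDl.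
  have e1 : S (1 + h m) y ^+ 2 = (1 + h m) ^+ 2 - sqnorm y.
    rewrite sqr_sqrtr//; have := h0 m; move: (h m) => hm ?; nra.
  have e2 : s ^+ 2 = 1 - sqnorm y by rewrite sqr_sqrtr// ltW.
  have hn0 : h m != 0 by rewrite gt_eqF.
  apply: (mulIf (lt0r_neq0 D0)); rewrite [RHS]divfK ?gt_eqF// mulrAC.
  apply: (mulIf hn0); rewrite [LHS]divfK//.
  by transitivity (S (1 + h m) y ^+ 2 - s ^+ 2); [ring|rewrite e1 e2; ring].
have -> : s^-1 = (2 + 0) / (S (1 + 0) y + s).
  have ss : s + s = 2 * s by ring.
  by rewrite !addr0 S1 ss invfM mulrA mulfV ?mul1r.
apply: cvgM; first by apply: cvgD; [exact: cvg_cst|exact: cvg_harmonic].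
apply: cvgV; first by rewrite addr0 S1 gt_eqF// addr_gt0.
apply: cvgD; last exact: cvg_cst.
apply: (@continuous_cvg _ _ _ _ _ (fun m => 1 + h m) (fun r => S r y)).
  rewrite /S; apply: (@continuous_comp R R R (fun r : R => r ^+ 2 - sqnorm y) (@Num.sqrt R)).
    apply: (@continuousB _ _ _ (fun r : R => r ^+ 2) (fun=> sqnorm y)).
      exact: exprn_continuous.
    exact: cst_continuous.
  exact: sqrt_continuous.
by apply: cvgD; [exact: cvg_cst|exact: cvg_harmonic].
Qed.

Let q_nd y : enorm y < 1 -> nondecreasing_seq (q ^~ y).
Proof.
move=> y1 m k mk; apply: sqrt_slope_le => //.
- exact: sqnorm_ge0.
- by rewrite -sqr_enorm expr_le1 ?enorm_ge0// ltW.
- by rewrite lef_pV2 ?posrE ?ltr0n// ler_nat.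
Qed.

(* Slicing gives [|B_r| = 2 \int sqrt (r^2 - |y|^2) dy = V r^(d+1)]; both sides
   are differentiated at [r = 1]. *)
Lemma sphere_area_ball_vol : sphere_area R d = (d.+1%:R * ball_vol R d.+1)%:E.
Proof.
have mB1 : measurable (@eball R d 1) by exact: measurable_eball.
have mB1C : measurable (~` @eball R d 1) by exact: measurableC.
have mqB m (D : set 'rV[R]_d) : measurable_fun D (EFin \o q m).
  by apply/measurable_EFinP; exact: measurable_funTS.
have split m : ((2^-1 * ball_vol R d.+1 * E d.+1 (h m))%:E =
   \int[mu]_(y in eball 1) (q m y)%:E + \int[mu]_(y in ~` eball 1) (q m y)%:E)%E.
  rewrite -intdiff -(setvU (@eball R d 1)) setUC ge0_integral_setU//.
  - exact: mqB.
  - by move=> y _; rewrite lee_fin; exact: q_ge0.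
  - by apply/disj_setPS => y [y1 ny1]; exact: ny1.
have T0 m : (0 <= \int[mu]_(y in ~` @eball R d 1) (q m y)%:E)%E.
  by apply: integral_ge0 => y _; rewrite lee_fin.
have Tfin m : (\int[mu]_(y in ~` @eball R d 1) (q m y)%:E)%E \is a fin_num.
  by rewrite ge0_fin_numE//; apply: le_lt_trans (tail m) _; rewrite ltry.
have Tcvg : (fun m => \int[mu]_(y in ~` @eball R d 1) (q m y)%:E)%E @ \oo --> 0%E.
  apply: (@squeeze_cvge _ _ _ _ (fun=> 0%E) _
    (fun m => (Num.sqrt (3 * h m) * (ball_vol R d * E d (h m)))%:E)).
  - by apply: nearW => m; rewrite T0 tail.
  - exact: cvg_cst.
  - apply: cvg_EFin; first exact: nearW.
    have -> : 0 = Num.sqrt (3 * 0) * (ball_vol R d * d%:R) :> R.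
      by rewrite mulr0 sqrtr0 mul0r.
    apply: cvgM; last by apply: cvgM; [exact: cvg_cst|exact: cvgE].
    apply: (@continuous_cvg _ _ _ _ _ _ (@Num.sqrt R)); first exact: sqrt_continuous.
    by apply: cvgM; [exact: cvg_cst|exact: cvg_harmonic].
have C1 : (fun m => \int[mu]_(y in eball 1) (q m y)%:E)%E @ \oo -->
    (2^-1 * ball_vol R d.+1 * d.+1%:R)%:E.
  have -> : (fun m => \int[mu]_(y in eball 1) (q m y)%:E)%E =
    (fun m => (2^-1 * ball_vol R d.+1 * E d.+1 (h m))%:E -
       \int[mu]_(y in ~` @eball R d 1) (q m y)%:E)%E.
    by apply/funext => m; rewrite split addeK.
  rewrite -[X in _ --> X]sube0; apply: cvgeB => //.
  apply: cvg_EFin; first exact: nearW.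
  by apply: cvgM; [exact: cvg_cst|exact: cvgE].
(* The limit integrand blows up at |y| = 1; the monotonicity of the quotients in [q_nd] takes the
   place of a majorant. *)
have C2 : (fun m => \int[mu]_(y in eball 1) (q m y)%:E)%E @ \oo -->
    (\int[mu]_(y in eball 1) limn (fun m => (q m y)%:E))%E.
  apply: cvg_monotone_convergence => //.
  - by move=> m; exact: mqB.
  - by move=> m y _; rewrite lee_fin.
have I1 := cvg_unique (@ereal_hausdorff R) C2 C1.
rewrite /sphere_area.
transitivity (2%:E * \int[mu]_(y in eball 1) limn (fun m => (q m y)%:E))%E.
  congr (_ * _)%E; apply: eq_integral => y; rewrite inE => y1.
  rewrite sphere_integrand//; apply/esym/cvg_lim => //.
  by apply: cvg_EFin; [exact: nearW|exact: q_cvg].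
rewrite I1.
transitivity (2 * (2^-1 * ball_vol R d.+1 * d.+1%:R))%:E; first by [].
by congr _%:E; field.
Qed.

End sphere_area.

(** * Integrals of radial functions *)

Section radial_integrals.
Context (R : realType).

(** An improper version, needed because the energy densities may blow up at an endpoint: exhaust by
    closed intervals and use monotone convergence. *)
Lemma ge0_FTC_oo (f G : R -> R) (a b A B : R) : a < b ->
  (forall x, a < x < b -> 0 <= f x) ->
  (forall x, a < x < b -> {for x, continuous f}) ->
  (forall x, a < x < b -> is_derive x 1 G (f x)) ->
  G x @[x --> a^'+] --> A -> G x @[x --> b^'-] --> B ->
  (\int[lebesgue_measure]_(x in `]a, b[) (f x)%:E = (B - A)%:E)%E.
Proof.
move=> ab f0 cf dG GA GB.
(* With [k.+2] the interval from a + e k to b - e k is already nondegenerate at k = 0. *)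
pose e (k : nat) : R := (b - a) / 2 * k.+2%:R^-1.
have e0 k : 0 < e k by rewrite mulr_gt0 ?divr_gt0 ?subr_gt0 ?invr_gt0.
have e_half k : e k < (b - a) / 2.
  by rewrite /e -[ltRHS]mulr1 ltr_pM2l ?divr_gt0 ?subr_gt0// invf_lt1 ?ltr1n.
have e_nd i j : (i <= j)%N -> e j <= e i.
  by move=> ij; rewrite ler_pM2l ?divr_gt0 ?subr_gt0// lef_pV2 ?posrE ?ltr0n// ler_nat.
have e_cvg : e k @[k --> \oo] --> 0.
  rewrite -[X in _ --> X](mulr0 ((b - a) / 2)).
  apply: cvgM; first exact: cvg_cst.
  by have := @cvg_harmonic R; rewrite -(cvg_shiftS); exact.
pose F k : set R := `[a + e k, b - e k]%classic.
have FU : \bigcup_k F k = `]a, b[%classic.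
  apply/seteqP; split=> x /=.
    move=> [k _]; rewrite /F/= !in_itv/= => /andP[h1 h2].
    by have := e0 k; move: (e k) h1 h2 => ek *; apply/andP; split; lra.
  rewrite in_itv/= => /andP[ax xb].
  have m0 : 0 < Num.min (x - a) (b - x) by rewrite lt_min !subr_gt0 ax.
  have [k _ /(_ k (leqnn k))] := (cvgr_lt _ e_cvg _ m0).
  rewrite /= lt_min => /andP[h1 h2]; exists k => //; rewrite /F/= in_itv/=.
  by move: (e k) h1 h2 => ek *; apply/andP; split; lra.
have ekab k : a + e k < b - e k by have := e_half k; move: (e k) => ek; lra.
have Fsub k x : F k x -> a < x < b.
  by move=> Fx; have : (\bigcup_k F k) x by [exists k]; rewrite FU/= in_itv/=.
have IF k : (\int[lebesgue_measure]_(x in F k) (f x)%:E =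
    (G (b - e k) - G (a + e k))%:E)%E.
  rewrite (@continuous_FTC2 _ f G) ?EFinB//.
  - by apply: continuous_in_subspaceT => x; rewrite inE => /Fsub; exact: cf.
  - have dGx x : x \in `[a + e k, b - e k]%R -> derivable G x 1.
      by move=> xk; have [] := dG x (Fsub k x xk).
    have cG x : x \in `[a + e k, b - e k]%R -> {for x, continuous G}.
      by move=> xk; apply/differentiable_continuous/derivable1_diffP/dGx.
    split.
    + by move=> x xk; apply: dGx; exact: subset_itv_oo_cc.
    + by apply: cvg_at_right_filter; apply: cG; rewrite in_itv/= lexx ltW.
    + by apply: cvg_at_left_filter; apply: cG; rewrite in_itv/= lexx ltW.
  - move=> x xk; rewrite derive1E; have xk' := subset_itv_oo_cc xk.
    by have [_ ->] := dG x (Fsub k x xk').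
have C1 : (fun k => \int[lebesgue_measure]_(x in F k) (f x)%:E)%E @ \oo -->
    (\int[lebesgue_measure]_(x in \bigcup_k F k) (f x)%:E)%E.
  apply: ge0_nondecreasing_set_cvg_integral.
  - apply/nondecreasing_seqP => k; apply/subsetPset => x; rewrite /F/= !in_itv/=.
    have := e_nd k k.+1 (leqnSn k); move: (e k) (e k.+1) => u v vu /andP[? ?].
    by apply/andP; split; lra.
  - by move=> k; exact: measurable_itv.
  - move=> k; apply/measurable_EFinP.
    apply: (@measurable_funS _ _ _ _ `]a, b[%classic) => //.
      by move=> x /Fsub; rewrite /= in_itv.
    apply: open_continuous_measurable_fun; first exact: interval_open.
    by move=> x; rewrite inE/= in_itv/=; exact: cf.
  - by move=> k x /Fsub xab; rewrite lee_fin f0.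
have C2 : (fun k => \int[lebesgue_measure]_(x in F k) (f x)%:E)%E @ \oo --> (B - A)%:E.
  rewrite (_ : (fun k => _) = (fun k => (G (b - e k) - G (a + e k))%:E)); last first.
    by apply/funext => k; exact: IF.
  apply: cvg_EFin; first exact: nearW.
  apply: cvgB.
    move/cvg_at_leftP : GB; apply; split.
      by move=> k; rewrite ltrBlDr ltrDl.
    by rewrite -[X in _ --> X]subr0; apply: cvgB => //; exact: cvg_cst.
  move/cvg_at_rightP : GA; apply; split.
    by move=> k; rewrite ltrDl.
  by rewrite -[X in _ --> X]addr0; apply: cvgD => //; exact: cvg_cst.
by rewrite -FU; exact: (cvg_unique (@ereal_hausdorff R) C1 C2).
Qed.

Variable n : nat.
Hypothesis n0 : (0 < n)%N.
Local Notation mu := (lebesgue_rV R n).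
Local Notation V := (ball_vol R n).

Lemma lebesgue_enormX_lt (t : R) : 0 <= t ->
  mu [set x : 'rV[R]_n | enorm x ^+ n < t] = (V * t)%:E.
Proof.
rewrite le_eqVlt => /predU1P[<-|t0].
  rewrite mulr0 (_ : [set _ | _] = set0) ?measure0//; apply/seteqP; split=> x //=.
  by rewrite ltNge exprn_ge0// enorm_ge0.
pose r := t `^ n%:R^-1.
have r0 : 0 < r by exact: powR_gt0.
have rn : r ^+ n = t.
  by rewrite -powR_mulrn ?ltW// -powRrM mulVf ?powRr1 ?ltW// pnatr_eq0 -lt0n.
rewrite mulrC -[X in (X * _)%:E]rn -(lebesgue_eball n r0); congr (mu _).
apply/seteqP; split=> x /=; rewrite /eball/= -{1}rn ltr_pXn2r ?nnegrE ?enorm_ge0 ?ltW//.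
Qed.

(** The set |x|^n < t has measure V t, linear in t. Hence the image of Lebesgue measure under |x|^n
    is V times Lebesgue measure; the n-th power is chosen to make this density constant. *)
Lemma ge0_integral_enormX (D : set R) (f : R -> \bar R) :
  measurable D -> D `<=` `[0, 1[%classic -> measurable_fun D f ->
  (forall t, D t -> (0 <= f t)%E) ->
  (\int[mu]_(x in [set x : 'rV[R]_n | D (enorm x ^+ n)%R]) f (enorm x ^+ n)%R =
   V%:E * \int[lebesgue_measure]_(t in D) f t)%E.
Proof.
move=> mD D01 mf f0.
pose rho (x : 'rV[R]_n) : measurableTypeR R := enorm x ^+ n.
have mrho : measurable_fun setT rho by apply: measurable_funX; exact: measurable_enorm.
have V0 : 0 <= V by rewrite ltW// ball_vol_gt0.
pose v : {nonneg R} := NngNum V0.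
have -> : (\int[mu]_(x in [set x : 'rV[R]_n | D (enorm x ^+ n)%R]) f (enorm x ^+ n)%R =
    \int[pushforward mu rho]_(t in D) f t)%E.
  by rewrite [RHS]ge0_integral_pushforward// => t; rewrite inE; exact: f0.
have -> : (V%:E * \int[lebesgue_measure]_(t in D) f t =
    \int[mscale v (@lebesgue_measure R)]_(t in D) f t)%E.
  by rewrite ge0_integral_mscale.
apply: eq_measure_integral => E mE ED.
(* After restriction to t < 1, respectively 0 <= t < 1, both measures are finite on rays, and they
   are compared on the rays t < x. *)
pose H : set R := `]-oo, 1[%classic.
pose J : set R := `[0, 1[%classic.
have mH : measurable H by exact: measurable_itv.
have mJ : measurable J by exact: measurable_itv.
have EH : E = E `&` H.
  apply/esym/setIidl => x Ex.
  by have := D01 _ (ED _ Ex); rewrite /H/= !in_itv/= => /andP[].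
have EJ : E = E `&` J by apply/esym/setIidl => x Ex; exact: D01 (ED _ Ex).
pose m2 : {measure set (measurableTypeR R) -> \bar R} := mscale v (mrestr (@lebesgue_measure R) mJ).
suff : mrestr (pushforward mu rho) mH E = m2 E.
  by rewrite [m2 E]/(v%:num%:E * lebesgue_measure (E `&` J))%E {1}/mrestr -EH -EJ.
have uniq := fun a b c => @measure_unique _ R (measurableTypeR R)
  (@RGenInftyO.G R) (fun k => `]-oo, k%:R[%classic) (RGenInftyO.measurableE R)
  a b c (mrestr (pushforward mu rho) mH).
apply: (uniq mrho _ _ _ m2) => //; clear uniq.
- move=> _ _ [x ->] [y ->]; exists (Num.min x y); apply/seteqP; split=> z /=;
    rewrite !in_itv/= lt_min; first by move=> [-> ->].
  by move=> /andP.
- by move=> k; exists k%:R.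
- apply/seteqP; split=> // x _; exists (Num.truncn `|x|).+1 => //=.
  by rewrite in_itv/= (le_lt_trans (ler_norm x))// truncnS_gt.
- move=> _ [x ->].
  pose y := Num.max 0 (Num.min x 1).
  have e1 : rho @^-1` (`]-oo, x[%classic `&` H) = [set x : 'rV[R]_n | enorm x ^+ n < y].
    apply/seteqP; split=> z; rewrite /rho/H/= !in_itv/= /y lt_max lt_min.
      by move=> [-> ->]; rewrite orbT.
    by rewrite ltNge exprn_ge0 ?enorm_ge0//= => /andP.
  have e2 : `]-oo, x[%classic `&` J = `[0, y[%classic.
    apply/seteqP; split=> z; rewrite /J/= !in_itv/= /y lt_max lt_min.
      by move=> [-> /andP[-> ->]]; rewrite orbT.
    by case: (ltP z 0) => //= z0 /andP[-> ->].
  have y0 : 0 <= y by rewrite /y le_max lexx.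
  transitivity (mu (rho @^-1` (`]-oo, x[%classic `&` H))); first by [].
  transitivity (V%:E * lebesgue_measure (`]-oo, x[%classic `&` J))%E; last by [].
  rewrite e1 e2 lebesgue_enormX_lt// lebesgue_measure_itv/= lte_fin.
  case: ifPn => [_|]; first by rewrite sube0 EFinM.
  by rewrite -leNgt => y0'; rewrite (_ : y = 0) ?mulr0 ?mule0//; apply/eqP; rewrite eq_le y0 y0'.
- move=> k.
  suff : (mu (rho @^-1` (`]-oo, k%:R[%classic `&` H)) < +oo)%E by [].
  apply: (@le_lt_trans _ _ (mu [set x : 'rV[R]_n | (enorm x ^+ n < 1)%R])).
    apply: le_measure; rewrite ?inE.
    + rewrite -[X in measurable X]setTI; apply: mrho => //; exact: measurableI.
    + rewrite -[X in measurable X]setTI.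
      exact: (mrho measurableT `]-oo, 1[%classic (measurable_itv _)).
    + by move=> x [_]; rewrite /H/= in_itv.
  by rewrite lebesgue_enormX_lt// ltry.
Qed.

End radial_integrals.

Section shells.
Context (R : realType) (n : nat).
Hypothesis n0 : (0 < n)%N.
Local Notation mu := (lebesgue_rV R n).
Local Notation V := (ball_vol R n).

Definition shell (a b : R) := [set x : 'rV[R]_n | a < enorm x /\ enorm x < b].

Lemma shellE a b : shell a b = (@enorm R n) @^-1` `]a, b[%classic.
Proof. by apply/seteqP; split=> x; rewrite /shell/= in_itv/=; [move=> [-> ->]|move=> /andP]. Qed.

Lemma open_shell a b : open (shell a b).
Proof.
rewrite shellE; apply: open_comp; last exact: interval_open.
by move=> x _; exact: continuous_enorm.
Qed.

Lemma measurable_shell a b : measurable (shell a b).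
Proof. by apply: open_measurable_rV; exact: open_shell. Qed.

(** With t = |x|^n and s = 1 + (ln t) / n one has dt / t = n ds, whence the factor n V. The weight 1
    / |x|^n is the n-th power of the length of the gradient of s. *)
Lemma integral_shell (a b : R) (F Phi : R -> R) (P Q : R) : 0 < a -> a < b -> b <= 1 ->
  (forall s, 1 + ln a < s < 1 + ln b -> 0 <= F s) ->
  (forall s, 1 + ln a < s < 1 + ln b -> {for s, continuous F}) ->
  (forall s, 1 + ln a < s < 1 + ln b -> is_derive s 1 Phi (F s)) ->
  Phi s @[s --> (1 + ln a)^'+] --> P -> Phi s @[s --> (1 + ln b)^'-] --> Q ->
  (\int[mu]_(x in shell a b) (F (1 + ln (enorm x)) / enorm x ^+ n)%:E =
   (n%:R * V * (Q - P))%:E)%E.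
Proof.
move=> a0 ab b1 F0 cF dPhi PhiP PhiQ.
have b0 : 0 < b := lt_trans a0 ab.
have nR0 : 0 < n%:R :> R by rewrite ltr0n.
have nR0' : n%:R != 0 :> R by rewrite gt_eqF.
pose sg (t : R) := 1 + n%:R^-1 * ln t.
have sgX x : 0 < x -> sg (x ^+ n) = 1 + ln x.
  by move=> x0; rewrite /sg lnXn// -[ln x *+ n]mulr_natl mulrA mulVf// mul1r.
have an0 : 0 < a ^+ n by rewrite exprn_gt0.
have anbn : a ^+ n < b ^+ n.
  by rewrite ltr_pXn2r ?nnegrE ?(ltW a0) ?(ltW b0).
have t0 t : a ^+ n < t < b ^+ n -> 0 < t by move=> /andP[? _]; exact: lt_trans an0 _.
have sg_lt t t' : 0 < t -> t < t' -> sg t < sg t'.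
  move=> t0' tt'; rewrite ltrD2l ltr_pM2l ?invr_gt0// ltr_ln ?posrE//.
  exact: lt_trans tt'.
have sgI t : a ^+ n < t < b ^+ n -> 1 + ln a < sg t < 1 + ln b.
  move=> tab; have t0' := t0 t tab; move: tab => /andP[at' tb].
  by apply/andP; split; rewrite -sgX//; exact: sg_lt.
have dsg (t : R) : 0 < t -> is_derive t 1 sg (n%:R^-1 / t).
  move=> t0'; have dl := is_derive1_ln t0'.
  have := is_deriveD (is_derive_cst (1 : R) t 1) (is_deriveZ n%:R^-1 dl).
  by rewrite add0r.
have csg (t : R) : 0 < t -> {for t, continuous sg}.
  by move=> t0'; apply/differentiable_continuous/derivable1_diffP; have [] := dsg t t0'.
pose f t := F (sg t) / t.
have cf (t : R) : a ^+ n < t < b ^+ n -> {for t, continuous f}.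
  move=> tab; apply: cvgM.
    by apply: (continuous_comp (csg t (t0 t tab))); apply: cF; exact: sgI.
  by apply: cvgV => //; rewrite gt_eqF// (t0 t tab).
have f0 (t : R) : a ^+ n < t < b ^+ n -> 0 <= f t.
  by move=> tab; rewrite divr_ge0 ?(ltW (t0 t tab))// F0// sgI.
have dom : shell a b = [set x : 'rV[R]_n | `]a ^+ n, b ^+ n[%classic (enorm x ^+ n)].
  apply/seteqP; split=> x; rewrite /shell/= in_itv/= !ltr_pXn2r ?nnegrE ?enorm_ge0 ?ltW//;
    by [move=> [-> ->]|move=> /andP].
have mf : measurable_fun `]a ^+ n, b ^+ n[%classic f.
  apply: open_continuous_measurable_fun; first exact: interval_open.
  by move=> x; rewrite inE/= in_itv/=; exact: cf.
pose D := `]a ^+ n, b ^+ n[%classic.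
transitivity (\int[mu]_(x in [set x : 'rV[R]_n | D (enorm x ^+ n)%R])
    (f (enorm x ^+ n)%R)%:E)%E.
  rewrite -[[set x | D _]]dom; apply: eq_integral => x; rewrite inE => -[ax xb].
  by rewrite /f sgX// (lt_trans a0).
rewrite (ge0_integral_enormX n0 (D := D) (f := fun t => (f t)%:E)); last 4 first.
- exact: measurable_itv.
- move=> t; rewrite /D/= !in_itv/= => tab; rewrite (ltW (t0 t tab))/=.
  by case/andP: tab => _ /lt_le_trans; apply; rewrite exprn_ile1// ltW.
- exact/measurable_EFinP.
- by move=> t; rewrite /D/= in_itv/= lee_fin; exact: f0.
pose G t := n%:R * Phi (sg t).
have dG (t : R) : a ^+ n < t < b ^+ n -> is_derive t 1 G (f t).
  move=> tab; have t0' := t0 t tab.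
  have dP := dPhi (sg t) (sgI t tab).
  have := is_deriveZ n%:R (is_derive_comp_line (dsg t t0') dP).
  congr is_derive; rewrite /GRing.scale/= /f.
  by field; rewrite nR0' gt_eqF.
have GA : G t @[t --> (a ^+ n)^'+] --> n%:R * P.
  apply/cvg_at_rightP => u [ua ucvg]; apply: cvgM; first exact: cvg_cst.
  move/cvg_at_rightP : PhiP; apply; split.
    by move=> k; rewrite -sgX//; exact: sg_lt.
  rewrite -sgX//; apply: (continuous_cvg _ _ ucvg); exact: csg.
have GB : G t @[t --> (b ^+ n)^'-] --> n%:R * Q.
  apply/cvg_at_leftP => u [ub ucvg]; apply: cvgM; first exact: cvg_cst.
  (* A sequence tending to b^n from the left may start at nonpositive reals, where the logarithm is
     meaningless; [v] agrees with it eventually and stays positive. *)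
  pose v k := Num.max (u k) (b ^+ n / 2).
  have bn0 : 0 < b ^+ n by rewrite exprn_gt0.
  have v0 k : 0 < v k by rewrite /v lt_max divr_gt0 ?orbT.
  have vb k : v k < b ^+ n by rewrite /v gt_max ub/= ltr_pdivrMr// ltr_pMr// ltr1n.
  have uv : \forall k \near \oo, u k = v k.
    have : b ^+ n / 2 < b ^+ n by rewrite ltr_pdivrMr// ltr_pMr// ltr1n.
    move=> /(cvgr_gt _ ucvg) H; near=> k; rewrite /v; apply/esym/max_idPl/ltW.
    by near: k.
  have vcvg : v @ \oo --> b ^+ n.
    by apply: (cvg_trans _ ucvg); apply: near_eq_cvg; apply: filterS uv => k ->.
  apply: (@cvg_trans _ ((fun k => Phi (sg (v k))) @ \oo)).
    by apply: near_eq_cvg; apply: filterS uv => k ->.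
  move/cvg_at_leftP : PhiQ; apply; split.
    by move=> k; rewrite -sgX//; exact: sg_lt.
  rewrite -sgX//; apply: (continuous_cvg _ _ vcvg); exact: csg.
rewrite (ge0_FTC_oo anbn f0 cf dG GA GB) -EFinM; congr _%:E.
by ring.
Unshelve. all: by end_near. Qed.

End shells.

(** * Weak gradients of functions of log |x| *)

Section gradients_on_open_sets.
Context (R : realType) (n : nat).
Implicit Types (x : 'rV[R]_n) (Omega D : set 'rV[R]_n) (u v : 'rV[R]_n -> R).
Implicit Types (g h : 'rV[R]_n -> 'rV[R]_n).
Local Notation mu := (lebesgue_rV R n).
Local Notation e_ := (@basis_vec R n).

Lemma eq_Lp D p u v : {in D, u =1 v} -> Lp D p u -> Lp D p v.
Proof.
move=> uv; rewrite /Lp; suff -> : u \_ D = v \_ D by [].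
by apply/funext => x; rewrite !patchE; case: ifPn => // /uv.
Qed.

Lemma eq_Lp_loc Omega p u v : {in Omega, u =1 v} -> Lp_loc Omega p u -> Lp_loc Omega p v.
Proof.
move=> uv Lu K cK KO; apply: eq_Lp (Lu K cK KO) => x; rewrite inE => Kx.
by apply: uv; rewrite inE; exact: KO.
Qed.

Lemma eq_weak_gradient Omega u v g h : {in Omega, u =1 v} -> {in Omega, g =1 h} ->
  weak_gradient Omega u g -> weak_gradient Omega v h.
Proof.
move=> uv gh [Lu Lg I]; split.
- exact: eq_Lp_loc uv Lu.
- by move=> i; apply: eq_Lp_loc (Lg i) => x Ox; rewrite gh.
- move=> psi tpsi i.
  transitivity (\int[mu]_(x in Omega) (u x * 'D_(e_ i) psi x)).
    by apply: eq_Rintegral => x Ox; rewrite uv.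
  by rewrite I//; congr (- _); apply: eq_Rintegral => x Ox; rewrite gh.
Qed.

(** Local integrability gives measurability on each closed box inside [Omega], and countably many
    boxes exhaust [Omega]. *)
Lemma Lp_loc_measurable Omega u : open Omega -> Lp_loc Omega 1 u -> measurable_fun Omega u.
Proof.
move=> oO Lu; have [D [a [b [abO OE]]]] := open_bigcup_boxes oO.
pose E k := if asbool (D k) then obox (a k) (b k) else set0.
have OE' : Omega = \bigcup_k E k.
  rewrite [LHS]OE; apply/seteqP; split => x [k].
    by move=> Dk xk; exists k => //; rewrite /E; case: asboolP.
  by move=> _; rewrite /E; case: asboolP => // Dk xk; exists k.
have mE k : measurable (E k).
  by rewrite /E; case: asboolP => // _; exact: measurable_obox.
rewrite OE'; apply/measurable_fun_bigcup => // k.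
rewrite /E; case: asboolP => [Dk|_]; last exact: measurable_fun_set0.
have mK : measurable (cbox (a k) (b k)) by exact: measurable_cbox.
have /LpE-/(_ mK)/integrableP[/measurable_EFinP mu_ _] := Lu _ (@cbox_compact _ _ (a k) (b k)) (abO k Dk).
by apply: measurable_funS mu_ => //; exact: obox_cbox.
Qed.

Lemma measurable_enorm_comp Omega g :
  (forall i, measurable_fun Omega (fun x => g x ord0 i)) ->
  measurable_fun Omega (fun x => enorm (g x)).
Proof.
move=> mg; have ms : measurable_fun setT (@Num.sqrt R).
  by apply: continuous_measurable_fun; exact: sqrt_continuous.
apply: (measurableT_comp ms) => /=.
by apply: measurable_sum => i; exact: measurable_funX.
Qed.

Lemma wgradP Omega u g : weak_gradient Omega u g -> weak_gradient Omega u (wgrad Omega u).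
Proof. by move=> wg; apply: (@getPex _ (weak_gradient Omega u)); exists g. Qed.

(** Almost everywhere uniqueness lets any explicit weak gradient stand in for the chosen one
    [wgrad]. *)
Lemma integral_wgrad Omega u g (k : nat) : open Omega -> weak_gradient Omega u g ->
  (\int[mu]_(x in Omega) (enorm (wgrad Omega u x) ^+ k)%:E =
   \int[mu]_(x in Omega) (enorm (g x) ^+ k)%:E)%E.
Proof.
move=> oO wg; have mO := open_measurable_rV oO.
have mm h : weak_gradient Omega u h ->
    measurable_fun Omega (fun x => (enorm (h x) ^+ k)%:E).
  move=> [_ Lh _]; apply/measurable_EFinP; apply: measurable_funX; apply: measurable_enorm_comp => i.
  exact: Lp_loc_measurable (Lh i).
apply: ge0_ae_eq_integral => //; [exact: (mm _ (wgradP wg))|exact: (mm _ wg)| | |].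
- by move=> x _; rewrite lee_fin exprn_ge0// enorm_ge0.
- by move=> x _; rewrite lee_fin exprn_ge0// enorm_ge0.
have := weak_gradient_unique oO (wgradP wg) wg.
by apply: filterS => x H Ox; rewrite H.
Qed.

Lemma Lp_integral D (k : nat) u : (0 < k)%N -> measurable D -> measurable_fun D u ->
  (\int[mu]_(x in D) (`|u x| ^+ k)%:E < +oo)%E -> Lp D k%:R u.
Proof.
move=> k0 mD mu_ Ik; rewrite /Lp inE; apply/andP; split; rewrite inE/=.
  exact/(measurable_restrictT u mD).
rewrite /finite_norm unlock /Lnorm.
have kR : (k%:R : R) != 0 by rewrite pnatr_eq0 -lt0n.
apply: poweR_lty; apply: le_lt_trans Ik; rewrite [leRHS]integral_mkcond.
rewrite le_eqVlt; apply/orP; left; apply/eqP; apply: eq_integral => x _ /=.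
rewrite !patchE; case: ifPn => _; last by rewrite normr0 powR0.
by rewrite powR_mulrn.
Qed.

End gradients_on_open_sets.

Section logarithmic_coordinate.
Context (R : realType) (n : nat).
Local Notation e_ := (@basis_vec R n).
Implicit Types x : 'rV[R]_n.

(** Written with |x|^2, a polynomial, so that smoothness away from the origin needs no square
    root. *)
Definition slog x : R := 1 + 2^-1 * ln (sqnorm x).

Lemma slogE x : 0 < enorm x -> slog x = 1 + ln (enorm x).
Proof.
move=> x0; rewrite /slog -sqr_enorm lnXn// -[ln _ *+ 2]mulr_natl mulrA mulVf ?mul1r//.
Qed.

(** The gradient of log |x|, of Euclidean length 1 / |x|. *)
Definition radial x : 'rV[R]_n := (sqnorm x)^-1 *: x.

Lemma enorm_radial (a : R) x : enorm (a *: radial x) = `|a| / enorm x.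
Proof.
rewrite /radial scalerA enormZ normrM normfV (ger0_norm (sqnorm_ge0 x)) -sqr_enorm.
have [->|x0] := eqVneq (enorm x) 0; first by rewrite mulr0 invr0 mulr0.
by field.
Qed.

Lemma sqnorm_gt0 x : 0 < enorm x -> 0 < sqnorm x.
Proof. by move=> x0; rewrite -sqr_enorm exprn_gt0. Qed.

Lemma Ck_on_slog (U : set 'rV[R]_n) k : open U -> (forall x, U x -> 0 < enorm x) ->
  Ck_on e_ U k slog.
Proof.
move=> oU U0; apply: Ck_onD => //; first exact: Ck_on_cst.
apply: Ck_onZ => //.
apply: (Ck_on_comp oU _ (Ck_on_sqnorm k oU) (Ck_R_ln R k)) => x Ux /=.
by apply: sqnorm_gt0; exact: U0.
Qed.

Lemma is_derive_slog x i : 0 < enorm x -> is_derive x (e_ i) slog (x ord0 i / sqnorm x).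
Proof.
move=> x0; have N0 := sqnorm_gt0 x0.
have dl := is_derive_comp_line (is_derive_sqnorm x i) (is_derive1_ln N0).
have := is_deriveD (is_derive_cst (1 : R) x (e_ i)) (is_deriveZ 2^-1 dl).
congr is_derive; rewrite add0r /GRing.scale/=.
by field; rewrite gt_eqF.
Qed.

Section radial_functions.
Variables (U : set 'rV[R]_n) (W : set R) (F dF : R -> R).
Hypothesis oU : open U.
Hypothesis U0 : forall x, U x -> 0 < enorm x.
Hypothesis UW : forall x, U x -> W (slog x).

Lemma Ck_on_radial k : Ck_R W k F -> Ck_on e_ U k (fun x => F (slog x)).
Proof. by move=> CF; exact: (Ck_on_comp oU UW (Ck_on_slog k oU U0) CF). Qed.

Lemma grad_radial x : (forall s, W s -> is_derive s 1 F (dF s)) -> U x ->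
  grad (fun x => F (slog x)) x = dF (slog x) *: radial x.
Proof.
move=> DF Ux; apply/rowP => i; rewrite grad_E !mxE.
have [_ ->] := is_derive_comp_line (is_derive_slog i (U0 Ux)) (DF _ (UW Ux)).
by rewrite [(sqnorm _)^-1 * _]mulrC.
Qed.

Lemma weak_gradient_radial : Ck_R W 1 F -> (forall s, W s -> is_derive s 1 F (dF s)) ->
  weak_gradient U (fun x => F (slog x)) (fun x => dF (slog x) *: radial x).
Proof.
move=> CF DF; apply: eq_weak_gradient (weak_gradient_C1 oU (Ck_on_radial CF)) => // x.
by rewrite inE; exact: grad_radial.
Qed.

End radial_functions.

End logarithmic_coordinate.

(** * One-variable estimates *)

Section absolute_powers.
Context (R : realType).
Implicit Types a s : R.

(* The library's [powR] is [1] at negative reals, so it is not continuous at 0. *)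
Definition apow a s := `|s| `^ a.

Lemma apowE a s : 0 <= s -> apow a s = s `^ a.
Proof. by move=> s0; rewrite /apow ger0_norm. Qed.

Lemma apow_ge0 a s : 0 <= apow a s.
Proof. exact: powR_ge0. Qed.

Lemma near_apow a s : 0 < s -> \near s, s `^ a = apow a s.
Proof.
by move=> s0; near=> t; rewrite apowE// ltW//; near: t; exact: lt_nbhsr.
Unshelve. all: by end_near. Qed.

Lemma is_derive_apow a s : 0 < s -> is_derive s 1 (apow a) (a * s `^ (a - 1)).
Proof.
move=> s0; apply: (near_eq_is_derive (near_apow a s0)).
exact: is_derive1_powR.
Qed.

Lemma is_derive_apow_onem a s : s < 1 ->
  is_derive s 1 (fun s => apow a (1 - s)) (- (a * (1 - s) `^ (a - 1))).
Proof.
move=> s1; have s0 : 0 < 1 - s by rewrite subr_gt0.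
have d1 : is_derive s 1 (fun s : R => 1 - s) (0 - 1).
  exact: (is_deriveB (is_derive_cst (1 : R) s 1) (is_derive_id s 1)).
have := is_derive_comp_line d1 (is_derive_apow a s0).
by congr is_derive; rewrite sub0r mulrN1.
Qed.

Lemma continuous_apow a : 0 < a -> continuous (apow a).
Proof.
move=> a0 s; have [->|s0] := eqVneq s 0.
  rewrite /continuous_at {2}/apow normr0 powR0 ?gt_eqF//.
  apply/cvgr0Pnorm_lt => e e0; pose d := e `^ a^-1.
  have d0 : 0 < d by exact: powR_gt0.
  have de : d `^ a = e by rewrite /d -powRrM mulVf ?powRr1 ?gt_eqF// ltW.
  have H : \forall t \near (0 : R), `|t| < d by exact: nbhs0_lt.
  apply: filterS H => t td; rewrite ger0_norm ?apow_ge0//.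
  by rewrite -de /apow gt0_ltr_powR// ?nnegrE ?(ltW d0).
apply: (@continuous_comp R R R (fun t : R => `|t|) (fun t => t `^ a)).
  exact: norm_continuous.
apply/differentiable_continuous/derivable1_diffP.
by apply: derivable_powR; rewrite in_itv/= andbT normr_gt0.
Qed.

End absolute_powers.

(** * The single crossing of u1 and u2 *)

Section crossing.
Context (R : realType).
Implicit Types x y : R.

Lemma ln_lt_tangent x y : 0 < x -> 0 < y -> x != y -> ln x < ln y + (x - y) / y.
Proof.
move=> x0 y0 xy; have xy0 : 0 < x / y by rewrite divr_gt0.
have l0 : ln (x / y) != 0.
  rewrite ln_eq0//; apply: contra xy => /eqP e.
  by rewrite -[x](divfK (lt0r_neq0 y0)) e mul1r.
have := expR_gt1Dx l0; rewrite lnK ?posrE// ln_div ?posrE// => h.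
have -> : (x - y) / y = x / y - 1 by rewrite mulrBl divff ?gt_eqF.
lra.
Qed.

Variables a1 a2 : R.
Hypotheses (a1_gt1 : 1 < a1) (a2_gt0 : 0 < a2) (a2_lt1 : a2 < 1).

Let a1_gt0 : 0 < a1 := lt_trans ltr01 a1_gt1.

(** The derivative of [g] below. The function [X] is the difference of the logarithms of its two
    terms; it has the same sign as [dg] and is a sum of concave functions. *)
Let dg (s : R) := a1 * s `^ (a1 - 1) - a2 * (1 - s) `^ (a2 - 1).
Let X (s : R) := ln a1 + (a1 - 1) * ln s - (ln a2 + (a2 - 1) * ln (1 - s)).

Let ln_term a b x : 0 < a -> 0 < x -> ln (a * x `^ b) = ln a + b * ln x.
Proof. by move=> a0 x0; rewrite lnM ?posrE ?powR_gt0// ln_powR. Qed.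

Let dg_ge0 (s : R) : 0 < s -> s < 1 -> (0 <= dg s) = (0 <= X s).
Proof.
move=> s0 s1; have s1' : 0 < 1 - s by rewrite subr_gt0.
by rewrite /dg /X !subr_ge0 -!ln_term// ler_ln ?posrE ?mulr_gt0 ?powR_gt0.
Qed.

Let dg_le0 (s : R) : 0 < s -> s < 1 -> (dg s <= 0) = (X s <= 0).
Proof.
move=> s0 s1; have s1' : 0 < 1 - s by rewrite subr_gt0.
by rewrite /dg /X !subr_le0 -!ln_term// ler_ln ?posrE ?mulr_gt0 ?powR_gt0.
Qed.

(* [X] is strictly concave, hence lies below its tangent at [c2]. *)
Let dg_no_dip (c1 c2 c3 : R) : 0 < c1 -> c1 < c2 -> c2 < c3 -> c3 < 1 ->
  0 <= dg c1 -> dg c2 <= 0 -> 0 <= dg c3 -> False.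
Proof.
move=> c10 c12 c23 c31.
have c20 := lt_trans c10 c12; have c30 := lt_trans c20 c23.
have c21 := lt_trans c23 c31; have c11 := lt_trans c12 c21.
rewrite !dg_ge0// dg_le0//.
pose k := (a1 - 1) / c2 + (a2 - 1) / (1 - c2).
have tangent c : 0 < c -> c < 1 -> c != c2 -> X c < X c2 + k * (c - c2).
  move=> c0 c1' cc2; have c1'' : 0 < 1 - c by rewrite subr_gt0.
  have c21' : 0 < 1 - c2 by rewrite subr_gt0.
  have t1 := ln_lt_tangent c0 c20 cc2.
  have cc2' : 1 - c != 1 - c2.
    by apply: contra cc2 => /eqP h; apply/eqP; lra.
  have t2 := ln_lt_tangent c1'' c21' cc2'.
  have -> : X c2 + k * (c - c2) = ln a1 + (a1 - 1) * (ln c2 + (c - c2) / c2) -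
     (ln a2 + (a2 - 1) * (ln (1 - c2) + ((1 - c) - (1 - c2)) / (1 - c2))).
    by rewrite /X /k; ring.
  have h1 : (a1 - 1) * ln c < (a1 - 1) * (ln c2 + (c - c2) / c2).
    by rewrite ltr_pM2l// subr_gt0.
  have h2 : (a2 - 1) * (ln (1 - c2) + ((1 - c) - (1 - c2)) / (1 - c2)) < (a2 - 1) * ln (1 - c).
    by rewrite ltr_nM2l// subr_lt0.
  by rewrite /X; move: h1 h2; lra.
move=> h1 h2 h3.
have t1 := tangent c1 c10 c11 (negbT (lt_eqF c12)).
have t3 := tangent c3 c30 c31 (negbT (gt_eqF c23)).
have [k0|k0] := leP 0 k.
  have : k * (c1 - c2) <= 0 by rewrite mulr_ge0_le0// subr_le0 ltW.
  lra.
have : k * (c3 - c2) <= 0 by rewrite mulr_le0_ge0 ?ltW// subr_gt0.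
lra.
Qed.

Let g (s : R) := apow a1 s + apow a2 (1 - s).

Let continuous_g : continuous g.
Proof.
move=> s; apply: cvgD; first exact: continuous_apow.
apply: (@continuous_comp R R R (fun t : R => 1 - t) (apow a2)).
  have [d1 _] : is_derive s 1 (fun t : R => 1 - t) (0 - 1).
    exact: (is_deriveB (is_derive_cst (1 : R) s 1) (is_derive_id s 1)).
  by apply/differentiable_continuous/derivable1_diffP.
exact: continuous_apow.
Qed.

Let derive_g (s : R) : 0 < s -> s < 1 -> is_derive s 1 g (dg s).
Proof.
move=> s0 s1; exact: (is_deriveD (is_derive_apow a1 s0) (is_derive_apow_onem a2 s1)).
Qed.

Let g_MVT (s t : R) : 0 <= s -> s < t -> t <= 1 ->
  exists c, [/\ s < c, c < t & g t - g s = dg c * (t - s)].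
Proof.
move=> s0 st t1.
have dg' x : x \in `]s, t[%R -> is_derive x 1 g (dg x).
  rewrite in_itv/= => /andP[sx xt]; apply: derive_g.
    exact: le_lt_trans sx.
  exact: lt_le_trans t1.
have cg : {within `[s, t], continuous g} by apply: continuous_subspaceT.
have [c /[!in_itv]/= /andP[sc ct] ->] := MVT st dg' cg.
by exists c.
Qed.

Variable s0 : R.
Hypotheses (s0_gt0 : 0 < s0) (s0_lt1 : s0 < 1).
Hypothesis s0_crossing : s0 `^ a1 + (1 - s0) `^ a2 = 1.

Let g0 : g 0 = 1.
Proof. by rewrite /g subr0 !apowE// powR0 ?powR1 ?add0r ?gt_eqF. Qed.

Let g1 : g 1 = 1.
Proof. by rewrite /g subrr !apowE// powR0 ?powR1 ?addr0 ?gt_eqF. Qed.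

Let gE (s : R) : 0 < s -> s < 1 -> g s = s `^ a1 + (1 - s) `^ a2.
Proof. by move=> /ltW s0' /ltW s1; rewrite /g !apowE// subr_ge0. Qed.

Let gs0 : g s0 = 1.
Proof. by rewrite gE. Qed.

(** Note that g = 1 at 0, s0 and 1. If g(s) >= 1, the mean value theorem on [0, s], [s, s0] and
    [s0, 1] yields derivatives >= 0, <= 0 and >= 0, against [dg_no_dip]. *)
Lemma crossing_lt s : 0 < s -> s < s0 -> s `^ a1 < 1 - (1 - s) `^ a2.
Proof.
move=> ss ss0; rewrite ltNge; apply/negP => h.
have s1 := lt_trans ss0 s0_lt1.
have gs : 1 <= g s by rewrite gE//; lra.
have [c1 [c1s c1t e1]] := g_MVT (lexx 0) ss (ltW s1).
have [c2 [c2s c2t e2]] := g_MVT (ltW ss) ss0 (ltW s0_lt1).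
have [c3 [c3s c3t e3]] := g_MVT (ltW s0_gt0) s0_lt1 (lexx 1).
apply: (@dg_no_dip c1 c2 c3) => //; [exact: lt_trans c2s|exact: lt_trans c3s| | |].
- by rewrite -(pmulr_lge0 _ (_ : 0 < s - 0)) ?subr0// -{1}[s]subr0 -e1 g0 subr_ge0.
- by rewrite -(pmulr_lle0 _ (_ : 0 < s0 - s)) ?subr_gt0// -e2 gs0 subr_le0.
- by rewrite -(pmulr_lge0 _ (_ : 0 < 1 - s0)) ?subr_gt0// -e3 gs0 g1 subrr.
Qed.

(** The same sign pattern arises on [0, s0], [s0, s] and [s, 1] if g(s) <= 1. *)
Lemma crossing_gt s : s0 < s -> s < 1 -> 1 - (1 - s) `^ a2 < s `^ a1.
Proof.
move=> s0s s1; rewrite ltNge; apply/negP => h.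
have ss := lt_trans s0_gt0 s0s.
have gs : g s <= 1 by rewrite gE//; lra.
have [c1 [c1s c1t e1]] := g_MVT (lexx 0) s0_gt0 (ltW s0_lt1).
have [c2 [c2s c2t e2]] := g_MVT (ltW s0_gt0) s0s (ltW s1).
have [c3 [c3s c3t e3]] := g_MVT (ltW ss) s1 (lexx 1).
apply: (@dg_no_dip c1 c2 c3) => //; [exact: lt_trans c2s|exact: lt_trans c3s| | |].
- by rewrite -(pmulr_lge0 _ (_ : 0 < s0 - 0)) ?subr0// -{1}[s0]subr0 -e1 g0 gs0 subrr.
- by rewrite -(pmulr_lle0 _ (_ : 0 < s - s0)) ?subr_gt0// -e2 gs0 subr_le0.
- by rewrite -(pmulr_lge0 _ (_ : 0 < 1 - s)) ?subr_gt0// -e3 g1 subr_ge0.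
Qed.

End crossing.

(** * Truncation and the smooth approximants *)

Section cutoff.
Context (R : realType).
Implicit Types e t : R.

(** Equal to (t - e) exp (- e / (t - e)) for t > e and to 0 for t <= e. It is smooth, tends to t as
    e -> 0 when t > 0, and has slope in [0, 1] whatever e is. *)
Definition cutoff e t := (t - e) * flat_pow 0 ((t - e) / e).
Definition dcutoff e t := flat_pow 0 ((t - e) / e) + flat_pow 1 ((t - e) / e).

Lemma cutoff_neq0 e t : 0 < e -> cutoff e t != 0 -> e < t.
Proof.
move=> e0; apply: contra_neqT; rewrite -leNgt => te.
by rewrite /cutoff /flat_pow ltNge ler_pdivrMr// mul0r subr_le0 te/= mulr0.
Qed.

Lemma cutoff_bound e t : 0 < e -> 0 <= t -> `|cutoff e t| <= t.
Proof.
move=> e0 t0; have [te|te] := leP t e.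
  have -> : cutoff e t = 0; last by rewrite normr0.
  by apply/eqP; apply: contraT => /(cutoff_neq0 e0); rewrite ltNge te.
have te' : 0 <= t - e by rewrite subr_ge0 ltW.
rewrite ger0_norm; last by rewrite mulr_ge0// flat_pow_ge0.
rewrite (@le_trans _ _ (t - e))//; last by rewrite gerBl ltW.
by rewrite ler_piMr// flat_le1.
Qed.

Lemma dcutoff_ge0 e t : 0 <= dcutoff e t.
Proof. by rewrite addr_ge0// flat_pow_ge0. Qed.

(** With y = (t - e) / e > 0 this is 1 + 1 / y <= exp (1 / y). *)
Lemma dcutoff_le1 e t : dcutoff e t <= 1.
Proof.
rewrite /dcutoff /flat_pow; case: ifPn => [y0|]; last by rewrite addr0.
rewrite expr0 expr1 invr1 -mulrDl -ler_pdivlMr ?expR_gt0// mul1r expRN invrK.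
exact: expR_ge1Dx.
Qed.

Lemma is_derive_cutoff e t : 0 < e -> is_derive t 1 (cutoff e) (dcutoff e t).
Proof.
move=> e0; have d1 : is_derive t 1 (fun t => t - e) (1 - 0).
  exact: (is_deriveB (is_derive_id t 1) (is_derive_cst e t 1)).
have d2 : is_derive t 1 (fun t => (t - e) / e) (e^-1 *: (1 - 0)).
  have := is_deriveZ e^-1 d1; congr is_derive; apply/funext => s.
  by rewrite mulrC.
have d3 := is_derive_comp_line d2 (is_derive_flat_pow 0 ((t - e) / e)).
have := is_deriveM d1 d3; congr is_derive.
rewrite /dcutoff /GRing.scale/= mul0r !subr0 !mulr1 addrC; congr (_ + _).
rewrite /flat_pow; case: ifPn => [y0|_]; last by rewrite mul0r mulr0.
have tn0 : t - e != 0 by apply: contraTneq y0 => ->; rewrite mul0r ltxx.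
by field; rewrite tn0 gt_eqF.
Qed.

Lemma Ck_R_cutoff e k : Ck_R setT k (cutoff e).
Proof.
have Cid : Ck_R [set: R] k (fun t => t - e).
  by apply: Ck_onB; [exact: openT|exact/Ck_R_id/openT|exact/Ck_on_cst/openT].
apply: Ck_onM => //; first exact: openT.
apply: (Ck_on_comp openT (fun _ _ => I) _ (Ck_R_flat_pow R k 0)).
by apply: Ck_onM => //; [exact: openT|exact/Ck_on_cst/openT].
Qed.

Section cutoff_limit.
Variables (t_ : nat -> R) (t : R).
Hypotheses (t0 : 0 < t) (t_cvg : t_ @ \oo --> t).
Let h (m : nat) : R := m.+1%:R^-1.
Let h0 m : 0 < h m. Proof. by rewrite invr_gt0 ltr0n. Qed.
(** The level [h m] and the argument [t_ m] move together, since the smoothed maximum also depends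
    on the level. Eventually [z m] is the reciprocal of the argument of [flat_pow], and both limits
    below follow from z -> 0. *)
Let z m := h m / (t_ m - h m).

Let th_cvg : (fun m => t_ m - h m) @ \oo --> t.
Proof. by rewrite -[X in _ --> X]subr0; apply: cvgB => //; exact: cvg_harmonic. Qed.

Let z_cvg : z @ \oo --> 0.
Proof.
rewrite -(mul0r t^-1); apply: cvgM; first exact: cvg_harmonic.
by apply: cvgV => //; rewrite gt_eqF.
Qed.

Let expz_cvg : (fun m => expR (- z m)) @ \oo --> (1 : R).
Proof.
rewrite -expR0 -oppr0.
apply: (@continuous_cvg _ _ _ _ _ (fun m => - z m) (@expR R)); first exact: continuous_expR.
exact: cvgN.
Qed.

Let near_pos : \forall m \near \oo, 0 < t_ m - h m.
Proof. exact: (cvgr_gt _ th_cvg). Qed.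

Let flatE k m : 0 < t_ m - h m ->
  flat_pow k ((t_ m - h m) / h m) = z m ^+ k * expR (- z m).
Proof.
move=> p; rewrite /flat_pow divr_gt0//; have -> : ((t_ m - h m) / h m)^-1 = z m by rewrite invf_div.
by rewrite -exprVn invf_div.
Qed.

Lemma cvg_cutoff : (fun m => cutoff (h m) (t_ m)) @ \oo --> t.
Proof.
rewrite -[X in _ --> X]mulr1; apply: (@cvg_trans _ ((fun m => (t_ m - h m) * expR (- z m)) @ \oo)).
  apply: near_eq_cvg; apply: filterS near_pos => m p.
  by rewrite /cutoff flatE// expr0 mul1r.
exact: cvgM.
Qed.

Lemma cvg_dcutoff : (fun m => dcutoff (h m) (t_ m)) @ \oo --> (1 : R).
Proof.
have -> : (1 : R) = (1 + 0) * 1 by rewrite addr0 mulr1.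
apply: (@cvg_trans _ ((fun m => (1 + z m) * expR (- z m)) @ \oo)).
  apply: near_eq_cvg; apply: filterS near_pos => m p.
  by rewrite /dcutoff !flatE// expr0 expr1 mulrDl.
by apply: cvgM => //; apply: cvgD => //; exact: cvg_cst.
Qed.

End cutoff_limit.

End cutoff.

Section approximants.
Context (R : realType).

Lemma powR_lt1 (s a : R) : 0 <= s -> s < 1 -> 0 < a -> s `^ a < 1.
Proof.
move=> s0 s1 a0; have := gt0_ltr_powR a0 (s0 : s \is Num.nneg) (ler01 : 1 \is Num.nneg) s1.
by rewrite powR1.
Qed.

Lemma powR_le1 (s a : R) : 0 <= s -> s <= 1 -> 0 <= a -> s `^ a <= 1.
Proof.
move=> s0 s1 a0; have := ge0_ler_powR a0 (s0 : s \is Num.nneg) (ler01 : 1 \is Num.nneg) s1.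
by rewrite powR1.
Qed.
Variables a1 a2 : R.
Hypotheses (a1_gt1 : 1 < a1) (a2_gt0 : 0 < a2) (a2_lt1 : a2 < 1).
Implicit Types s e : R.

(* [gap1] and [gap2] are [v - u1] and [v - u2] as functions of [s = 1 + ln |x|]. *)
Definition gap1 s := s - s `^ a1.
Definition gap2 s := s - (1 - (1 - s) `^ a2).
Definition dgap1 s := 1 - a1 * s `^ (a1 - 1).
Definition dgap2 s := 1 - a2 * (1 - s) `^ (a2 - 1).

(** The maximum of [gap1] and [gap2], in the form to which [weak_gradient_abs] and [sabs] apply. *)
Definition gap s := 2^-1 * (gap1 s + gap2 s + `|gap1 s - gap2 s|).
Definition dgap s :=
  2^-1 * (dgap1 s + dgap2 s + Num.sg (gap1 s - gap2 s) * (dgap1 s - dgap2 s)).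

(* [sabs e] smooths the absolute value in [gap], and [cutoff e] makes the result
   vanish near 0 and 1. *)
Definition sgap e s := 2^-1 * (gap1 s + gap2 s + sabs e (gap1 s - gap2 s)).
Definition dsgap e s := 2^-1 * (dgap1 s + dgap2 s +
  (gap1 s - gap2 s) / sabs e (gap1 s - gap2 s) * (dgap1 s - dgap2 s)).

Definition agap e s := cutoff e (sgap e s).
Definition dagap e s := dcutoff e (sgap e s) * dsgap e s.

Definition I01 := `]0, 1[%classic : set R.

Lemma open_I01 : open I01.
Proof. exact: interval_open. Qed.

Lemma I01P s : I01 s <-> 0 < s /\ s < 1.
Proof. by rewrite /I01/= in_itv/=; split=> [/andP[]|[-> ->]]. Qed.

Lemma Ck_R_gap1 k : Ck_R I01 k gap1.
Proof.
apply: Ck_onB; [exact: open_I01|exact/Ck_R_id/open_I01|].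
by apply: sub_Ck_on (Ck_R_powR k a1) => s /I01P[].
Qed.

Lemma Ck_R_gap2 k : Ck_R I01 k gap2.
Proof.
have Cid : Ck_R I01 k id by exact/Ck_R_id/open_I01.
have C1 : Ck_R I01 k (fun=> 1) by exact/Ck_on_cst/open_I01.
have Cm : Ck_R I01 k (fun s => 1 - s) by exact: (Ck_onB open_I01 C1 Cid).
apply: (Ck_onB open_I01 Cid); apply: (Ck_onB open_I01 C1).
apply: (Ck_on_comp open_I01 _ Cm (Ck_R_powR k a2)) => s /I01P[_ s1] /=.
by rewrite subr_gt0.
Qed.

Lemma Ck_R_gap_diff k : Ck_R I01 k (fun s => gap1 s - gap2 s).
Proof. exact: (Ck_onB open_I01 (Ck_R_gap1 k) (Ck_R_gap2 k)). Qed.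

Lemma Ck_R_gap_sum k : Ck_R I01 k (fun s => gap1 s + gap2 s).
Proof. exact: (Ck_onD open_I01 (Ck_R_gap1 k) (Ck_R_gap2 k)). Qed.

Lemma Ck_R_agap e k : 0 < e -> Ck_R I01 k (agap e).
Proof.
move=> e0.
have Csg : Ck_R I01 k (sgap e).
  apply: (Ck_onZ _ open_I01); apply: (Ck_onD open_I01 (Ck_R_gap_sum k)).
  exact: (Ck_on_comp open_I01 (fun _ _ => I) (Ck_R_gap_diff k) (Ck_R_sabs k e0)).
exact: (Ck_on_comp open_I01 (fun _ _ => I) Csg (Ck_R_cutoff e k)).
Qed.

Lemma is_derive_gap1 s : 0 < s -> is_derive s 1 gap1 (dgap1 s).
Proof.
move=> s0; exact: (is_deriveB (is_derive_id s 1) (is_derive1_powR a1 s0)).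
Qed.

Lemma is_derive_gap2 s : s < 1 -> is_derive s 1 gap2 (dgap2 s).
Proof.
move=> s1; have s1' : 0 < 1 - s by rewrite subr_gt0.
have d1 : is_derive s 1 (fun s : R => 1 - s) (0 - 1).
  exact: (is_deriveB (is_derive_cst (1 : R) s 1) (is_derive_id s 1)).
have d2 := is_derive_comp_line d1 (is_derive1_powR a2 s1').
have := is_deriveB (is_derive_id s 1) (is_deriveB (is_derive_cst (1 : R) s 1) d2).
by congr is_derive; rewrite /dgap2; ring.
Qed.

Lemma is_derive_agap e s : 0 < e -> 0 < s -> s < 1 ->
  is_derive s 1 (agap e) (dagap e s).
Proof.
move=> e0 s0 s1; have d1 := is_derive_gap1 s0; have d2 := is_derive_gap2 s1.
have d3 := is_derive_comp_line (is_deriveB d1 d2) (is_derive_sabs (gap1 s - gap2 s) e0).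
have d4 := is_deriveZ 2^-1 (is_deriveD (is_deriveD d1 d2) d3).
exact: (is_derive_comp_line d4 (is_derive_cutoff (sgap e s) e0)).
Qed.

Lemma gap1_gt0 s : 0 < s -> s < 1 -> 0 < gap1 s.
Proof.
move=> s0 s1; rewrite subr_gt0.
have -> : s `^ a1 = s * s `^ (a1 - 1) by rewrite mulr_powRB1// ?ltW// (lt_trans ltr01).
by rewrite gtr_pMr// powR_lt1 ?subr_gt0// ltW.
Qed.

Lemma gap2_le s : 0 < s -> s < 1 -> gap2 s <= (1 - s) `^ a2.
Proof. by move=> s0 s1; rewrite /gap2; lra. Qed.

Lemma gapE s : gap s = Num.max (gap1 s) (gap2 s).
Proof.
rewrite /gap; case: (leP (gap1 s) (gap2 s)) => h.
  by rewrite ler0_norm ?subr_le0//; field.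
by rewrite gtr0_norm ?subr_gt0//; field.
Qed.

Lemma gap_gt0 s : 0 < s -> s < 1 -> 0 < gap s.
Proof. by move=> s0 s1; rewrite gapE lt_max gap1_gt0. Qed.

Lemma gap_le s : 0 < s -> s < 1 -> gap s <= s.
Proof.
move=> s0 s1; rewrite gapE ge_max /gap1 /gap2 !gerBl powR_ge0/= subr_ge0.
have s1' : 0 <= 1 - s by rewrite subr_ge0 ltW.
have s1'' : 1 - s <= 1 by rewrite gerBl ltW.
by rewrite powR_le1// ltW.
Qed.

Lemma gap_le_sgap e s : gap s <= sgap e s.
Proof. by rewrite ler_pM2l// lerD2l sabs_ge. Qed.

Lemma sgap_le e s : 0 <= e -> sgap e s <= gap s + e / 2.
Proof. by move=> e0; have := sabs_le (gap1 s - gap2 s) e0; rewrite /sgap /gap; lra. Qed.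

Lemma cvg_sgap s : (fun m => sgap m.+1%:R^-1 s) @ \oo --> gap s.
Proof.
apply: cvgM; first exact: cvg_cst.
by apply: cvgD; [exact: cvg_cst|exact: cvg_sabs].
Qed.

Lemma cvg_agap s : 0 < s -> s < 1 -> (fun m => agap m.+1%:R^-1 s) @ \oo --> gap s.
Proof. by move=> s0 s1; apply: cvg_cutoff; [exact: gap_gt0|exact: cvg_sgap]. Qed.

(** This holds even where [gap1] and [gap2] meet: the slope of [sabs] at 0 and [Num.sg 0] are both
    0. *)
Lemma cvg_dagap s : 0 < s -> s < 1 -> (fun m => dagap m.+1%:R^-1 s) @ \oo --> dgap s.
Proof.
move=> s0 s1; rewrite -[X in _ --> X]mul1r; apply: cvgM.
  by apply: (cvg_dcutoff (gap_gt0 s0 s1)); exact: cvg_sgap.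
apply: cvgM; first exact: cvg_cst.
apply: cvgD; first exact: cvg_cst.
by apply: cvgM; [exact: cvg_sabs_ratio|exact: cvg_cst].
Qed.

Lemma agap_bound e s : 0 < e -> e <= 1 -> 0 < s -> s < 1 -> `|agap e s| <= 2.
Proof.
move=> e0 e1 s0 s1.
have g0 := gap_gt0 s0 s1; have g1 := gap_le s0 s1.
have sg := sgap_le s (ltW e0); have gs := gap_le_sgap e s.
apply: (le_trans (cutoff_bound e0 _)); lra.
Qed.

(** The constant collects |dgap1| <= 1 + a1 and |dgap2| <= 1 + a2 D, where D = (1 - s)^(a2 - 1) >=
    1. *)
Definition dbound s := (2 + a1 + a2) * (1 - s) `^ (a2 - 1).

(** A convex combination of P and Q with weights (1 + th) / 2 and (1 - th) / 2. It serves both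
    [dgap], where [th] is a sign, and [dsgap], where it is the slope of [sabs]. *)
Lemma mean_bound (P Q th : R) : `|th| <= 1 ->
  `|2^-1 * (P + Q + th * (P - Q))| <= `|P| + `|Q|.
Proof.
move=> th1.
have -> : 2^-1 * (P + Q + th * (P - Q)) = 2^-1 * (1 + th) * P + 2^-1 * (1 - th) * Q by ring.
move: th1; rewrite ler_norml => /andP[t1 t2].
apply: (le_trans (ler_normD _ _)); apply: lerD; rewrite normrM ler_piMl// ger0_norm; lra.
Qed.

Lemma dgap_sum_le s : 0 < s -> s < 1 -> `|dgap1 s| + `|dgap2 s| <= dbound s.
Proof.
move=> s0 s1; have a10 : 0 < a1 := lt_trans ltr01 a1_gt1.
have s1' : 0 < 1 - s by rewrite subr_gt0.
have h1 : s `^ (a1 - 1) <= 1.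
  by rewrite powR_le1// ?subr_ge0 ltW.
have h2 : 1 <= (1 - s) `^ (a2 - 1).
  have s01 : 0 < 1 - s <= 1 by rewrite s1' gerBl ltW.
  have a21 : a2 - 1 <= 0 by rewrite subr_le0 ltW.
  by have := ger_powR s01 a21; rewrite powRr0.
have p1 := powR_ge0 s (a1 - 1).
have b1 : `|dgap1 s| <= 1 + a1.
  apply: (le_trans (ler_normB _ _)); rewrite normr1 lerD2l normrM (ger0_norm p1) gtr0_norm//.
  by rewrite ler_piMr// ltW.
have b2 : `|dgap2 s| <= 1 + a2 * (1 - s) `^ (a2 - 1).
  apply: (le_trans (ler_normB _ _)); rewrite normr1 lerD2l ger0_norm//.
  by rewrite mulr_ge0 ?powR_ge0// ltW.
rewrite /dbound; move: ((1 - s) `^ (a2 - 1)) h2 b2 => D h2 b2.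
have : (1 + a1) * 1 <= (1 + a1) * D by rewrite ler_wpM2l// addr_ge0// ltW.
by lra.
Qed.

Lemma dgap_bound s : 0 < s -> s < 1 -> `|dgap s| <= dbound s.
Proof.
move=> s0 s1; apply: le_trans (dgap_sum_le s0 s1); apply: mean_bound.
by rewrite normr_sg; case: (_ != _).
Qed.

Lemma dagap_bound e s : 0 < e -> 0 < s -> s < 1 -> `|dagap e s| <= dbound s.
Proof.
move=> e0 s0 s1; apply: le_trans (dgap_sum_le s0 s1).
rewrite normrM ger0_norm ?dcutoff_ge0//.
apply: (@le_trans _ _ `|dsgap e s|); first by rewrite ler_piMl// dcutoff_le1.
by apply: mean_bound; exact: sabs_ratio_le1.
Qed.

(** A nonzero value means sgap > e, hence gap > e / 2, because smoothing adds at most e / 2. The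
    bound gap <= s keeps s away from 0; near 1 the constants [d1] and [d2] serve the cases where
    [gap1] or [gap2] exceeds e / 2. *)
Lemma agap_support e : 0 < e ->
  exists2 d : R, 0 < d & forall s, 0 < s -> s < 1 -> agap e s != 0 -> d <= s <= 1 - d.
Proof.
move=> e0; have a10 : 0 < a1 := lt_trans ltr01 a1_gt1.
pose d1 := (e / 2) ^+ 2 / a1; pose d2 := (e / 2) `^ a2^-1.
have e2 : 0 < e / 2 by rewrite divr_gt0.
have d10 : 0 < d1 by rewrite divr_gt0// exprn_gt0.
have d20 : 0 < d2 by exact: powR_gt0.
exists (Num.min (e / 2) (Num.min d1 d2)); first by rewrite !lt_min e2 d10.
move=> s s0 s1 /(cutoff_neq0 e0) es.
have ge2 : e / 2 < gap s by have := sgap_le s (ltW e0); lra.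
have se : e / 2 < s := lt_le_trans ge2 (gap_le s0 s1).
rewrite ge_min (ltW se)/= lerBrDr -lerBrDl !ge_min; apply/orP; right.
move: ge2; rewrite gapE lt_max => /orP[h|h]; apply/orP; [left|right]; last first.
  have h' := lt_le_trans h (gap2_le s0 s1).
  rewrite leNgt; apply/negP => sd; move: h'; apply/negP; rewrite -leNgt.
  have -> : e / 2 = d2 `^ a2 by rewrite /d2 -powRrM mulVf ?powRr1 ?gt_eqF// ltW.
  by rewrite ge0_ler_powR ?nnegrE ?ltW// subr_gt0.
(* [s ^ a1 >= 1 + a1 ln s >= 1 - a1 (1 / s - 1)] *)
have l1 : 1 + a1 * ln s <= s `^ a1.
  have -> : s `^ a1 = expR (a1 * ln s) by rewrite /powR gt_eqF.
  exact: expR_ge1Dx.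
have l2 : 1 - s^-1 <= ln s.
  have V0 : 0 < s^-1 by rewrite invr_gt0.
  have := expR_ge1Dx (ln s^-1); rewrite lnK ?posrE// lnV ?posrE//; lra.
have l3 : a1 * (1 - s^-1) <= a1 * ln s by rewrite ler_pM2l.
have l4 : e / 2 < a1 * (s^-1 - 1) by rewrite /gap1 in h; lra.
have l5 : (e / 2) * s < a1 * (1 - s).
  have -> : a1 * (1 - s) = a1 * (s^-1 - 1) * s by field; rewrite gt_eqF.
  by rewrite ltr_pM2r.
(* Since s > e / 2, the bound [l5] gives a1 (1 - s) > (e / 2)^2. *)
rewrite /d1 ler_pdivrMr// [(1 - s) * a1]mulrC (le_trans _ (ltW l5))//.
by rewrite expr2 ler_pM2l// ltW.
Qed.

End approximants.

(** * The Dirichlet integral on the annulus *)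

Section annulus.
Context (R : realType) (n : nat).
Hypothesis n0 : (0 < n)%N.
Local Notation mu := (lebesgue_rV R n).

Definition annulus := @shell R n (expR 1)^-1 1.

Lemma ln_invexp1 : ln (expR 1 : R)^-1 = -1.
Proof. by rewrite lnV ?posrE ?expR_gt0// expRK. Qed.

Lemma open_annulus : open annulus.
Proof. exact: open_shell. Qed.

Lemma measurable_annulus : measurable annulus.
Proof. exact: measurable_shell. Qed.

Lemma annulus_gt0 x : annulus x -> 0 < enorm x.
Proof. by move=> [+ _]; apply: lt_trans; rewrite invr_gt0 expR_gt0. Qed.

Lemma annulus_slogE x : annulus x -> slog x = 1 + ln (enorm x).
Proof. by move=> /annulus_gt0/slogE. Qed.

Lemma annulus_slog x : annulus x -> @I01 R (slog x).
Proof.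
move=> Ax; have x0 := annulus_gt0 Ax; have [x1 x2] := Ax.
have ei : 0 < (expR 1 : R)^-1 by rewrite invr_gt0 expR_gt0.
apply/I01P; rewrite annulus_slogE//; split.
  by rewrite -ltrBlDl sub0r -ln_invexp1 ltr_ln.
by rewrite gtrDl ln_lt0// x0.
Qed.

Lemma lebesgue_annulus_lty : (mu annulus < +oo)%E.
Proof.
apply: le_lt_trans (lebesgue_eball_lty n 1); apply: le_measure; rewrite ?inE.
- exact: measurable_annulus.
- exact: measurable_eball.
- by move=> x [].
Qed.

(** The sphere is the preimage of one point under |x|^n, whose image measure has a density. *)
Lemma lebesgue_sphere0 (r : R) : 0 < r -> r < 1 -> mu [set x | enorm x = r] = 0%E.
Proof.
move=> r0 r1; have rn1 : r ^+ n < 1 by rewrite exprn_ilt1// ?ltW// lt0n_neq0.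
have D01 : [set r ^+ n] `<=` `[0, 1[%classic.
  by move=> _ ->; rewrite /= in_itv/= rn1 exprn_ge0// ltW.
have := @ge0_integral_enormX R n n0 [set r ^+ n] (cst 1%E) (measurable_set1 _) D01
  (measurable_cst _) (fun _ _ => lee01).
rewrite !integral_cst//=; last first.
  have mX : measurable_fun setT (fun x : 'rV[R]_n => enorm x ^+ n).
    by apply: measurable_funX; exact: measurable_enorm.
  by rewrite -[X in measurable X]setTI; exact: (mX measurableT _ (measurable_set1 _)).
rewrite lebesgue_measure_set1 !mul1e mule0 => <-; congr (mu _).
apply/seteqP; split => x /= [].
  by move=> ->.
move=> /eqP; rewrite eqrXn2 ?enorm_ge0 ?(ltW r0)//.
by move/eqP.
Qed.

End annulus.

Section annulus_integrals.
Context (R : realType) (n : nat).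
Hypothesis n0 : (0 < n)%N.
Local Notation mu := (lebesgue_rV R n).
Local Notation V := (ball_vol R n).
Variable a : R.
Hypothesis b0 : 0 < n%:R * (a - 1) + 1.
(** The density (a s^(a - 1))^n has the antiderivative q s^b, where [q] is the constant that the
    exponent [a] determines in the statement; [b0] makes q s^b vanish at s = 0. *)
Let b := n%:R * (a - 1) + 1.
Let q := a ^+ n / (n%:R * a - n%:R + 1).

Let qb : q * b = a ^+ n.
Proof.
rewrite /q; have -> : n%:R * a - n%:R + 1 = b by rewrite /b; ring.
by rewrite divfK// gt_eqF.
Qed.

Let powE s : (a * s `^ (a - 1)) ^+ n = a ^+ n * s `^ (b - 1).
Proof.
rewrite exprMn; congr (_ * _).
by rewrite -powR_mulrn ?powR_ge0// -powRrM addrK; congr (_ `^ _); exact: mulrC.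
Qed.

Lemma integral_shell_powR (r : R) : 0 <= a -> (expR 1)^-1 < r -> r < 1 ->
  (\int[mu]_(x in shell (expR 1)^-1 r)
     ((a * (1 + ln (enorm x)) `^ (a - 1)) ^+ n / enorm x ^+ n)%:E =
   (n%:R * V * (q * (1 + ln r) `^ b))%:E)%E.
Proof.
move=> a0 er r1; have e0 : 0 < (expR 1 : R)^-1 by rewrite invr_gt0 expR_gt0.
have r0 : 0 < r := lt_trans e0 er.
have s0 : 0 < 1 + ln r by rewrite -ltrBlDl sub0r -ln_invexp1 ltr_ln.
pose F s := a ^+ n * s `^ (b - 1).
rewrite (eq_integral (fun x => (F (1 + ln (enorm x)) / enorm x ^+ n)%:E)); last first.
  by move=> x _; rewrite powE.
rewrite -[q * _]subr0; apply: (@integral_shell R n n0 _ _ F (fun s => q * apow b s)) => //.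
- exact: ltW.
- by move=> s _; rewrite mulr_ge0 ?powR_ge0// exprn_ge0.
- rewrite ln_invexp1 subrr => s /andP[s_gt0 _].
  have C : Ck_R [set s : R | 0 < s] 0 (fun s => a ^+ n * s `^ (b - 1)).
    by apply: Ck_onZ; [exact: open_gt|exact: (Ck_R_powR 0 (b - 1))].
  exact: (Ck_on_continuous C).
- rewrite ln_invexp1 subrr => s /andP[s_gt0 _].
  have := is_deriveZ q (is_derive_apow b s_gt0); congr is_derive.
  by rewrite /GRing.scale/= mulrA qb.
- rewrite ln_invexp1 subrr; apply: cvg_at_right_filter.
  have e : q * apow b 0 = 0 by rewrite apowE// powR0 ?gt_eqF// mulr0.
  by rewrite -[X in _ --> X]e; apply: cvgM; [exact: cvg_cst|exact: (continuous_apow b0)].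
- apply: cvg_at_left_filter; rewrite -apowE ?ltW//.
  by apply: cvgM; [exact: cvg_cst|exact: (continuous_apow b0)].
Qed.

(** The case r = 1 / e is included: over the whole annulus it yields the integrability of the
    majorant of all gradients. *)
Lemma integral_shell_powR_onem (r : R) : 0 <= a -> (expR 1)^-1 <= r -> r < 1 ->
  (\int[mu]_(x in shell r 1)
     ((a * (1 - (1 + ln (enorm x))) `^ (a - 1)) ^+ n / enorm x ^+ n)%:E =
   (n%:R * V * (q * (- ln r) `^ b))%:E)%E.
Proof.
move=> a0 er r1; have e0 : 0 < (expR 1 : R)^-1 by rewrite invr_gt0 expR_gt0.
have r0 : 0 < r := lt_le_trans e0 er.
have s0 : 0 < - ln r by rewrite oppr_gt0 ln_lt0// r0.
pose F s := a ^+ n * (1 - s) `^ (b - 1).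
rewrite (eq_integral (fun x => (F (1 + ln (enorm x)) / enorm x ^+ n)%:E)); last first.
  by move=> x _; rewrite powE.
have cPhi : continuous (fun s : R => (- q) * apow b (1 - s)).
  move=> s; apply: cvgM; first exact: cvg_cst.
  apply: (@continuous_comp _ _ _ (fun s : R => 1 - s) (apow b)); last exact: (continuous_apow b0).
  by apply: cvgB; [exact: cvg_cst|exact: cvg_id].
rewrite -[q * _]opprK -mulNr -sub0r.
apply: (@integral_shell R n n0 _ _ F (fun s => (- q) * apow b (1 - s))) => //.
- by move=> s _; rewrite mulr_ge0 ?powR_ge0// exprn_ge0.
- rewrite ln1 addr0 => s /andP[_ s1].
  have o1 : open [set s : R | s < 1] by exact: open_lt.
  have Cid : Ck_R [set s : R | s < 1] 0 id by exact: Ck_R_id.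
  have C1 : Ck_R [set s : R | s < 1] 0 (fun=> 1) by exact: Ck_on_cst.
  have Cm : Ck_R [set s : R | s < 1] 0 (fun s : R => 1 - s) by exact: Ck_onB.
  have C : Ck_R [set s : R | s < 1] 0 (fun s => a ^+ n * (1 - s) `^ (b - 1)).
    apply: (Ck_onZ _ o1); apply: (Ck_on_comp o1 _ Cm (Ck_R_powR 0 (b - 1))) => t /= t1.
    by rewrite subr_gt0.
  exact: (Ck_on_continuous C).
- rewrite ln1 addr0 => s /andP[_ s1].
  have := is_deriveZ (- q) (is_derive_apow_onem b s1); congr is_derive.
  by rewrite /GRing.scale/= mulrNN mulrA qb.
- apply: cvg_at_right_filter.
  have -> : - q * (- ln r) `^ b = - q * apow b (1 - (1 + ln r)).
    by rewrite apowE; [congr (_ * _ `^ _); ring|rewrite opprD addrA subrr sub0r ltW].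
  exact: cPhi.
- rewrite ln1 addr0; apply: cvg_at_left_filter.
  have e : - q * apow b (1 - 1) = 0 by rewrite subrr apowE// powR0 ?gt_eqF// mulr0.
  by rewrite -[X in _ --> X]e; exact: cPhi.
Qed.

Lemma integral_annulus_inv :
  (\int[mu]_(x in @annulus R n) (1 / enorm x ^+ n)%:E = (n%:R * V)%:E)%E.
Proof.
have e1 : (expR 1 : R)^-1 < 1 by rewrite invf_lt1 ?expR_gt0// expR_gt1.
rewrite -[n%:R * V]mulr1 -[X in _ * X]subr0.
apply: (@integral_shell R n n0 (expR 1)^-1 1 (fun=> 1) id) => //.
- by move=> s _; exact: cst_continuous.
- rewrite ln_invexp1 subrr; apply: cvg_at_right_filter; exact: cvg_id.
- rewrite ln1 addr0; apply: cvg_at_left_filter; exact: cvg_id.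
Qed.

End annulus_integrals.

(** * Weak gradient and energy of u *)

Section minimum.
Context (R : realType) (n : nat).
Local Notation mu := (lebesgue_rV R n).
Local Notation A := (@annulus R n).
Variables a1 a2 : R.

Definition umin (x : 'rV[R]_n) : R :=
  Num.min ((ln (enorm (expR 1 *: x))) `^ a1) (1 - (- ln (enorm x)) `^ a2).

Lemma uminE x : A x -> umin x = slog x - gap a1 a2 (slog x).
Proof.
move=> Ax; have x0 := annulus_gt0 Ax; have e0 := expR_gt0 (1 : R).
rewrite /umin enormZ gtr0_norm// lnM ?posrE// expRK -(annulus_slogE Ax).
have -> : - ln (enorm x) = 1 - slog x by rewrite (annulus_slogE Ax); ring.
rewrite gapE /gap1 /gap2.
move: (slog x `^ a1) ((1 - slog x) `^ a2) => P q; case: (leP (slog x - P)) => h.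
  by rewrite min_r; lra.
by rewrite min_l; lra.
Qed.

Lemma weak_gradient_slog : weak_gradient A (@slog R n) (fun x => 1 *: radial x).
Proof.
have Cid : Ck_R (@I01 R) 1 id by exact/Ck_R_id/open_I01.
have W := (weak_gradient_radial (@open_annulus R n) (@annulus_gt0 R n) (@annulus_slog R n)
  (dF := fun=> 1) Cid (fun s _ => is_derive_id s 1)).
exact: eq_weak_gradient W.
Qed.

Lemma weak_gradient_gap :
  weak_gradient A (fun x => gap a1 a2 (slog x)) (fun x => dgap a1 a2 (slog x) *: radial x).
Proof.
have oA := @open_annulus R n.
have dsum s : @I01 R s -> is_derive s 1 (fun s => gap1 a1 s + gap2 a2 s) (dgap1 a1 s + dgap2 a2 s).
  move=> /I01P[s0 s1]; exact: (is_deriveD (is_derive_gap1 a1 s0) (is_derive_gap2 a2 s1)).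
have ddiff s : @I01 R s -> is_derive s 1 (fun s => gap1 a1 s - gap2 a2 s) (dgap1 a1 s - dgap2 a2 s).
  move=> /I01P[s0 s1]; exact: (is_deriveB (is_derive_gap1 a1 s0) (is_derive_gap2 a2 s1)).
have W1 := weak_gradient_radial oA (@annulus_gt0 R n) (@annulus_slog R n)
  (Ck_R_gap_sum a1 a2 1) dsum.
have W2 := weak_gradient_abs oA (Ck_on_radial oA (@annulus_gt0 R n) (@annulus_slog R n)
  (Ck_R_gap_diff a1 a2 1)).
(* [weak_gradient_lin] scales only its first summand; the factor 1/2 is produced as - 1/2 f + f. *)
have W3 := weak_gradient_lin 1 oA W1 W2; have W4 := weak_gradient_lin (- 2^-1) oA W3 W3.
apply: eq_weak_gradient W4 => x; rewrite inE => Ax; first by rewrite /gap; field.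
rewrite (grad_radial (@annulus_gt0 R n) (@annulus_slog R n) ddiff Ax).
by rewrite /dgap; move: (radial x) => r; rewrite !scalerA -!scalerDl scalerA -scalerDl; congr (_ *: _); field.
Qed.

Lemma weak_gradient_umin :
  weak_gradient A umin (fun x => (1 - dgap a1 a2 (slog x)) *: radial x).
Proof.
have := weak_gradient_lin (-1) (@open_annulus R n) weak_gradient_gap weak_gradient_slog.
apply: eq_weak_gradient => x; rewrite inE => Ax; first by rewrite uminE//; ring.
by rewrite scalerA -scalerDl; congr (_ *: _); ring.
Qed.

Lemma integral_wgrad_radial (w : 'rV[R]_n -> R) (D : R -> R) :
  weak_gradient A w (fun x => D (slog x) *: radial x) ->
  (\int[mu]_(x in A) (enorm (wgrad A w x) ^+ n)%:E =
   \int[mu]_(x in A) (`|D (1 + ln (enorm x))| ^+ n / enorm x ^+ n)%:E)%E.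
Proof.
move=> W; rewrite (integral_wgrad n (@open_annulus R n) W); apply: eq_integral => x.
by rewrite inE => Ax; rewrite enorm_radial expr_div_n annulus_slogE.
Qed.

End minimum.

Section minimum_energy.
Context (R : realType) (n : nat).
Hypothesis n0 : (0 < n)%N.
Local Notation mu := (lebesgue_rV R n).
Local Notation V := (ball_vol R n).
Local Notation A := (@annulus R n).

(** Measurability is read off the components of the weak gradient, since [D] may jump. *)
Lemma measurable_radial_energy (w : 'rV[R]_n -> R) (D : R -> R) :
  weak_gradient A w (fun x => D (slog x) *: radial x) ->
  measurable_fun A (fun x => `|D (1 + ln (enorm x))| ^+ n / enorm x ^+ n).
Proof.
move=> [_ Lg _]; have mg i := Lp_loc_measurable (@open_annulus R n) (Lg i).
apply: eq_measurable_fun (measurable_funX n (measurable_enorm_comp mg)) => x.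
by rewrite inE => Ax; rewrite enorm_radial expr_div_n annulus_slogE.
Qed.

Variables a1 a2 r0 : R.
Hypotheses (a1_gt1 : 1 < a1) (a2_gt0 : 0 < a2) (a2_lt1 : a2 < 1).
Hypothesis b2_gt0 : 0 < n%:R * (a2 - 1) + 1.
Hypotheses (r0_gt : (expR 1)^-1 < r0) (r0_lt1 : r0 < 1).
Hypothesis crossing : (1 + ln r0) `^ a1 + (- ln r0) `^ a2 = 1.

Let r0_gt0 : 0 < r0.
Proof. by apply: lt_trans r0_gt; rewrite invr_gt0 expR_gt0. Qed.

Let s0_gt0 : 0 < 1 + ln r0.
Proof. by rewrite -ltrBlDl sub0r -ln_invexp1 ltr_ln// posrE invr_gt0 expR_gt0. Qed.

Let s0_lt1 : 1 + ln r0 < 1.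
Proof. by rewrite gtrDl ln_lt0// r0_gt0. Qed.

Let crossing' : (1 + ln r0) `^ a1 + (1 - (1 + ln r0)) `^ a2 = 1.
Proof. by rewrite opprD addrA subrr sub0r. Qed.

Lemma onem_dgap_lt s : 0 < s -> s < 1 + ln r0 -> 1 - dgap a1 a2 s = a1 * s `^ (a1 - 1).
Proof.
move=> ss ss0; have := crossing_lt a1_gt1 a2_gt0 a2_lt1 s0_gt0 s0_lt1 crossing' ss ss0.
move=> h; rewrite /dgap gtr0_sg; last by rewrite /gap1 /gap2; lra.
by rewrite /dgap1; field.
Qed.

Lemma onem_dgap_gt s : 1 + ln r0 < s -> s < 1 -> 1 - dgap a1 a2 s = a2 * (1 - s) `^ (a2 - 1).
Proof.
move=> ss0 s1; have := crossing_gt a1_gt1 a2_gt0 a2_lt1 s0_gt0 s0_lt1 crossing' ss0 s1.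
move=> h; rewrite /dgap ltr0_sg; last by rewrite /gap1 /gap2; lra.
by rewrite /dgap2; field.
Qed.

(** The annulus is split along |x| = r0. On that sphere [dgap] takes the mean of the two slopes,
    which does not matter as the sphere is null; on either side the density is a pure power of s or
    of 1 - s. *)
Lemma integral_wgrad_umin :
  (\int[mu]_(x in A) (enorm (wgrad A (umin a1 a2) x) ^+ n)%:E =
   (n%:R * V * (a1 ^+ n / (n%:R * a1 - n%:R + 1) * (1 + ln r0) `^ (n%:R * (a1 - 1) + 1)
     + a2 ^+ n / (n%:R * a2 - n%:R + 1) * (- ln r0) `^ (n%:R * (a2 - 1) + 1)))%:E)%E.
Proof.
have W := @weak_gradient_umin R n a1 a2.
rewrite (integral_wgrad_radial (D := fun s => 1 - dgap a1 a2 s) W).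
have mf := measurable_radial_energy (D := fun s => 1 - dgap a1 a2 s) W.
pose f x : R := `|1 - dgap a1 a2 (1 + ln (enorm (x : 'rV[R]_n)))| ^+ n / enorm x ^+ n.
rewrite -/f in mf *.
have f0 x : (0 <= (f x)%:E)%E.
  by rewrite lee_fin divr_ge0// ?exprn_ge0// enorm_ge0.
pose B := @shell R n (expR 1)^-1 r0; pose C := @shell R n r0 1.
pose S := [set x : 'rV[R]_n | enorm x = r0].
have mS : measurable S.
  rewrite -[X in measurable X]setTI.
  exact: ((@measurable_enorm R n) measurableT _ (measurable_set1 r0)).
have mB : measurable B by exact: measurable_shell.
have mC : measurable C by exact: measurable_shell.
have AE : A = B `|` (S `|` C).
  apply/seteqP; split => x.
    move=> [x1 x2]; have [h|h|h] := ltgtP (enorm x) r0; [left|right;right|right;left] => //.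
  move=> [[x1 x2]|[xr|[x1 x2]]]; split => //.
  - exact: lt_trans r0_lt1.
  - by rewrite /= xr.
  - by rewrite /= xr.
  - exact: lt_trans x1.
have mfA : measurable_fun A (EFin \o f) by exact/measurable_EFinP.
have mSC : measurable (S `|` C) by exact: measurableU.
have mfSC : measurable_fun (S `|` C) (EFin \o f).
  by apply: measurable_funS mfA; [exact: measurable_annulus|rewrite AE; exact: subsetUr].
have mfS : measurable_fun S (EFin \o f).
  by apply: measurable_funS mfSC => //; exact: subsetUl.
rewrite AE in mfA *.
have BSC : [disjoint B & S `|` C].
  by apply/disj_setPS => x [[_ x1] [/=xr|[x2 _]]]; move: x1; rewrite ?xr ?ltxx// ltNge (ltW x2).
have SC : [disjoint S & C].
  by apply/disj_setPS => x [/=xr [x2 _]]; move: x2; rewrite xr ltxx.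
transitivity (\int[mu]_(x in B `|` (S `|` C)) (EFin \o f) x)%E; first by [].
rewrite (ge0_integral_setU _ mB mSC mfA (fun x _ => f0 x) BSC).
rewrite (ge0_integral_setU _ mS mC mfSC (fun x _ => f0 x) SC).
rewrite [X in (_ + (X + _))%E](_ : _ = 0%E); last first.
  by apply: null_set_integral => //; exact: lebesgue_sphere0.
rewrite add0e mulrDr EFinD; congr (_ + _)%E.
- have b1 : 0 < n%:R * (a1 - 1) + 1 by rewrite ltr_wpDl// mulr_ge0// subr_ge0 ltW.
  rewrite -(integral_shell_powR n0 b1 _ r0_gt r0_lt1); last by rewrite (le_trans ler01)// ltW.
  apply: eq_integral => x; rewrite inE => -[x1 x2]; rewrite /= /f.
  have x0 : 0 < enorm x by apply: lt_trans x1; rewrite invr_gt0 expR_gt0.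
  rewrite onem_dgap_lt; last 2 first.
  + by rewrite -ltrBlDl sub0r -ln_invexp1 ltr_ln// posrE invr_gt0 expR_gt0.
  + by rewrite ltrD2l ltr_ln.
  by rewrite ger0_norm// mulr_ge0 ?powR_ge0// ltW// (lt_trans ltr01).
- rewrite -(integral_shell_powR_onem n0 b2_gt0 (ltW a2_gt0) (ltW r0_gt) r0_lt1).
  apply: eq_integral => x; rewrite inE => -[x1 x2]; rewrite /= /f.
  have x0 : 0 < enorm x by exact: lt_trans x1.
  rewrite onem_dgap_gt; last 2 first.
  + by rewrite ltrD2l ltr_ln.
  + by rewrite gtrDl ln_lt0// x0.
  by rewrite ger0_norm// mulr_ge0 ?powR_ge0// ltW.
Qed.

End minimum_energy.

(** * Membership of v - u in the Sobolev space with zero boundary values *)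

Lemma dominated_cvg0 d (T : measurableType d) (R : realType)
    (mu : {measure set T -> \bar R}) (D : set T) (f_ : nat -> T -> R) (g : T -> R) :
  measurable D -> (forall m, measurable_fun D (f_ m)) ->
  (forall x, D x -> f_ ^~ x @ \oo --> 0) ->
  mu.-integrable D (EFin \o g) -> (forall m x, D x -> `|f_ m x| <= g x) ->
  (\int[mu]_(x in D) (f_ m x)%:E)%E @[m --> \oo] --> 0%E.
Proof.
move=> mD mf f0 ig fg.
have [] := @dominated_convergence _ _ _ mu D mD (fun m => EFin \o f_ m) (cst 0%E) (EFin \o g).
- by move=> m; exact/measurable_EFinP.
- exact: measurable_cst.
- apply/aeW => x Dx; apply: cvg_EFin; first exact: nearW.
  exact: f0.
- exact: ig.
- by apply/aeW => x m Dx; rewrite lee_fin fg.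
by move=> _ _; rewrite integral0.
Qed.

Section gap_sobolev.
Context (R : realType) (n : nat).
Hypothesis n0 : (0 < n)%N.
Local Notation mu := (lebesgue_rV R n).
Local Notation A := (@annulus R n).
Variables a1 a2 : R.
Hypotheses (a1_gt1 : 1 < a1) (a2_gt0 : 0 < a2).
Hypothesis b2_gt0 : 0 < n%:R * (a2 - 1) + 1.

Definition annulus_agap e : 'rV[R]_n -> R := (fun x => agap a1 a2 e (slog x)) \_ A.

Lemma annulus_agapE e x : A x -> annulus_agap e x = agap a1 a2 e (slog x).
Proof. by move=> Ax; rewrite /annulus_agap patchE mem_set. Qed.

(** The bounds d <= s <= 1 - d of [agap_support] become exp (d - 1) <= |x| <= exp (- d), a compact
    shell K inside A. The function is smooth on A and 0 off K, and these two open sets cover the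
    space. *)
Lemma annulus_agap_test e : 0 < e -> test_function A (annulus_agap e).
Proof.
move=> e0; have [d d0 dP] := agap_support a1_gt1 a2_gt0 e0.
pose K := [set x : 'rV[R]_n | expR (d - 1) <= enorm x <= expR (- d)].
have cK : closed K.
  have -> : K = (@enorm R n) @^-1` `[expR (d - 1), expR (- d)]%classic.
    by apply/seteqP; split => x; rewrite /K/= in_itv.
  apply: preimage_closed; last exact: itv_closed.
  by move=> x _; exact: continuous_enorm.
have KA : K `<=` A.
  move=> x /andP[x1 x2]; split.
    by apply: lt_le_trans x1; rewrite -expRN ltr_expR ltrBrDl addrN.
  by apply: (le_lt_trans x2); rewrite -expR0 ltr_expR oppr_lt0.
have KC : compact K.
  have KB : K `<=` cbox (fun=> - 1) (fun=> 1); last first.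
    exact: subclosed_compact cK (@cbox_compact R n (fun=> - 1) (fun=> 1)) KB.
  move=> x /KA[_ x1] i /=.
  by rewrite in_itv/= -ler_norml (le_trans (coord_le_enorm x i))// ltW.
have supK x : annulus_agap e x != 0 -> K x.
  have [Ax|Ax] := pselect (A x); last first.
    by rewrite /annulus_agap patchE memNset// eqxx.
  rewrite annulus_agapE// => nz; have [s0 s1] := (I01P _).1 (annulus_slog Ax).
  have := dP _ s0 s1 nz; rewrite annulus_slogE// => /andP[l1 l2].
  have x0 := annulus_gt0 Ax.
  rewrite /K/= -[enorm x]lnK ?posrE// !ler_expR; apply/andP; split; lra.
have suppK : closure [set x | annulus_agap e x != 0] `<=` K.
  by rewrite [X in _ `<=` X]((closure_id K).1 cK); exact: closureS.
split.
- move=> k; apply/Ck_onT.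
  have -> : [set: 'rV[R]_n] = A `|` ~` K.
    apply/seteqP; split => // x _.
    by have [Kx|Kx] := pselect (K x); [left; exact: KA|right].
  apply: Ck_onU.
    apply: (eq_Ck_on (@open_annulus R n) _ (Ck_on_radial (@open_annulus R n)
      (@annulus_gt0 R n) (@annulus_slog R n) (Ck_R_agap a1 a2 k e0))) => x.
    by rewrite inE => Ax; rewrite annulus_agapE.
  apply: (eq_Ck_on _ _ (Ck_on_cst _ _ 0 _)); rewrite ?openC//.
  move=> x; rewrite inE => nK; apply/eqP; rewrite eq_sym; apply: contrapT => /negP.
  by move/supK.
- by apply: subclosed_compact KC suppK; exact: closed_closure.
- exact: subset_trans suppK KA.
Qed.

Lemma weak_gradient_agap e : 0 < e ->
  weak_gradient A (annulus_agap e) (fun x => dagap a1 a2 e (slog x) *: radial x).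
Proof.
move=> e0.
have D s : @I01 R s -> is_derive s 1 (agap a1 a2 e) (dagap a1 a2 e s).
  by move=> /I01P[s0 s1]; exact: is_derive_agap.
have := weak_gradient_radial (@open_annulus R n) (@annulus_gt0 R n)
  (@annulus_slog R n) (Ck_R_agap a1 a2 1 e0) D.
by apply: eq_weak_gradient => // x; rewrite inE => Ax; rewrite annulus_agapE.
Qed.

(** Up to a constant, [dbound] is 1 - dgap2 = a2 (1 - s)^(a2 - 1), the slope of u2 = s - gap2.
    Measurability comes from the weak gradient of u2 and finiteness from [integral_shell_powR_onem]
    with r = 1 / e. *)
Lemma integrable_dbound c : mu.-integrable A
  (EFin \o (fun x => (c * dbound a1 a2 (1 + ln (enorm x))) ^+ n / enorm x ^+ n)).
Proof.
have D s : @I01 R s -> is_derive s 1 (gap2 a2) (dgap2 a2 s).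
  by move=> /I01P[s0 s1]; exact: is_derive_gap2.
have W := weak_gradient_radial (@open_annulus R n) (@annulus_gt0 R n)
  (@annulus_slog R n) (Ck_R_gap2 a2 1) D.
have W2 := weak_gradient_lin (- 1) (@open_annulus R n) W (@weak_gradient_slog R n).
have W3 : weak_gradient A (fun x => - 1 * gap2 a2 (slog x) + slog x)
    (fun x => (1 - dgap2 a2 (slog x)) *: radial x).
  apply: eq_weak_gradient W2 => // x _.
  by rewrite scalerA -scalerDl; congr (_ *: _); ring.
have mh := measurable_radial_energy (D := fun s => 1 - dgap2 a2 s) W3.
pose h (x : 'rV[R]_n) : R := `|1 - dgap2 a2 (1 + ln (enorm x))| ^+ n / enorm x ^+ n.
have h0 x : 0 <= h x by rewrite divr_ge0// exprn_ge0// enorm_ge0.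
have ih : mu.-integrable A (EFin \o h).
  apply/integrableP; split; first exact/measurable_EFinP.
  rewrite (eq_integral (fun x => ((a2 * (1 - (1 + ln (enorm x))) `^ (a2 - 1)) ^+ n
    / enorm x ^+ n)%:E)); last first.
    move=> x _; rewrite /= ger0_norm// /h /dgap2 opprB addrCA subrr addr0.
    by rewrite ger0_norm// mulr_ge0 ?powR_ge0// ltW.
  have e1 : (expR 1 : R)^-1 < 1 by rewrite invf_lt1 ?expR_gt0// expR_gt1.
  by rewrite (integral_shell_powR_onem n0 b2_gt0 (ltW a2_gt0) (lexx _) e1) ltry.
have := @integrableZl _ _ _ mu A (@measurable_annulus R n) ((c * (2 + a1 + a2) / a2) ^+ n) _ ih.
apply: eq_integrable; first exact: measurable_annulus.
move=> x _; rewrite /= -EFinM /h mulrA; congr (_ / _)%:E.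
rewrite /dgap2 opprB addrCA subrr addr0 ger0_norm; last first.
  by rewrite mulr_ge0 ?powR_ge0// ltW.
by rewrite -exprMn /dbound; congr (_ ^+ _); field; rewrite gt_eqF.
Qed.

End gap_sobolev.

Section gap_W1p0.
Context (R : realType) (n : nat).
Hypothesis n0 : (0 < n)%N.
Local Notation mu := (lebesgue_rV R n).
Local Notation A := (@annulus R n).
Variables a1 a2 : R.
Hypotheses (a1_gt1 : 1 < a1) (a2_gt0 : 0 < a2) (a2_lt1 : a2 < 1).
Hypothesis b2_gt0 : 0 < n%:R * (a2 - 1) + 1.
Variable phi : 'rV[R]_n -> R.
Hypothesis phiE : forall x, A x -> phi x = gap a1 a2 (slog x).

Let oA := @open_annulus R n.
Let mA := @measurable_annulus R n.

Let Wphi : weak_gradient A phi (fun x => dgap a1 a2 (slog x) *: radial x).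
Proof.
have := @weak_gradient_gap R n a1 a2.
by apply: eq_weak_gradient => // x; rewrite inE => Ax; rewrite phiE.
Qed.

Let mphi : measurable_fun A phi.
Proof. by have [L _ _] := Wphi; exact: Lp_loc_measurable L. Qed.

Lemma W1p_gap : W1p A n%:R phi.
Proof.
split.
  apply: Lp_integral => //.
  apply: le_lt_trans (lebesgue_annulus_lty R n).
  rewrite -[leRHS]mul1e -integral_cst//; apply: ge0_le_integral => //.
  - apply/measurable_EFinP; apply: measurable_funX.
    exact: (measurableT_comp (@normr_measurable R setT) mphi).
  - move=> x Ax; have [s0 s1] := (I01P _).1 (annulus_slog Ax).
    rewrite lee_fin exprn_ile1// phiE// gtr0_norm ?gap_gt0//.
    by rewrite (le_trans (gap_le a1 a2_gt0 s0 s1))// ltW.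
exists (fun x => dgap a1 a2 (slog x) *: radial x); split => // i.
have [_ Lg _] := Wphi; have mg := Lp_loc_measurable oA (Lg i).
apply: Lp_integral => //.
have /integrableP[mD] := integrable_dbound n0 a1 a2_gt0 b2_gt0 1.
apply: le_lt_trans; apply: ge0_le_integral => //.
- apply/measurable_EFinP; apply: measurable_funX.
  exact: (measurableT_comp (@normr_measurable R setT) mg).
- exact: (measurableT_comp (@abse_measurable R setT) mD).
- move=> x Ax; have [s0 s1] := (I01P _).1 (annulus_slog Ax).
  have b := dgap_bound a1_gt1 a2_gt0 a2_lt1 s0 s1; have d0 := le_trans (normr_ge0 _) b.
  rewrite lee_fin (le_trans _ (ler_norm _))// -expr_div_n mul1r -annulus_slogE//.
  rewrite lerXn2r ?nnegrE//; first by rewrite divr_ge0// enorm_ge0.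
  rewrite (le_trans (coord_le_enorm _ i))// enorm_radial.
  by rewrite ler_wpM2r// invr_ge0 enorm_ge0.
Qed.

Lemma W1p_norm_pow_cvg0 :
  W1p_norm_pow A n%:R (phi \- annulus_agap a1 a2 m.+1%:R^-1) @[m --> \oo] --> 0%E.
Proof.
pose e m : R := m.+1%:R^-1.
have e0 m : 0 < e m by rewrite invr_gt0.
have e1 m : e m <= 1 by rewrite invf_le1// ler1n.
pose psi m := @annulus_agap R n a1 a2 (e m).
have We m : weak_gradient A (phi \- psi m)
    (fun x => (dgap a1 a2 (slog x) - dagap a1 a2 (e m) (slog x)) *: radial x).
  have := weak_gradient_lin (- 1) oA (@weak_gradient_agap R n a1 a2 _ (e0 m)) Wphi.
  apply: eq_weak_gradient => x _; first by rewrite mulN1r addrC.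
  by rewrite scalerA -scalerDl mulN1r addrC.
have cvgX (u : nat -> R) : u @ \oo --> 0 -> (fun m => `|u m| ^+ n) @ \oo --> 0.
  move=> u0; have z : `|0 : R| ^+ n = 0 by rewrite normr0 expr0n gtn_eqF.
  rewrite -[X in _ --> X]z.
  apply: (@continuous_cvg _ _ _ _ _ (fun m => `|u m|) (fun t : R => t ^+ n)).
    exact: exprn_continuous.
  by apply: cvg_norm.
have T1 : (\int[mu]_(x in A) (`|(phi \- psi m) x| ^+ n)%:E)%E @[m --> \oo] --> 0%E.
  (* On A, 0 < phi <= 1 and the approximants are at most 2 in absolute value; A has finite
     measure. *)
  apply: (@dominated_cvg0 _ _ _ mu A (fun m x => `|(phi \- psi m) x| ^+ n) (cst (3 ^+ n))) => //.
  - move=> m; have [L _ _] := We m; have := Lp_loc_measurable oA L => mw.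
    apply: measurable_funX.
    exact: (measurableT_comp (@normr_measurable R setT) mw).
  - move=> x Ax; apply: cvgX; have [s0 s1] := (I01P _).1 (annulus_slog Ax).
    rewrite /= phiE//; under eq_fun do rewrite /psi annulus_agapE//.
    rewrite -(subrr (gap a1 a2 (slog x))); apply: cvgB; first exact: cvg_cst.
    exact: cvg_agap.
  - apply/integrableP; split; first exact: (@measurable_cst _ _ _ _ A (3 ^+ n)%:E).
    rewrite [X in (X < _)%E](_ : _ = \int[mu]_(x in A) cst (`|3 ^+ n|%:E) x)%E//.
    by rewrite integral_cst// lte_mul_pinfty// lebesgue_annulus_lty.
  - move=> m x Ax; have [s0 s1] := (I01P _).1 (annulus_slog Ax).
    rewrite normrX normr_id lerXn2r ?nnegrE//= phiE// /psi annulus_agapE//.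
    have g0 := gap_gt0 a2 a1_gt1 s0 s1.
    have g1 := gap_le a1 a2_gt0 s0 s1.
    have b := agap_bound a1_gt1 a2_gt0 (e0 m) (e1 m) s0 s1.
    by apply: (le_trans (ler_normB _ _)); rewrite gtr0_norm//; lra.
have T2 : (\int[mu]_(x in A) (enorm (wgrad A (phi \- psi m) x) ^+ n)%:E)%E
    @[m --> \oo] --> 0%E.
  have E m := integral_wgrad_radial
    (D := fun s => dgap a1 a2 s - dagap a1 a2 (e m) s) (We m).
  under eq_fun do rewrite E.
  apply: (@dominated_cvg0 _ _ _ mu A _
    (fun x => (2 * dbound a1 a2 (1 + ln (enorm x))) ^+ n / enorm x ^+ n)) => //.
  - move=> m; exact: (measurable_radial_energy
      (D := fun s => dgap a1 a2 s - dagap a1 a2 (e m) s) (We m)).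
  - move=> x Ax; have [s0 s1] := (I01P _).1 (annulus_slog Ax).
    rewrite -annulus_slogE// -[X in _ --> X](mul0r (enorm x ^+ n)^-1).
    apply: cvgM; last exact: cvg_cst.
    apply: cvgX; rewrite -(subrr (dgap a1 a2 (slog x))); apply: cvgB; first exact: cvg_cst.
    exact: cvg_dagap.
  - exact: integrable_dbound.
  - move=> m x Ax; have [s0 s1] := (I01P _).1 (annulus_slog Ax).
    rewrite -annulus_slogE// ger0_norm; last first.
      by rewrite divr_ge0// exprn_ge0// enorm_ge0.
    rewrite ler_wpM2r ?invr_ge0 ?exprn_ge0 ?enorm_ge0//.
    have b1 := dgap_bound a1_gt1 a2_gt0 a2_lt1 s0 s1.
    have b2 := dagap_bound a1_gt1 a2_gt0 a2_lt1 (e0 m) s0 s1.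
    have b3 := le_trans (ler_normB _ _) (lerD b1 b2).
    have b4 : 0 <= 2 * dbound a1 a2 (slog x) 
      by rewrite mulr_natl mulr2n (le_trans _ b3).
    by rewrite lerXn2r ?nnegrE// mulr_natl mulr2n.
rewrite -[X in _ --> X]adde0 /W1p_norm_pow.
apply: cvgeD => //.
- by apply: cvg_trans T1; apply: near_eq_cvg; apply: nearW => m;
    apply: eq_integral => x _; rewrite powR_mulrn.
- by apply: cvg_trans T2; apply: near_eq_cvg; apply: nearW => m;
    apply: eq_integral => x _; rewrite powR_mulrn ?enorm_ge0.
Qed.

(** [phi] is prescribed on A alone, so that this applies to [slog - u] whatever its values outside
    A. *)
Lemma W1p_0_gap : W1p_0 A n%:R phi.
Proof.
split; first exact: W1p_gap.
move=> eps eps0.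
have /W1p_norm_pow_cvg0[N _ /(_ N (leqnn N)) H] : nbhs 0%E [set t : \bar R | (t < eps%:E)%E].
  apply: open_nbhs_nbhs; split; last by rewrite /= lte_fin.
  exact: open_ereal_lt_ereal.
by exists (annulus_agap a1 a2 N.+1%:R^-1) => //; apply: annulus_agap_test => //; rewrite invr_gt0.
Qed.

End gap_W1p0.

(** Strict positivity of v - u makes the set where the test function is nonzero all of [Omega], so
    the defining inequality compares full energies. *)
Lemma quasisuperminimizer_energy_le (R : realType) (n k : nat) (Omega : set 'rV[R]_n)
    (Q : R) (u v : 'rV[R]_n -> R) :
  quasisuperminimizer Omega k%:R Q u -> W1p_0 Omega k%:R (v \- u) ->
  (forall x, Omega x -> u x < v x) ->
  (\int[lebesgue_rV R n]_(x in Omega) (enorm (wgrad Omega u x) ^+ k)%:E <=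
   Q%:E * \int[lebesgue_rV R n]_(x in Omega) (enorm (wgrad Omega v x) ^+ k)%:E)%E.
Proof.
move=> [_ minu] W uv.
have uv0 x : Omega x -> 0 < (v \- u) x by move=> /uv; rewrite /= subr_gt0.
have /= := minu _ W (fun x Ox => ltW (uv0 x Ox)).
rewrite (_ : Omega `&` _ = Omega); last first.
  by apply/seteqP; split => [x []//|x Ox]; split => //=; rewrite gt_eqF// uv0.
have -> : u \+ (v \- u) = v by apply/funext => x; rewrite /= addrC subrK.
by congr (_ <= _ * _)%E; apply: eq_integral => x _; rewrite powR_mulrn ?enorm_ge0.
Qed.

Theorem mainTheorem2 (R : realType) (n : nat) (Q1 Q2 a1 a2 r0 : R) :
  (2 <= n)%N -> 1 < Q1 -> 1 < Q2 ->
  1 - n%:R^-1 < a2 -> a2 < 1 -> 1 < a1 ->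
  Q1 = a1 ^+ n / (n%:R * a1 - n%:R + 1) ->
  Q2 = a2 ^+ n / (n%:R * a2 - n%:R + 1) ->
  (expR 1)^-1 < r0 -> r0 < 1 ->
  1 = (- ln r0) `^ a2 + (ln (expR 1 * r0)) `^ a1 ->
  let A := [set x : 'rV[R]_n | (expR 1)^-1 < enorm x /\ enorm x < 1] in
  let u1 := fun x : 'rV[R]_n => (ln (enorm (expR 1 *: x))) `^ a1 in
  let u2 := fun x : 'rV[R]_n => 1 - (- ln (enorm x)) `^ a2 in
  let u := fun x : 'rV[R]_n => Num.min (u1 x) (u2 x) in
  let Qhat := Q1 * (ln (expR 1 * r0)) `^ (n%:R * (a1 - 1) + 1)
            + Q2 * (- ln r0) `^ (n%:R * (a2 - 1) + 1) in
  (\int[lebesgue_rV R n]_(x in A) ((enorm (wgrad A u x)) ^+ n)%:E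
     = sphere_area R n.-1 * Qhat%:E)%E /\
  (forall Q : R, Q < Qhat -> ~ quasisuperminimizer A n%:R Q u).
Proof.
move=> n2 _ _ a2_gt a2_lt1 a1_gt1 -> -> r0_gt r0_lt1 + A u1 u2 u Qhat.
have r0_gt0 : 0 < r0 by apply: lt_trans r0_gt; rewrite invr_gt0 expR_gt0.
have lnE : ln (expR 1 * r0) = 1 + ln r0 by rewrite lnM ?posrE ?expR_gt0// expRK.
rewrite {}/Qhat !lnE addrC => /esym crossing.
have n0 : (0 < n)%N by exact: ltnW.
have nR : 0 < n%:R :> R by rewrite ltr0n.
have a2_gt0 : 0 < a2.
  apply: le_lt_trans a2_gt; rewrite subr_ge0 invf_le1// ler1n//.
(* The lower bound on [a2] says precisely this: n (a2 - 1) + 1 = n (a2 - (1 - 1/n)). *)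
have b2_gt0 : 0 < n%:R * (a2 - 1) + 1.
  have : 0 < n%:R * (a2 - (1 - n%:R^-1)) by rewrite mulr_gt0// subr_gt0.
  by rewrite (_ : n%:R * _ = n%:R * (a2 - 1) + 1)//; field; rewrite gt_eqF.
have cE : sphere_area R n.-1 = (n%:R * ball_vol R n)%:E.
  by rewrite sphere_area_ball_vol prednK.
have energy := integral_wgrad_umin n0 a1_gt1 a2_gt0 a2_lt1 b2_gt0 r0_gt r0_lt1 crossing.
have energy_slog : (\int[lebesgue_rV R n]_(x in A) (enorm (wgrad A (@slog R n) x) ^+ n)%:E
    = (n%:R * ball_vol R n)%:E)%E.
  rewrite (integral_wgrad_radial (D := fun=> 1) (@weak_gradient_slog R n)).
  rewrite -(integral_annulus_inv R n0); apply: eq_integral => x _.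
  by rewrite normr1 expr1n.
split; first by rewrite cE -EFinM; exact: energy.
move=> Q QQ minu.
have phiE x : A x -> (@slog R n \- u) x = gap a1 a2 (slog x).
  by move=> Ax; rewrite /= -[u x]/(umin a1 a2 x) uminE// opprB addrCA subrr addr0.
have us x : A x -> u x < slog x.
  move=> Ax; have [s0 s1] := (I01P _).1 (annulus_slog Ax).
  by rewrite -subr_gt0 [_ - _]phiE// gap_gt0.
have := quasisuperminimizer_energy_le minu
  (W1p_0_gap n0 a1_gt1 a2_gt0 a2_lt1 b2_gt0 phiE) us.
move: energy energy_slog; rewrite -[umin a1 a2]/u.
move: (integral _ _ _) (integral _ _ _) => E1 E2 -> ->.
(* Both energies carry the factor n V, which is positive and cancels, leaving Qhat <= Q. *)
rewrite -EFinM lee_fin mulrC ler_pM2r; last by rewrite mulr_gt0// ball_vol_gt0.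
by rewrite leNgt QQ.
Qed.
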